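(* Let $\beta\in(0,1)$, $\mathsf{p}>12$ and $\mathsf{K}>0$. Let $w=\{w_{ij}\}_{i,j\ge 1}$ be independent real random variables on a probability space $(\Omega_w,\mathcal{F}_w,\mathbb{P}_w)$ with $\mathbb{E}_w w_{ij}=0$, $\mathbb{E}_w w_{ij}^2=1$ and $\mathbb{E}_w|w_{ij}|^{\mathsf{p}}\le \mathsf{K}$ for all $i,j$. For each $N$ put $B=\lfloor \beta N\rfloor$ and $$\Sigma_{N,N}=\bigl\{(i,j)\in\square_{N,N}:\ \max\left(|i-N/2|,|j-N/2|\right)\ge B/2\bigr\},$$ and let $\sigma=\sigma_N$ be chosen uniformly at random, with law $\mathbb{P}_\sigma$ and independently of $w$, from the set of up-right paths from $(1,1)$ to $(N,N)$ that remain in $\Sigma_{N,N}$. Then for $\mathbb{P}_w$-almost every environment $w$, $$\frac{1}{\sqrt{2N-1}}\sum_{(i,j)\in \sigma}w_{ij}\ \xrightarrow{\ \mathscr{D}\ }\ \mathscr{N}(0,1),\qquad N\to\infty,$$ where, with $w$ held fixed, the convergence in distribution to the standard normal is with respect to $\mathbb{P}_\sigma$.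
   Context: $\square_{N,N}=\{(i,j)\in\mathbb{Z}^2: 1\le i\le N,\ 1\le j\le N\}$. An up-right path from $(1,1)$ to $(N,N)$ is a collection $\{(i_k,j_k): k=1,\ldots,2N-1\}$ with $(i_1,j_1)=(1,1)$, $(i_{2N-1},j_{2N-1})=(N,N)$, and $(i_{k+1}-i_k,j_{k+1}-j_k)\in\{(1,0),(0,1)\}$ for each $k$; it remains in $\Sigma_{N,N}$ if all of its points belong to $\Sigma_{N,N}$. The weights $w_{ij}$ are independent but not necessarily identically distributed; the same environment $w$ on $\mathbb{Z}_{\ge1}^2$ is used for all $N$. *)

(* Defs.v *)
From HB Require Import structures.
From mathcomp Require Import all_boot all_order all_algebra.
From mathcomp Require Import all_classical all_reals all_analysis.

Set Implicit Arguments.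
Unset Strict Implicit.
Unset Printing Implicit Defensive.

Import Order.TTheory GRing.Theory Num.Theory.
Import numFieldNormedType.Exports.

Local Open Scope classical_set_scope.
Local Open Scope ring_scope.

Definition mutually_independent d (T : measurableType d) (R : realType)
    (P : probability T R) (I : choiceType) (D : set I)
    (X : I -> {RV P >-> R}) : Prop :=
  forall (s : seq I) (A : I -> set R),
    uniq s -> [set` s] `<=` D -> (forall k, measurable (A k)) ->
    P (\bigcap_(k in [set` s]) (X k @^-1` A k)) =
      (\prod_(k <- s) P (X k @^-1` A k))%E.

Definition cvg_in_distribution (R : realType)
    (mu : nat -> set R -> \bar R) (nu : set R -> \bar R) : Prop :=
  forall x : R, {for x, continuous (fun y : R => nu `]-oo, y]%classic)} ->
    mu n `]-oo, x]%classic @[n --> \oo] --> nu `]-oo, x]%classic.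

(* When A is empty this is the zero set function (division by 0 is 0). *)
Definition uniform_law (R : realType) (I : finType) (A : {set I})
    (E : set I) : \bar R :=
  (#|[set s in A | s \in E]|%:R / #|A|%:R)%:E.

Definition in_frame (R : realType) (beta : R) (N : nat) (p : nat * nat) : bool :=
  let B : int := Num.floor (beta * N%:R) in
  let c : R := N%:R / 2 in
  [&& (1 <= p.1 <= N)%N, (1 <= p.2 <= N)%N &
      B%:~R / 2 <= Num.max `|p.1%:R - c| `|p.2%:R - c| ].

Definition up_right_step (p q : nat * nat) : bool :=
  (q == (p.1.+1, p.2)) || (q == (p.1, p.2.+1)).

(* The default (0, 0) of head and last is only used for the empty sequence,
   which is thereby not an up-right path. *)
Definition up_right (N : nat) (s : seq (nat * nat)) : bool :=
  [&& size s == N.*2.-1, head (0%N, 0%N) s == (1%N, 1%N),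
      last (0%N, 0%N) s == (N, N) & sorted up_right_step s].

(* Coordinates range over 0, ..., N, so that 'I_N.+1 contains 1, ..., N
   literally; the value 0 is excluded by up_right and in_frame. *)
Definition lattice_seq (N : nat) : finType :=
  (N.*2.-1).-tuple ('I_N.+1 * 'I_N.+1).

Definition points (N : nat) (s : lattice_seq N) : seq (nat * nat) :=
  [seq (nat_of_ord p.1, nat_of_ord p.2) | p <- tval s].

Definition frame_paths (R : realType) (beta : R) (N : nat) :
    {set lattice_seq N} :=
  [set s | up_right N (points s) && all (in_frame beta N) (points s)].

Definition normalized_energy (R : realType) (w : nat -> nat -> R) (N : nat)
    (s : lattice_seq N) : R :=
  (Num.sqrt (2 * N%:R - 1))^-1 * \sum_(p <- points s) w p.1 p.2.

Definition quenched_law (R : realType) (beta : R) (w : nat -> nat -> R)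
    (N : nat) (E : set R) : \bar R :=
  uniform_law R (frame_paths beta N) (@normalized_energy R w N @^-1` E).

(* Main.v *)
Require Import Defs.
From HB Require Import structures.
From mathcomp Require Import all_boot all_order all_algebra.
From mathcomp Require Import all_classical all_reals all_analysis.
From mathcomp Require Import measurable_realfun.
From mathcomp Require Import zify ring lra.

Set Implicit Arguments.
Unset Strict Implicit.
Unset Printing Implicit Defensive.

Import Order.TTheory GRing.Theory Num.Theory.
Import numFieldNormedType.Exports.

Local Open Scope classical_set_scope.
Local Open Scope ring_scope.

(* The hole of the frame is symmetric about the antidiagonal i + j = N, so a
   path is admissible iff it crosses that antidiagonal close enough to the
   upper-left or to the lower-right corner; given the crossing point it
   consists of two independent unconstrained bridges.  Its position at a given
   time is therefore a mixture of hypergeometric laws, whose atoms are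
   O(N^(-1/2)) away from the ends of the two bridges, and two independent paths
   share on average O(sqrt N) sites.

   Fix a smooth test function g of the form Phi((c - y) / eps), Phi being the
   normal distribution function.  The quenched mean of g is a Lipschitz function
   of each weight w_k, with constant of order P(k in sigma) / sqrt N; a
   sixth-moment martingale bound and the overlap estimate make its centred sixth
   moment O(N^(-3/2)), which is summable, and Borel-Cantelli applies.  The
   annealed mean of g is handled by a Lindeberg telescoping along the explicit
   solution Phi((c - y) / sqrt(eps^2 + tau)) of the heat equation.

   To work with finite sums only, the weights are first clamped to [-N, N] and
   rounded to multiples of 1/N: independence then gives the joint law of the
   rounded weights as a finite product. *)

(** * Anticoncentration of the hypergeometric law *)

(** Why the sixth moment: the squared Lipschitz constants add up to O(1/N) times the mean overlap
    O(sqrt N), hence to O(N^(-1/2)); a moment of order 2k bounds the deviation by the k-th power of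
    this, which is summable only from k = 3 on.

    The obstacle is in the overlap. A bridge whose crossing point is close to a corner is almost
    deterministic, so its atoms are not small, and conditioning on the crossing point alone gives no
    uniform estimate. But the number of paths through a crossing point increases from the corner
    towards the hole, so the bad crossing points are the rarest; averaged over the crossing point,
    the atoms are as small as for a crossing at distance of order N from the corner.

    The annealed side never sees the frame: along any single path the sum is one of 2N - 1
    independent weights. Normal distribution functions as test functions form a family that is
    stable under Gaussian averaging, so the Lindeberg exchange only changes their width, and they
    are monotone, so they compare directly with indicators of half-lines. Countably many of them
    suffice, which leaves a single null set of environments. *)

Section Hypergeometric.
Context {R : realType} (n s v : nat).
Hypotheses (hs : (s.*2 <= n)%N) (hv : (v.*2 <= n)%N).

Let wt (y : nat) : R := if (y <= v)%N then ('C(s, y) * 'C(n - s, v - y))%:R else 0.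
(** Consecutive weights compare according to the sign of y + 1 - h, so [x0], the integer part of
    [h], is a mode of the hypergeometric weights [wt]. *)
Let h : R := s.+1%:R * v.+1%:R / n.+2%:R.
Let x0 : nat := (s.+1 * v.+1 %/ n.+2)%N.

(** The ratio of consecutive weights is kept in cross-multiplied form so that it stays valid at the
    ends of the support, where both sides vanish. *)
Let hypergeometric_ratio (y : nat) :
  wt y.+1 * (y.+1%:R * (n%:R - s%:R - v%:R + y.+1%:R)) =
  wt y * ((s%:R - y%:R) * (v%:R - y%:R)).
Proof.
rewrite /wt; case: (ltnP y v) => [yv|]; last first.
  rewrite leq_eqVlt => /orP[/eqP ->|vy].
    by rewrite leqnn subrr !mulr0 mul0r.
  by rewrite leqNgt vy /= !mul0r.
rewrite (ltnW yv); case: (leqP y s) => [ys|sy]; last first.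
  by rewrite (bin_small sy) (bin_small (leqW sy)) !mul0n !mul0r.
have e1 := mul_bin_left s y.
have e2 := mul_bin_left (n - s) (v - y.+1).
have e3 : (v - y.+1).+1 = (v - y)%N by lia.
rewrite e3 in e2.
have -> : n%:R - s%:R - v%:R + y.+1%:R = (n - s - (v - y.+1))%:R :> R.
  have /(congr1 (fun k => k%:R : R)) : (n - s - (v - y.+1) + s + v = n + y.+1)%N by lia.
  rewrite !natrD => E; lra.
rewrite -!natrB // 1?ltnW // -!natrM; congr _%:R.
transitivity ((y.+1 * 'C(s, y.+1)) * ((n - s - (v - y.+1)) * 'C(n - s, v - y.+1)))%N.
  by lia.
by rewrite e1 -e2; lia.
Qed.

Let wt_ge0 y : 0 <= wt y.
Proof. by rewrite /wt; case: ifP. Qed.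

Let h_gt0 : 0 < h.
Proof. by rewrite /h divr_gt0 // mulr_gt0. Qed.

Let hE : h * n.+2%:R = s.+1%:R * v.+1%:R.
Proof. by rewrite /h mulfVK. Qed.

Let Z_gt0 (y : nat) : 0 < y.+1%:R * (n%:R - s%:R - v%:R + y.+1%:R) :> R.
Proof.
rewrite mulr_gt0 //; have /(congr1 (fun k => k%:R : R)) : (n = n - s - v + s + v)%N by lia.
rewrite !natrD => ->; rewrite -addrA -addrA.
have := ler0n R (n - s - v); have := ltr0Sn R y; lra.
Qed.

(** The quadratic terms in y cancel in the difference of the two products of [hypergeometric_ratio],
    leaving (n + 2)(y + 1) - (s + 1)(v + 1). Its sign gives unimodality, its size the speed of
    decay. *)
Let wt_diff (y : nat) :
  (wt y - wt y.+1) * (y.+1%:R * (n%:R - s%:R - v%:R + y.+1%:R)) =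
  wt y * (n.+2%:R * (y.+1%:R - h)).
Proof.
rewrite mulrBl hypergeometric_ratio.
have -> : n.+2%:R * (y.+1%:R - h) = n.+2%:R * y.+1%:R - s.+1%:R * v.+1%:R by rewrite -hE; ring.
by rewrite -!natr1; ring.
Qed.

Let x0_le : x0%:R <= h.
Proof.
rewrite /h ler_pdivlMr // -!natrM ler_nat; exact: leq_trunc_div.
Qed.

Let x0_gt : h < x0.+1%:R.
Proof.
rewrite /h ltr_pdivrMr // -!natrM ltr_nat; exact: ltn_ceil.
Qed.

Let wt_le_mode y : wt y <= wt x0.
Proof.
have up z : z.+1%:R <= h -> wt z <= wt z.+1.
  move=> zh; rewrite -subr_le0 -(pmulr_lle0 _ (Z_gt0 z)) wt_diff.
  by rewrite mulr_ge0_le0 // mulr_ge0_le0 // subr_le0.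
have down z : h <= z.+1%:R -> wt z.+1 <= wt z.
  move=> zh; rewrite -subr_ge0 -(pmulr_lge0 _ (Z_gt0 z)) wt_diff.
  by rewrite mulr_ge0 // mulr_ge0 // subr_ge0.
case: (leqP y x0) => [yx|/ltnW xy].
  have : forall k, (k <= x0)%N -> wt (x0 - k) <= wt x0.
    elim=> [|k IH kx]; first by rewrite subn0.
    apply: le_trans (IH (ltnW kx)); rewrite -(subnSK kx); apply: up.
    by apply: le_trans x0_le; rewrite ler_nat; lia.
  by move/(_ (x0 - y)%N); rewrite subKn // leq_subr; apply.
rewrite -(subnK xy); elim: (y - x0)%N => [|k IH]; first by [].
apply: le_trans IH; rewrite addSn; apply: down.
by apply: le_trans (ltW x0_gt) _; rewrite ler_nat; lia.
Qed.

(* Near the mode the weights decrease slowly: this is what forces the mode to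
   carry only a small fraction of the total mass. *)
Let wt_near_mode l : wt x0 * (1 - 2 * (l * l.+1)%:R / h) <= wt (x0 + l)%N.
Proof.
elim: l => [|l IH]; first by rewrite addn0 mul0n mulr0 mul0r subr0 mulr1.
set y := (x0 + l)%N; rewrite addnS -/y.
have zh : 0 <= y.+1%:R - h.
  rewrite subr_ge0; apply: le_trans (ltW x0_gt) _; rewrite ler_nat /y; lia.
have zh' : y.+1%:R - h <= l.+1%:R.
  rewrite lerBlDl /y -addnS natrD lerD2r //.
(* With y + 1 >= h in both factors it remains that n - s - v + h >= (n + 2) / 4. Multiplied by 4 (n
   + 2), the difference is (n - 2 s)(n - 2 v) + (n + 2)((n - 2 s) + (n - 2 v)): this is where both
   halves are used. *)
have Zge : h * (n.+2%:R / 4) <= y.+1%:R * (n%:R - s%:R - v%:R + y.+1%:R).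
  apply: ler_pM; rewrite ?(ltW h_gt0) ?divr_ge0 //; first by rewrite -subr_ge0.
  apply: (@le_trans _ _ (n%:R - s%:R - v%:R + h)); last by rewrite lerD2l -subr_ge0.
  rewrite -(ler_pM2r (ltr0Sn R n.+1)) [leRHS]mulrDl hE.
  have a1 : (s.*2)%:R <= n%:R :> R by rewrite ler_nat.
  have a2 : (v.*2)%:R <= n%:R :> R by rewrite ler_nat.
  rewrite -!muln2 !natrM in a1 a2.
  have := ler0n R s; have := ler0n R v.
  have b1 : 0 <= n%:R - 2 * s%:R :> R by lra.
  have b2 : 0 <= n%:R - 2 * v%:R :> R by lra.
  have b3 := mulr_ge0 b1 b2; have b4 := mulr_ge0 (ler0n R n.+2) (addr_ge0 b1 b2).
  by move: b3 b4; rewrite -[n.+2%:R]natr1 -[n.+1%:R]natr1 -[s.+1%:R]natr1 -[v.+1%:R]natr1; lra.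
have dle : wt y - wt y.+1 <= wt x0 * (4 * l.+1%:R / h).
  have Zp : 0 < h * (n.+2%:R / 4) by rewrite mulr_gt0 // divr_gt0.
  case: (lerP (wt y - wt y.+1) 0) => [d0|d0].
    by apply: le_trans d0 _; rewrite mulr_ge0 // divr_ge0 // ?(ltW h_gt0) // mulr_ge0.
  rewrite -(ler_pM2r Zp); apply: le_trans (_ : wt y * (n.+2%:R * (y.+1%:R - h)) <= _).
    by rewrite -wt_diff ler_pM2l.
  have -> : wt x0 * (4 * l.+1%:R / h) * (h * (n.+2%:R / 4)) = wt x0 * (n.+2%:R * l.+1%:R).
    by field; rewrite gt_eqF.
  by rewrite ler_pM // ?wt_le_mode // ?mulr_ge0 // ler_pM2l.
have -> : (l.+1 * l.+2)%:R = (l * l.+1)%:R + 2 * l.+1%:R :> R.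
  by rewrite -!natrM -natrD; congr _%:R; lia.
have -> : 1 - 2 * ((l * l.+1)%:R + 2 * l.+1%:R) / h =
  1 - 2 * (l * l.+1)%:R / h - 4 * l.+1%:R / h :> R by field; rewrite gt_eqF.
rewrite mulrBr; rewrite -/y in IH; lra.
Qed.

Let sum_wt l : \sum_(i < l) wt (x0 + i)%N <= 'C(n, v)%:R.
Proof.
have -> : 'C(n, v) = 'C(s + (n - s), v) by congr 'C(_, _); lia.
rewrite -binomial.Vandermonde natr_sum.
have -> : \sum_(i < v.+1) ('C(s, i) * 'C(n - s, v - i))%:R = \sum_(0 <= i < v.+1) wt i.
  rewrite big_mkord; apply: eq_bigr => i _; rewrite /wt.
  by rewrite -ltnS ltn_ord.
rewrite -(big_mkord xpredT (fun i => wt (x0 + i)%N)).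
have -> : \sum_(0 <= i < l) wt (x0 + i)%N = \sum_(x0 <= i < x0 + l) wt i.
  rewrite -{2}[x0]add0n big_addn addKn; apply: eq_bigr => i _; by rewrite addnC.
apply: (@le_trans _ _ (\sum_(0 <= i < x0 + l) wt i)).
  by rewrite [leRHS](big_cat_nat (n := x0)) ?leq_addr //= lerDr sumr_ge0.
case: (leqP (x0 + l) v.+1) => [lv|/ltnW lv].
  by rewrite [leRHS](big_cat_nat (n := (x0 + l)%N)) //= lerDl sumr_ge0.
rewrite (big_cat_nat (n := v.+1)) //= gerDl big_nat_cond big1 // => i /andP[/andP[i1 _] _].
by rewrite /wt leqNgt i1.
Qed.

(** About sqrt h / 2 weights, from the mode on, are at least half of the maximum, while all weights
    add up to 'C(n, v) by Vandermonde's identity; so the maximum is O(h^(-1/2)) of the total. *)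
Lemma hypergeometric_le_half (y : nat) : (y <= v)%N ->
  ('C(s, y) * 'C(n - s, v - y))%:R <=
  'C(n, v)%:R * (8 * Num.sqrt (n.+2%:R / (s.+1%:R * v.+1%:R))) :> R.
Proof.
move=> yv; have -> : ('C(s, y) * 'C(n - s, v - y))%:R = wt y by rewrite /wt yv.
apply: le_trans (wt_le_mode y) _.
have -> : n.+2%:R / (s.+1%:R * v.+1%:R) = h^-1 by rewrite /h invf_div.
rewrite sqrtrV ?(ltW h_gt0) //.
set q := Num.sqrt h.
have q0 : 0 < q by rewrite sqrtr_gt0.
have qE : q * q = h by rewrite -expr2 sqr_sqrtr // ltW.
(* For i < l one has i (i + 1) <= l^2 <= h / 4, so [wt_near_mode] loses at most half of the
   maximum. *)
set l := Num.truncn (q / 2).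
have /andP[l1 l2] : l%:R <= q / 2 < l.+1%:R by apply: truncn_itv; rewrite divr_ge0 // ltW.
have wm := wt_ge0 x0.
have main : l%:R / 2 * wt x0 <= 'C(n, v)%:R.
  apply: le_trans (sum_wt l).
  have -> : l%:R / 2 * wt x0 = \sum_(i < l) (wt x0 / 2).
    by rewrite sumr_const card_ord -mulr_natl; ring.
  apply: ler_sum => i _.
  apply: le_trans (wt_near_mode i); rewrite ler_wpM2l //.
  have : 2 * (i * i.+1)%:R / h <= 2^-1 :> R.
    rewrite ler_pdivrMr // -qE.
    have : (i * i.+1)%:R <= l%:R * l%:R :> R.
      rewrite -natrM ler_nat; have := ltn_ord i; nia.
    have := ler0n R l; nra.
  lra.
case: (ltnP 0 l) => l0.
  rewrite mulrA ler_pdivlMr // mulrC.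
  have : 1 <= l%:R :> R by rewrite ler1n.
  rewrite -[l.+1]addn1 natrD in l2; nra.
(* If l = 0, the right-hand side exceeds the total mass, which already bounds the maximum. *)
have q2 : q < 2 by move: l2; move: l0; rewrite leqn0 => /eqP ->; lra.
apply: (@le_trans _ _ 'C(n, v)%:R).
  have := sum_wt 1; by rewrite big_ord1 addn0.
rewrite ler_peMr // ler_pdivlMr //; lra.
Qed.

End Hypergeometric.

(** Two symmetries reduce to arguments at most n / 2: exchanging the colours of the urn replaces s
    by n - s and y by v - y; passing to the complement of the sample replaces v by n - v and y by s
    - y. *)
Lemma hypergeometric_le {R : realType} (n s v y : nat) :
  (s <= n)%N -> (v <= n)%N -> (y <= v)%N ->
  ('C(s, y) * 'C(n - s, v - y))%:R <=
  'C(n, v)%:R * (8 * Num.sqrt (n.+2%:R /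
     ((minn s (n - s)).+1%:R * (minn v (n - v)).+1%:R))) :> R.
Proof.
have half s' v' y' : (s' <= n)%N -> (v'.*2 <= n)%N -> (y' <= v')%N ->
    ('C(s', y') * 'C(n - s', v' - y'))%:R <= 'C(n, v')%:R *
    (8 * Num.sqrt (n.+2%:R / ((minn s' (n - s')).+1%:R * v'.+1%:R))) :> R.
  move=> sn vn yv; case: (leqP s'.*2 n) => s2.
    have -> : minn s' (n - s') = s' by lia.
    exact: hypergeometric_le_half.
  have -> : minn s' (n - s') = (n - s')%N by lia.
  have ns2 : ((n - s').*2 <= n)%N by lia.
  have := hypergeometric_le_half ns2 vn (leq_subr y' v').
  by rewrite !subKn // mulnC.
move=> sn vn yv; case: (leqP v.*2 n) => v2.
  have -> : minn v (n - v) = v by lia.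
  exact: half.
have -> : minn v (n - v) = (n - v)%N by lia.
case: (leqP y s) => ys; last first.
  by rewrite bin_small // mul0n mulr_ge0 // mulr_ge0 // sqrtr_ge0.
case: (leqP (v - y) (n - s)) => vy; last first.
  by rewrite mulnC bin_small // mul0n mulr_ge0 // mulr_ge0 // sqrtr_ge0.
rewrite -bin_sub // -(bin_sub vy) -(bin_sub vn).
have -> : (n - s - (v - y) = (n - v) - (s - y))%N by lia.
by apply: half => //; lia.
Qed.

(** * Counting lattice paths in the frame *)

(** Plain lists instead of tuples: sums over them split along concatenation, which is how paths are
    cut at the antidiagonal and at the observed time. *)
Fixpoint bitseqs (n : nat) : seq (seq bool) :=
  if n is m.+1 then [seq true :: s | s <- bitseqs m] ++ [seq false :: s | s <- bitseqs m]
  else [:: [::]].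

Lemma mem_bitseqs n s : (s \in bitseqs n) = (size s == n).
Proof.
elim: n s => [|n IH] [|b s] //=.
  by rewrite mem_cat; apply/negbTE; rewrite negb_or; apply/andP; split; apply/mapP => -[].
rewrite mem_cat eqSS -IH; case: b.
  rewrite mem_map; last by move=> ? ? [].
  by case: (s \in _) => //=; apply/mapP => -[].
rewrite orbC mem_map; last by move=> ? ? [].
by case: (s \in _) => //=; apply/mapP => -[].
Qed.

Lemma bitseqs_uniq n : uniq (bitseqs n).
Proof.
elim: n => [//|n IH] /=; rewrite cat_uniq !map_inj_uniq ?IH; try by move=> ? ? [].
rewrite /= andbT; apply/hasPn => s /mapP[t _ ->]; by apply/mapP => -[].
Qed.

Notation ups := (count_mem true).

Lemma sum_bitseqs_ups n (f : nat -> nat) :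
  (\sum_(s <- bitseqs n) f (ups s) = \sum_(t < n.+1) 'C(n, t) * f t)%N.
Proof.
elim: n f => [|n IH] f; first by rewrite /= big_seq1 big_ord1 mul1n.
rewrite /= big_cat !big_map /= (IH (fun k => f (1 + k)%N)) (IH (fun k => f (0 + k)%N)).
rewrite [RHS]big_ord_recl /= bin0 mul1n.
rewrite [X in (_ + X)%N = _]big_ord_recl /= bin0 mul1n add0n.
rewrite addnCA; congr addn.
rewrite [in RHS](eq_bigr (fun i : 'I_n.+1 => 'C(n, i.+1) * f i.+1 + 'C(n, i) * f i.+1)%N); last first.
  by move=> i _; rewrite /bump /= add1n binS mulnDl.
rewrite big_split /= addnC; congr addn.
by rewrite [in RHS]big_ord_recr /= bin_small ?mul0n ?addn0.
Qed.

Lemma sum_bitseqsD m n (f : seq bool -> nat) :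
  (\sum_(s <- bitseqs (m + n)) f s =
   \sum_(s <- bitseqs m) \sum_(t <- bitseqs n) f (s ++ t))%N.
Proof.
elim: m f => [|m IH] f; first by rewrite /= big_seq1.
by rewrite addSn /= !big_cat !big_map /= (IH (f \o cons true)) (IH (f \o cons false)).
Qed.

Lemma count_bitseqs n (P : pred (seq bool)) :
  (count P (bitseqs n) = \sum_(s <- bitseqs n) P s)%N.
Proof. by rewrite -sum1_count big_mkcond. Qed.

Lemma size_of_bitseqs n s : s \in bitseqs n -> size s = n.
Proof. by rewrite mem_bitseqs => /eqP. Qed.

(* Bit strings of length [m + (m + 2)] with [m + 1] ups encode the lattice paths
   of a square of side [m + 2]; after [m] steps the path is on the antidiagonal
   of the square, and the hole is avoided iff it is there within [a] of a side. *)
Section Frame.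
Variables (m a : nat).

Definition good_ups (t : nat) : bool := (t < a)%N || (m - t < a)%N.

Definition good_bits (b : seq bool) : bool :=
  (ups b == m.+1) && good_ups (ups (take m b)).

Let w (t : nat) : nat := ('C(m, t) * 'C(m.+2, m.+1 - t))%N.

Lemma sum_indicator_eq (n k : nat) (F : nat -> nat) : (k < n)%N ->
  (\sum_(z < n) F z * (nat_of_ord z == k) = F k)%N.
Proof.
move=> kn; rewrite (bigD1 (Ordinal kn)) //= eqxx muln1 big1 ?addn0 // => i ik.
have /negbTE -> : nat_of_ord i != k by apply: contra ik => /eqP e; apply/eqP/val_inj.
by rewrite muln0.
Qed.

Lemma sum_bitseqs_total (M z : nat) n :
  (\sum_(s <- bitseqs n) (z + ups s == M)%N = (z <= M) * 'C(n, M - z))%N.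
Proof.
rewrite (sum_bitseqs_ups n (fun k => (z + k == M)%N : nat)).
case: (leqP z M) => [zM|Mz]; last first.
  by rewrite mul0n big1 // => i _; case: eqP => //; lia.
have e (i : 'I_n.+1) : (z + i == M)%N = (nat_of_ord i == (M - z)%N) by apply/eqP/eqP; lia.
under eq_bigr => i _ do rewrite e.
case: (ltnP (M - z) n.+1) => [lt|ge].
  by rewrite (sum_indicator_eq (fun k => 'C(n, k)) lt) mul1n.
rewrite bin_small // muln0 big1 // => i _; have := ltn_ord i.
by case: eqP => //; lia.
Qed.

Lemma count_good_bits :
  count good_bits (bitseqs (m + m.+2)) = (\sum_(t < m.+1) good_ups t * w t)%N.
Proof.
rewrite count_bitseqs sum_bitseqsD.
pose f t := (good_ups t * ((t <= m.+1) * 'C(m.+2, m.+1 - t)))%N.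
have -> : (\sum_(s <- bitseqs m) \sum_(t <- bitseqs m.+2) good_bits (s ++ t) =
           \sum_(s <- bitseqs m) f (ups s))%N.
  rewrite big_seq [RHS]big_seq; apply: eq_bigr => s /size_of_bitseqs es.
  rewrite /f -sum_bitseqs_total big_distrr /=; apply: eq_bigr => t _.
  by rewrite /good_bits count_cat take_size_cat // andbC mulnb.
rewrite (sum_bitseqs_ups m f); apply: eq_bigr => t _.
by rewrite /f /w (leqW (ltnSE (ltn_ord t))) mul1n mulnCA.
Qed.

(** The string is cut at d and at m. Given the crossing point x + y, the product of 'C(d, x) and
    'C(m - d, y) over 'C(m, x + y) is a hypergeometric probability. *)
Lemma count_passing_first d x : (d <= m)%N ->
  count (fun b => good_bits b && (ups (take d b) == x)) (bitseqs (m + m.+2)) =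
  ('C(d, x) * \sum_(y < (m - d).+1) 'C(m - d, y) *
     (good_ups (x + y) * ((x + y <= m.+1) * 'C(m.+2, m.+1 - (x + y)))))%N.
Proof.
move=> dm; have em : (m + m.+2 = d + ((m - d) + m.+2))%N by lia.
rewrite em count_bitseqs sum_bitseqsD.
pose f k y := (good_ups (k + y) * ((k + y <= m.+1) * 'C(m.+2, m.+1 - (k + y))))%N.
pose g k := ((k == x) * \sum_(y < (m - d).+1) 'C(m - d, y) * f x y)%N.
have -> : (\sum_(s <- bitseqs d) \sum_(t <- bitseqs (m - d + m.+2))
    (good_bits (s ++ t) && (ups (take d (s ++ t)) == x)) =
    \sum_(s <- bitseqs d) g (ups s))%N.
  rewrite big_seq [RHS]big_seq; apply: eq_bigr => s /size_of_bitseqs es.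
  rewrite sum_bitseqsD /g.
  under eq_bigr => t _ do under eq_bigr => u _ do rewrite take_size_cat // andbC -mulnb.
  under eq_bigr => t _ do rewrite -big_distrr /=.
  rewrite -big_distrr /=; case: eqP => [sx|]; last by rewrite !mul0n.
  congr (_ * _)%N; rewrite -(sum_bitseqs_ups (m - d) (f x)).
  rewrite big_seq [RHS]big_seq; apply: eq_bigr => t /size_of_bitseqs et.
  rewrite /f -sum_bitseqs_total big_distrr /=; apply: eq_bigr => u _.
  rewrite /good_bits catA take_size_cat ?size_cat ?es ?et ?subnKC //.
  by rewrite !count_cat sx andbC mulnb.
rewrite (sum_bitseqs_ups d g); case: (ltnP x d.+1) => xd; last first.
  rewrite [in RHS]bin_small // mul0n big1 // => i _; rewrite /g.
  by case: eqP (ltn_ord i) => [->|]; rewrite ?muln0 // ltnNge xd.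
rewrite -(sum_indicator_eq (fun k => 'C(d, k) * \sum_(y < (m - d).+1) 'C(m - d, y) * f x y)%N xd).
by apply: eq_bigr => i _; rewrite /g [RHS]mulnAC -mulnA.
Qed.

(** Now the cut at m comes before the observed time m + e, and it is the second bridge, of m + 2
    steps, whose position is hypergeometric given the crossing point t. *)
Lemma count_passing_last e x : (e <= m.+2)%N ->
  count (fun b => good_bits b && (ups (take (m + e) b) == x)) (bitseqs (m + m.+2)) =
  (\sum_(t < m.+1) 'C(m, t) * (good_ups t *
     ((t <= x) * 'C(e, x - t) * ((x <= m.+1) * 'C(m.+2 - e, m.+1 - x)))))%N.
Proof.
move=> em; have eN : (m + m.+2 = m + (e + (m.+2 - e)))%N by lia.
rewrite eN count_bitseqs sum_bitseqsD.
pose f t := (good_ups t *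
     ((t <= x) * 'C(e, x - t) * ((x <= m.+1) * 'C(m.+2 - e, m.+1 - x))))%N.
rewrite -(sum_bitseqs_ups m f) big_seq [RHS]big_seq.
apply: eq_bigr => s /size_of_bitseqs es; rewrite sum_bitseqsD /f.
rewrite -sum_bitseqs_total big_distrl big_distrr /= big_seq [RHS]big_seq.
apply: eq_bigr => t /size_of_bitseqs et.
rewrite -sum_bitseqs_total big_distrr big_distrr /=; apply: eq_bigr => u _.
rewrite /good_bits take_size_cat // catA take_size_cat ?size_cat ?es ?et //.
rewrite !count_cat -!mulnb; case: (ups s + ups t =P x)%N => [<-|_].
  by rewrite /= muln1 mul1n mulnC.
by rewrite !muln0.
Qed.

End Frame.

(** * Averaging the anticoncentration bound over the crossing point *)

Lemma leq_bin_succ n k : (k.*2.+1 <= n)%N -> ('C(n, k) <= 'C(n, k.+1))%N.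
Proof.
move=> kn; rewrite -(leq_pmul2l (ltn0Sn k)) mul_bin_left leq_mul2r.
by apply/orP; right; lia.
Qed.

(** All terms of the double sum of (f i - f j)(g i - g j) are nonpositive by opposite monotonicity;
    expanding it gives the claim. *)
Lemma chebyshev_sum_le {R : realDomainType} n (f g : nat -> R) :
  (forall i j, (i <= j < n)%N -> f i <= f j) ->
  (forall i j, (i <= j < n)%N -> g j <= g i) ->
  n%:R * \sum_(i < n) f i * g i <= (\sum_(i < n) f i) * \sum_(i < n) g i.
Proof.
move=> fi gd.
have : \sum_(i < n) \sum_(j < n) (f i - f j) * (g i - g j) <= 0.
  apply: sumr_le0 => i _; apply: sumr_le0 => j _.
  case: (leqP i j) => [ij|/ltnW ji].
    by rewrite mulr_le0_ge0 ?subr_le0 ?subr_ge0 ?fi ?gd // ij ltn_ord.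
  by rewrite mulr_ge0_le0 ?subr_le0 ?subr_ge0 ?fi ?gd // ji ltn_ord.
have -> : \sum_(i < n) \sum_(j < n) (f i - f j) * (g i - g j) =
  2 * (n%:R * (\sum_(i < n) f i * g i) - (\sum_(i < n) f i) * \sum_(i < n) g i).
  transitivity (\sum_(i < n) (n%:R * (f i * g i) - f i * (\sum_(j < n) g j) -
      (\sum_(j < n) f j) * g i + \sum_(j < n) f j * g j)).
    apply: eq_bigr => i _; rewrite mulr_sumr mulr_suml.
    have -> : n%:R * (f i * g i) = \sum_(j < n) f i * g i.
      by rewrite sumr_const card_ord mulr_natl.
    by rewrite -!sumrB -big_split /=; apply: eq_bigr => j _; ring.
  rewrite big_split /= !sumrB -mulr_sumr -mulr_suml -mulr_sumr sumr_const card_ord -mulr_natl; ring.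
lra.
Qed.

(** Telescoping of 1 / sqrt(n + 1) <= 2 (sqrt(n + 1) - sqrt n). *)
Lemma sum_inv_sqrt_le {R : realType} n :
  \sum_(u < n) (Num.sqrt u.+1%:R)^-1 <= 2 * Num.sqrt n%:R :> R.
Proof.
elim: n => [|n IH]; first by rewrite big_ord0 sqrtr0 mulr0.
rewrite big_ord_recr /=; apply: le_trans (lerD IH (lexx _)) _.
set x := Num.sqrt n%:R; set y := Num.sqrt n.+1%:R.
have x0 : 0 <= x by exact: sqrtr_ge0.
have y0 : 0 < y by rewrite sqrtr_gt0.
have xE : x * x = n%:R by rewrite -expr2 sqr_sqrtr.
have yE : y * y = n%:R + 1 by rewrite -expr2 sqr_sqrtr // natr1.
rewrite -(ler_pM2r y0) mulrDl mulVf ?gt_eqF //.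
have : 0 <= (y - x) * (y - x) by rewrite -expr2 sqr_ge0.
nra.
Qed.

Lemma sqrt_ratio_le {R : realType} (x y b c c' : R) : 0 <= x <= y -> 0 < b -> 0 < c' <= c ->
  Num.sqrt (x / (b * c)) <= Num.sqrt y / Num.sqrt b * (Num.sqrt c')^-1.
Proof.
move=> /andP[x0 xy] b0 /andP[c0 cc].
have y0 := le_trans x0 xy; have cp := lt_le_trans c0 cc.
rewrite -!sqrtrV ?(ltW b0) ?(ltW c0) // -!sqrtrM ?divr_ge0 ?(ltW b0) //.
apply: ler_wsqrtr; rewrite invfM mulrA.
apply: ler_pM; rewrite ?divr_ge0 ?invr_ge0 ?(ltW b0) ?(ltW cp) //.
  by rewrite ler_wpM2r // invr_ge0 ltW.
by rewrite lef_pV2.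
Qed.

Section PassingBound.
Context {R : realType} (m a : nat).
Hypotheses (a_gt0 : (0 < a)%N) (am : (a.*2 <= m.+1)%N).

Let w (t : nat) : R := ('C(m, t) * 'C(m.+2, m.+1 - t))%:R.
(** The part of the hypergeometric bound that depends on the crossing point t; it fails to be small
    exactly near the two corners. *)
Let r (t : nat) : R := (Num.sqrt (minn t (m - t)).+1%:R)^-1.

Let w_sym t : (t <= m)%N -> w (m - t) = w t.
Proof.
move=> tm; rewrite /w bin_sub // -[X in (_ * X)%:R = _]bin_sub; last by lia.
by congr (_ * 'C(_, _))%:R; lia.
Qed.

Let r_sym t : (t <= m)%N -> r (m - t) = r t.
Proof. by move=> tm; rewrite /r subKn // minnC. Qed.

(** Each binomial grows up to its middle, and 2 a <= m + 1 keeps the argument below it. *)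
Let w_incr i j : (i <= j < a)%N -> w i <= w j.
Proof.
move=> /andP[ij ja]; rewrite /w ler_nat -(subnK ij).
have : (j - i + i < a)%N by rewrite subnK.
elim: (j - i)%N => [//|k IH] ka; apply: leq_trans (IH (ltnW ka)) _.
set t := (k + i)%N in ka *; rewrite addSn -/t in ka *.
apply: leq_mul; first by apply: leq_bin_succ; lia.
have flip l : (l <= m)%N -> 'C(m.+2, m.+1 - l) = 'C(m.+2, l.+1).
  by move=> lm; rewrite -bin_sub; [congr 'C(_, _); lia|lia].
rewrite !flip; try lia.
by apply: leq_bin_succ; lia.
Qed.

Lemma sum_good_ups (F : nat -> R) : \sum_(t < m.+1) (good_ups m a t)%:R * F t =
  \sum_(u < a) F u + \sum_(u < a) F (m - u)%N.
Proof.
rewrite -(big_mkord xpredT (fun t => (good_ups m a t)%:R * F t)).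
rewrite (big_cat_nat (n := a)) /=; try lia.
rewrite [X in _ + X](big_cat_nat (n := (m.+1 - a)%N)) /=; try lia.
have -> : \sum_(a <= t < m.+1 - a) (good_ups m a t)%:R * F t = 0.
  rewrite big_nat_cond big1 // => i /andP[ia _].
  by rewrite /good_ups (_ : (_ || _) = false) ?mul0r //; lia.
rewrite add0r.
congr (_ + _).
  rewrite -(big_mkord xpredT F); rewrite big_nat_cond [RHS]big_nat_cond.
  by apply: eq_bigr => i /andP[ia _]; rewrite /good_ups (_ : (_ || _) = true) ?mul1r //; lia.
rewrite -(big_mkord xpredT (fun u => F (m - u)%N)).
rewrite big_nat_rev /= -{1}[(m.+1 - a)%N]add0n big_addn.
have -> : (m.+1 - (m.+1 - a) = a)%N by lia.
rewrite big_nat_cond [RHS]big_nat_cond.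
apply: eq_bigr => i /andP[ia _].
rewrite (_ : (_ - _)%N = (m - i)%N); last by lia.
by rewrite /good_ups (_ : (_ || _) = true) ?mul1r //; lia.
Qed.

(* The weights [w] increase and [r] decreases on [0, a), so Chebyshev's sum
   inequality replaces the [w]-average of [r] by its plain average. *)
Let average_r : \sum_(t < m.+1) (good_ups m a t)%:R * (w t * r t) <=
  (\sum_(t < m.+1) (good_ups m a t)%:R * w t) * (2 / Num.sqrt a%:R).
Proof.
rewrite (sum_good_ups (fun t => w t * r t)) (sum_good_ups w).
have half : \sum_(u < a) w u * r u <= (\sum_(u < a) w u) * (2 / Num.sqrt a%:R).
  have a0 : 0 < a%:R :> R by rewrite ltr0n.
  rewrite -(ler_pM2l a0).
  apply: le_trans (chebyshev_sum_le (f := w) (g := r) w_incr _) _.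
    move=> i j /andP[ij ja]; rewrite /r lef_pV2 ?posrE ?sqrtr_gt0 //.
    by rewrite ler_sqrt // ler_nat; lia.
  rewrite mulrCA ler_wpM2l //; first by apply: sumr_ge0 => i _; rewrite /w.
  apply: (@le_trans _ _ (\sum_(u < a) (Num.sqrt u.+1%:R)^-1)).
    apply: ler_sum => i _; rewrite /r (_ : minn _ _ = i) //.
    by have := ltn_ord i; lia.
  apply: le_trans (sum_inv_sqrt_le _) _.
  have s0 : Num.sqrt a%:R != 0 :> R by rewrite gt_eqF // sqrtr_gt0.
  have aE : a%:R = Num.sqrt a%:R * Num.sqrt a%:R :> R by rewrite -expr2 sqr_sqrtr ?ltW.
  rewrite [X in _ <= X * _]aE.
  by rewrite le_eqVlt; apply/orP; left; apply/eqP; field.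
have e (F : nat -> R) : (forall t, (t <= m)%N -> F (m - t)%N = F t) ->
    \sum_(u < a) F (m - u)%N = \sum_(u < a) F u.
  by move=> Fs; apply: eq_bigr => i _; apply: Fs; have := ltn_ord i; lia.
have e1 : \sum_(u < a) w (m - u) * r (m - u) = \sum_(u < a) w u * r u.
  by apply: (e (fun u => w u * r u)) => t tm; rewrite w_sym // r_sym.
by rewrite mulrDl lerD ?e1 ?(e w w_sym).
Qed.

(** Number of steps from time d to the nearer end of the bridge containing it; the two bridges have
    m and m + 2 steps. *)
Definition antidiagonal_gap (d : nat) : nat :=
  if (d <= m)%N then minn d (m - d) else minn (d - m) (m.+2 - (d - m)).

(** The factor 16 is the 8 of [hypergeometric_le] times the 2 of [average_r], which also supplies 1
    / sqrt a. *)
Definition passing_bound (d : nat) : R :=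
  16 * Num.sqrt (m.+4%:R / a%:R) / Num.sqrt (antidiagonal_gap d).+1%:R.

Let total_good : (count (good_bits m a) (bitseqs (m + m.+2)))%:R =
  \sum_(t < m.+1) (good_ups m a t)%:R * w t.
Proof.
by rewrite count_good_bits natr_sum; apply: eq_bigr => t _; rewrite natrM.
Qed.

(** Given the crossing point t the position at time d is hypergeometric, with atoms at most K times
    [r t]; [average_r] then averages over t. *)
Lemma passing_le d x : (d <= m + m.+2)%N ->
  (count (fun b => good_bits m a b && (ups (take d b) == x)) (bitseqs (m + m.+2)))%:R <=
  (count (good_bits m a) (bitseqs (m + m.+2)))%:R * passing_bound d.
Proof.
move=> dm.
(* m + 4 is the n + 2 of [hypergeometric_le] for the longer bridge, so the same K serves both. *)
pose K : R := 8 * (Num.sqrt m.+4%:R / Num.sqrt (antidiagonal_gap d).+1%:R).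
have K0 : 0 <= K by rewrite /K mulr_ge0 // divr_ge0 // sqrtr_ge0.
suff : (count (fun b => good_bits m a b && (ups (take d b) == x)) (bitseqs (m + m.+2)))%:R <=
    K * \sum_(t < m.+1) (good_ups m a t)%:R * (w t * r t).
  move=> /le_trans; apply; apply: le_trans (ler_wpM2l K0 average_r) _.
  rewrite total_good mulrCA ler_wpM2l //.
    by apply: sumr_ge0 => i _; rewrite mulr_ge0 // /w.
  rewrite /K /passing_bound sqrtrM // sqrtrV //.
  by rewrite le_eqVlt; apply/orP; left; apply/eqP; ring.
rewrite mulr_sumr; case: (leqP d m) => dm'.
  rewrite count_passing_first // natrM natr_sum mulr_sumr.
  case: (ltnP d x) => dx.
    rewrite bin_small // big1 ?sumr_ge0 // => i _; last by rewrite mul0r.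
    by rewrite mulr_ge0 // mulr_ge0 // mulr_ge0 // /w ?invr_ge0 ?sqrtr_ge0.
  pose g t : R := K * ((good_ups m a t)%:R * (w t * r t)).
  have g0 t : 0 <= g t by rewrite /g mulr_ge0 // mulr_ge0 // mulr_ge0 // /r invr_ge0 sqrtr_ge0.
  apply: (@le_trans _ _ (\sum_(y < (m - d).+1) g (x + y)%N)); last first.
    rewrite -(big_mkord xpredT (fun y => g (x + y)%N)) -(big_mkord xpredT g).
    have -> : \sum_(0 <= i < (m - d).+1) g (x + i)%N = \sum_(x <= i < x + (m - d).+1) g i.
      rewrite -{2}[x]add0n big_addn addKn; apply: eq_bigr => i _; by rewrite addnC.
    rewrite [leRHS](big_cat_nat (n := x)) /=; try lia.
    rewrite [X in _ <= _ + X](big_cat_nat (n := (x + (m - d).+1)%N)) /=; try lia.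
    have s0 p q : 0 <= \sum_(p <= i < q) g i by apply: sumr_ge0.
    by have := s0 0%N x; have := s0 (x + (m - d).+1)%N m.+1; lra.
  apply: ler_sum => y _; have := ltn_ord y; set t := (x + y)%N => yd.
  have tm : (t <= m)%N by rewrite /t; lia.
  rewrite /g (leqW tm) mul1n !natrM.
  have := @hypergeometric_le R m d t x dm' tm (leq_addr _ _).
  have -> : (t - x = y)%N by rewrite /t addKn.
  rewrite natrM => hyp.
  have {}hyp : 'C(d, x)%:R * 'C(m - d, y)%:R <= 'C(m, t)%:R * (K * r t).
    apply: le_trans hyp _; rewrite ler_wpM2l // /K -mulrA ler_wpM2l //.
    rewrite /antidiagonal_gap dm' /=.
    by apply: sqrt_ratio_le; rewrite ?ler0n ?ltr0n ?ler_nat ?lexx //=; lia.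
  have := ler_wpM2l (mulr_ge0 (ler0n R (good_ups m a t)) (ler0n R 'C(m.+2, m.+1 - t))) hyp.
  rewrite /w natrM; lra.
have [e [de em]] : exists e, d = (m + e)%N /\ (e <= m.+2)%N.
  by exists (d - m)%N; lia.
rewrite {1}de count_passing_last // natr_sum; apply: ler_sum => t _.
rewrite !natrM.
case: (leqP t x) => tx; last first.
  by rewrite /= ?(mul0r, mulr0) mulr_ge0 // mulr_ge0 // mulr_ge0 // /w ?invr_ge0 ?sqrtr_ge0.
case: (leqP x m.+1) => xm; last first.
  by rewrite /= ?(mul0r, mulr0) mulr_ge0 // mulr_ge0 // mulr_ge0 // /w ?invr_ge0 ?sqrtr_ge0.
rewrite /= !mul1r.
(* The second bridge has m + 1 - t ups out of m + 2 steps; both m + 1 - t and t + 1 are at least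
   min(t, m - t), so the same [r t] applies. *)
have hyp : 'C(e, x - t)%:R * 'C(m.+2 - e, m.+1 - x)%:R <= 'C(m.+2, m.+1 - t)%:R * (K * r t).
  have := @hypergeometric_le R m.+2 e (m.+1 - t) (x - t) em ltac:(lia) ltac:(lia).
  have -> : (m.+1 - t - (x - t) = m.+1 - x)%N by lia.
  rewrite natrM => /le_trans; apply; rewrite ler_wpM2l // /K -mulrA ler_wpM2l //.
  rewrite /antidiagonal_gap leqNgt dm' /= de addKn.
  by apply: sqrt_ratio_le; rewrite ?ler0n ?ltr0n ?ler_nat //=; lia.
have := ler_wpM2l (mulr_ge0 (ler0n R (good_ups m a t)) (ler0n R 'C(m, t))) hyp.
by rewrite /w natrM; lra.
Qed.

Lemma sum_inv_sqrt_gap_le n :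
  \sum_(d < n.+1) (Num.sqrt (minn d (n - d)).+1%:R)^-1 <= 4 * Num.sqrt n.+1%:R :> R.
Proof.
have s0 k : 0 <= (Num.sqrt k.+1%:R)^-1 :> R by rewrite invr_ge0 sqrtr_ge0.
apply: (@le_trans _ _ (\sum_(d < n.+1) ((Num.sqrt d.+1%:R)^-1 + (Num.sqrt (n - d).+1%:R)^-1))).
  apply: ler_sum => d _; rewrite /minn; case: ifP => _; by rewrite ?lerDl ?lerDr.
rewrite big_split /= [X in _ + X](reindex_inj rev_ord_inj) /=.
have -> : \sum_(j < n.+1) (Num.sqrt (n - (n.+1 - j.+1)).+1%:R)^-1 =
          \sum_(j < n.+1) (Num.sqrt j.+1%:R)^-1 :> R.
  by apply: eq_bigr => j _; rewrite subSS subKn // -ltnS.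
by have := @sum_inv_sqrt_le R n.+1; lra.
Qed.

(** Each bridge contributes O(sqrt m) to the sum of inverse square roots of the gaps, and the
    prefactor stays bounded when a is proportional to m. *)
Lemma sum_passing_bound_le :
  \sum_(d < (m + m.+2).+1) passing_bound d <=
  128 * Num.sqrt (m.+4%:R / a%:R) * Num.sqrt m.+3%:R.
Proof.
rewrite /passing_bound -mulr_sumr.
have -> : 128 * Num.sqrt (m.+4%:R / a%:R) * Num.sqrt m.+3%:R =
  16 * Num.sqrt (m.+4%:R / a%:R) * (8 * Num.sqrt m.+3%:R) :> R by ring.
apply: ler_wpM2l; first by rewrite mulr_ge0 // sqrtr_ge0.
have s0 k : 0 <= (Num.sqrt k.+1%:R)^-1 :> R by rewrite invr_ge0 sqrtr_ge0.
rewrite -(big_mkord xpredT (fun d => (Num.sqrt (antidiagonal_gap d).+1%:R)^-1)).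
rewrite (big_cat_nat (n := m.+1)) /=; try lia.
apply: (@le_trans _ _ (4 * Num.sqrt m.+1%:R + 4 * Num.sqrt m.+3%:R)); last first.
  have : Num.sqrt m.+1%:R <= Num.sqrt m.+3%:R :> R by rewrite ler_sqrt // ler_nat; lia.
  lra.
apply: lerD.
  apply: le_trans (sum_inv_sqrt_gap_le m).
  rewrite -(big_mkord xpredT (fun d => (Num.sqrt (minn d (m - d)).+1%:R)^-1)).
  rewrite big_nat_cond [leRHS]big_nat_cond; apply: ler_sum => i /andP[im _].
  by rewrite /antidiagonal_gap (_ : (i <= m)%N) //; lia.
apply: le_trans (sum_inv_sqrt_gap_le m.+2).
rewrite -(big_mkord xpredT (fun d => (Num.sqrt (minn d (m.+2 - d)).+1%:R)^-1)).
rewrite [leRHS]big_ltn // -[in leLHS](add1n m) big_addn.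
have -> : ((m + m.+2).+1 - m = m.+3)%N by lia.
apply: ler_wpDl => //; rewrite big_nat_cond [leRHS]big_nat_cond.
apply: ler_sum => i /andP[im _].
by rewrite /antidiagonal_gap (_ : (i + m <= m)%N = false) ?addnK //; lia.
Qed.

End PassingBound.

(** * Up-right paths as bit strings *)

Definition walk_pos (b : seq bool) (d : nat) : nat * nat :=
  ((d - ups (take d b)).+1, (ups (take d b)).+1).

Definition walk (b : seq bool) : seq (nat * nat) := mkseq (walk_pos b) (size b).+1.

Definition steps_of (t : seq (nat * nat)) : seq bool :=
  mkseq (fun d => (nth (0, 0)%N t d.+1).2 != (nth (0, 0)%N t d).2) (size t).-1.

Lemma ups_takeS b d : (d < size b)%N ->
  ups (take d.+1 b) = (ups (take d b) + nth false b d)%N.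
Proof.
by move=> db; rewrite (take_nth false db) -cats1 count_cat /= addn0; case: nth.
Qed.

Lemma ups_take_le b d : (ups (take d b) <= d)%N.
Proof. by apply: leq_trans (count_size _ _) _; rewrite size_take; case: ltnP. Qed.

Lemma ups_take_mono b d e : (d <= e)%N ->
  (ups (take d b) <= ups (take e b) <= ups (take d b) + (e - d))%N.
Proof.
move=> de; rewrite -(cat_take_drop d (take e b)) take_takel // count_cat leq_addr leq_add2l /=.
apply: leq_trans (count_size _ _) _; rewrite size_drop size_take.
by case: ltnP => h; lia.
Qed.

Lemma walk_pos_step b d : (d < size b)%N ->
  walk_pos b d.+1 =
    if nth false b d then ((walk_pos b d).1, (walk_pos b d).2.+1)
    else ((walk_pos b d).1.+1, (walk_pos b d).2).
Proof.
move=> db; rewrite /walk_pos ups_takeS //; have := ups_take_le b d.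
by set u := ups _; case: nth => /= h; congr (_, _); lia.
Qed.

Lemma nth_walk b d : (d <= size b)%N -> nth (0, 0)%N (walk b) d = walk_pos b d.
Proof. by move=> db; rewrite nth_mkseq. Qed.

Lemma steps_of_walk b : steps_of (walk b) = b.
Proof.
apply: (@eq_from_nth _ false); rewrite size_mkseq size_mkseq // => d db.
have -> : nth false (steps_of (walk b)) d =
    ((nth (0, 0)%N (walk b) d.+1).2 != (nth (0, 0)%N (walk b) d).2).
  by rewrite [LHS]nth_mkseq // size_mkseq.
rewrite !nth_walk ?(ltnW db) // walk_pos_step //.
by case: nth => /=; rewrite ?eqxx //; apply/negP => /eqP; lia.
Qed.

Lemma walk_inj : injective walk.
Proof. exact: can_inj steps_of_walk. Qed.

Lemma up_right_walk m b : size b = (m + m.+2)%N -> ups b = m.+1 ->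
  up_right m.+2 (walk b).
Proof.
move=> sb ub; apply/and4P; split.
- by rewrite size_mkseq sb; apply/eqP; lia.
- by rewrite /= /walk_pos take0.
- rewrite (last_nth (0, 0)%N) size_mkseq /= -/(nth _ (walk b) _) nth_walk // /walk_pos.
  by rewrite take_size ub sb; apply/eqP; congr (_, _); lia.
- apply/(sortedP (0, 0)%N) => i; rewrite size_mkseq ltnS => ib.
  rewrite !nth_walk ?(ltnW ib) // walk_pos_step // /up_right_step.
  by case: nth => /=; rewrite eqxx ?orbT.
Qed.

(** By induction on time, the walk rebuilt from the steps of a path retraces it; hence [walk]
    reaches every up-right path. *)
Lemma walk_steps_of m t : up_right m.+2 t ->
  [/\ size (steps_of t) = (m + m.+2)%N, ups (steps_of t) = m.+1 & walk (steps_of t) = t].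
Proof.
case/and4P => /eqP st /eqP ht /eqP lt /(sortedP (0, 0)%N) srt.
have st' : size t = (m + m.+2).+1 by rewrite st; lia.
have sz : size (steps_of t) = (m + m.+2)%N by rewrite size_mkseq st'.
have pos d : (d <= m + m.+2)%N -> walk_pos (steps_of t) d = nth (0, 0)%N t d.
  elim: d => [|d IH] dm; first by rewrite /walk_pos take0 nth0 ht.
  rewrite walk_pos_step ?sz // IH ?(ltnW dm) // nth_mkseq ?st' //.
  have := srt d; rewrite st' ltnS => /(_ dm) /orP[] /eqP ->; first by rewrite /= eqxx.
  by rewrite /= ifT //; apply/negP => /eqP; lia.
have wt : walk (steps_of t) = t.
  apply: (@eq_from_nth _ (0, 0)%N); first by rewrite size_mkseq sz st'.
  by move=> d; rewrite size_mkseq sz ltnS => dm; rewrite nth_walk ?sz // pos.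
split=> //; have := pos _ (leqnn _); have := lt; rewrite (last_nth (0, 0)%N) st' /= => ->.
by rewrite /walk_pos take_oversize ?sz // => -[_ ->].
Qed.

Lemma points_lift N (t : seq (nat * nat)) : size t = N.*2.-1 ->
  all (fun q => (q.1 <= N)%N && (q.2 <= N)%N) t -> exists s : lattice_seq N, points s = t.
Proof.
move=> st tN.
have sz : size [seq (inord p.1 : 'I_N.+1, inord p.2 : 'I_N.+1) | p <- t] == N.*2.-1.
  by rewrite size_map st.
exists (Tuple sz); rewrite /points /= -map_comp; apply: map_id_in => -[i j] /(allP tN) /andP[/= i1 j1].
by rewrite /= !inordK.
Qed.

Section FrameBijection.
Context {R : realType} (beta : R).

(** The integer a of the counting sections. As the hole is centred at N / 2 and not at (N + 1) / 2,
    for beta in (0, 1) the frame has this many columns on the left but one more on the right, and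
    likewise for rows. *)
Definition frame_width (N : nat) : nat :=
  Num.truncn ((N%:R - (Num.floor (beta * N%:R))%:~R) / 2 : R).

Lemma in_frameE N p : (Num.floor (beta * N%:R))%:~R <= N%:R :> R ->
  in_frame beta N p =
    [&& (1 <= p.1 <= N)%N, (1 <= p.2 <= N)%N &
     [|| (p.1 <= frame_width N)%N, (N - p.1 <= frame_width N)%N,
         (p.2 <= frame_width N)%N | (N - p.2 <= frame_width N)%N]].
Proof.
move=> BN; rewrite /in_frame; set B := (Num.floor _)%:~R in BN *.
have x0 : 0 <= (N%:R - B) / 2 by rewrite divr_ge0 // subr_ge0.
have le_width k : (k <= frame_width N)%N = (k%:R <= (N%:R - B) / 2).
  by rewrite /frame_width truncn_ge_nat.
case: (boolP (1 <= p.1 <= N)%N) => //= h1; have p1 : (p.1 <= N)%N by case/andP: h1.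
case: (boolP (1 <= p.2 <= N)%N) => //= h2; have p2 : (p.2 <= N)%N by case/andP: h2.
rewrite !le_width !natrB // le_max !ler_normr -!orbA.
have e1 (k : nat) : (B / 2 <= k%:R - N%:R / 2) = (N%:R - k%:R <= (N%:R - B) / 2).
  by apply/idP/idP; lra.
have e2 (k : nat) : (B / 2 <= - (k%:R - N%:R / 2)) = (k%:R <= (N%:R - B) / 2).
  by apply/idP/idP; lra.
rewrite !e1 !e2; do 4! case: (_ <= _) => //.
Qed.

(** Coordinates are monotone along a path. If the second one is at most a at step m, it was so
    before, and the first one is at least N - a from then on; the other case is symmetric.
    Conversely, step m lies on i + j = N, where the four side conditions collapse to the two of
    [good_ups]. *)
Lemma all_in_frame_walk m b :
  (Num.floor (beta * m.+2%:R))%:~R <= m.+2%:R :> R ->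
  (0 < frame_width m.+2)%N ->
  size b = (m + m.+2)%N -> ups b = m.+1 ->
  all (in_frame beta m.+2) (walk b) = good_ups m (frame_width m.+2) (ups (take m b)).
Proof.
set a := frame_width _ => BN a0 sb ub; apply/idP/idP.
  move/allP/(_ (walk_pos b m)); rewrite in_frameE //= -/a => H.
  have /H : walk_pos b m \in walk b.
    by apply/mapP; exists m; rewrite // mem_iota sb; lia.
  have := ups_take_le b m; rewrite /good_ups /=; lia.
rewrite /good_ups => good; apply/allP => q /(nthP (0, 0)%N)[d].
rewrite size_mkseq sb ltnS => dm <-; rewrite nth_walk ?sb // in_frameE // /walk_pos /= -/a.
have td := ups_take_le b d; have tm := ups_take_le b m.
have := @ups_take_mono b d (m + m.+2)%N ltac:(lia).
rewrite (take_oversize (n := (m + m.+2)%N)) ?sb // ub => de.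
move: (@ups_take_mono b d m) (@ups_take_mono b m d) good td tm de.
move: (ups (take d b)) (ups (take m b)) => t t0 h1 h2 good td tm de.
case: (leqP d m) => dm'; first by have := h1 dm'; lia.
by have := h2 (ltnW dm'); lia.
Qed.

(** Both sides count one and the same duplicate-free list of paths, since [points] and [walk] are
    injective. *)
Lemma card_frame_paths m (Q : pred (seq (nat * nat))) :
  (Num.floor (beta * m.+2%:R))%:~R <= m.+2%:R :> R ->
  (0 < frame_width m.+2)%N ->
  #|[set s in frame_paths beta m.+2 | Q (points s)]| =
  count (fun b => good_bits m (frame_width m.+2) b && Q (walk b)) (bitseqs (m + m.+2)).
Proof.
move=> BN a0; set A := [set s in _ | _].
have points_inj : injective (@points m.+2).
  move=> s t /(inj_map _) st; apply/val_inj/st => -[p1 p2] [q1 q2] [] e1 e2.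
  by congr (_, _); apply: val_inj.
rewrite cardE -(size_map (@points m.+2)) -size_filter -(size_map walk).
apply/eqP; rewrite -uniq_size_uniq.
- by rewrite map_inj_uniq ?enum_uniq.
- by rewrite (map_inj_uniq walk_inj) filter_uniq // bitseqs_uniq.
move=> t; apply/esym; apply/mapP/mapP => [[s]|[b]].
  rewrite mem_enum !inE => /andP[/andP[us fs] Qs ->].
  have [sz ub wb] := walk_steps_of us.
  exists (steps_of (points s)); last by rewrite wb.
  rewrite mem_filter mem_bitseqs sz eqxx andbT wb Qs andbT /good_bits ub eqxx.
  by rewrite -all_in_frame_walk // wb.
rewrite mem_filter mem_bitseqs => /andP[/andP[/andP[/eqP ub gb] Qb] /eqP sb] ->.
have fb : all (in_frame beta m.+2) (walk b) by rewrite all_in_frame_walk.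
have [s E] : exists s : lattice_seq m.+2, points s = walk b.
  apply: points_lift; first by rewrite size_mkseq sb; lia.
  apply/allP => q /(allP fb); rewrite in_frameE // => /and3P[/andP[_ ->] /andP[_ ->] _] //.
exists s; last by rewrite E.
by rewrite mem_enum !inE E Qb fb up_right_walk.
Qed.

End FrameBijection.

(** * Passing probabilities and overlaps of frame paths *)

Definition box (N : nat) : seq (nat * nat) := [seq (i, j) | i <- iota 1 N, j <- iota 1 N].

Lemma mem_box N k : (k \in box N) = (1 <= k.1 <= N)%N && (1 <= k.2 <= N)%N.
Proof.
case: k => i j; apply/allpairsP/idP => [[[x y] [/= xb yb [-> ->]]]|/andP[/= ib jb]].
  by move: xb yb; rewrite !mem_iota !add1n !ltnS => -> ->.
by exists (i, j); rewrite /= !mem_iota !add1n !ltnS.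
Qed.

Lemma box_uniq N : uniq (box N).
Proof. by apply: allpairs_uniq; rewrite ?iota_uniq // => -[? ?] [? ?]. Qed.

Lemma frame_path_walk {R : realType} (beta : R) m (s : lattice_seq m.+2) :
  s \in frame_paths beta m.+2 ->
  exists2 b, points s = walk b & size b = (m + m.+2)%N.
Proof.
rewrite inE => /andP[us _]; have [sz _ wb] := walk_steps_of us.
by exists (steps_of (points s)).
Qed.

Lemma frame_path_box {R : realType} (beta : R) N (s : lattice_seq N) :
  s \in frame_paths beta N -> {subset points s <= box N}.
Proof.
rewrite inE => /andP[_ /allP fs] k /fs; rewrite /in_frame mem_box => /and3P[-> ->] //.
Qed.

Lemma walk_uniq b : uniq (walk b).
Proof.
rewrite map_inj_in_uniq ?iota_uniq // => d e _ _ [].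
have := ups_take_le b d; have := ups_take_le b e.
move: (ups (take d b)) (ups (take e b)) => u v; lia.
Qed.

Lemma frame_path_uniq {R : realType} (beta : R) m (s : lattice_seq m.+2) :
  s \in frame_paths beta m.+2 -> uniq (points s).
Proof. by move=> /frame_path_walk[b -> _]; exact: walk_uniq. Qed.

Section Collisions.
Context {R : realType} (beta : R).

Definition pass_prob N (k : nat * nat) : R :=
  #|[set s in frame_paths beta N | k \in points s]|%:R / #|frame_paths beta N|%:R.

Lemma pass_prob_ge0 N k : 0 <= pass_prob N k.
Proof. by rewrite divr_ge0. Qed.

Lemma sum_mem_points N (k : nat * nat) :
  \sum_(s in frame_paths beta N) (k \in points s)%:R =
  #|[set s in frame_paths beta N | k \in points s]|%:R :> R.
Proof.
rewrite -natr_sum -sum1_card; congr _%:R.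
rewrite big_mkcond /= [RHS]big_mkcond /=; apply: eq_bigr => s _.
have -> : (s \in [set s in frame_paths beta N | k \in points s]) =
    (s \in frame_paths beta N) && (k \in points s) by rewrite [LHS]finset.in_set.
by case: (s \in frame_paths beta N); case: (k \in _).
Qed.

Lemma sum_pass_prob N (f : nat * nat -> R) :
  (forall s, s \in frame_paths beta N -> uniq (points s)) ->
  \sum_(k <- box N) pass_prob N k * f k =
  (\sum_(s in frame_paths beta N) \sum_(k <- points s) f k) / #|frame_paths beta N|%:R.
Proof.
move=> un; rewrite mulr_suml.
have -> : \sum_(s in frame_paths beta N) (\sum_(k <- points s) f k) / #|frame_paths beta N|%:R =
  \sum_(s in frame_paths beta N) \sum_(k <- box N) (k \in points s)%:R * (f k / #|frame_paths beta N|%:R).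
  apply: eq_bigr => s sA; rewrite mulr_suml.
  transitivity (\sum_(k <- box N | k \in points s) f k / #|frame_paths beta N|%:R).
    rewrite -[RHS]big_filter; apply: perm_big; apply: uniq_perm.
    - exact: un.
    - by rewrite filter_uniq // box_uniq.
    - move=> k; rewrite mem_filter andb_idr // => /(frame_path_box sA) //.
  by rewrite big_mkcond /=; apply: eq_bigr => k _; case: (k \in _); rewrite ?mul1r ?mul0r.
rewrite exchange_big /=; apply: eq_bigr => k _.
rewrite -mulr_suml /pass_prob mulrAC mulrA; congr (_ * _ * _).
by rewrite sum_mem_points.
Qed.

Section Fixed.
Variables m : nat.
Let a := frame_width beta m.+2.
Hypotheses (BN : (Num.floor (beta * m.+2%:R))%:~R <= m.+2%:R :> R).
Hypotheses (a_gt0 : (0 < a)%N) (am : (a.*2 <= m.+1)%N).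

Let card_frame : #|frame_paths beta m.+2| = count (good_bits m a) (bitseqs (m + m.+2)).
Proof.
have := card_frame_paths xpredT BN a_gt0.
rewrite (eq_count (a2 := good_bits m a)); last by move=> b; rewrite andbT.
by move=> <-; apply: eq_card => s; rewrite !inE andbT.
Qed.

Lemma card_frame_paths_gt0 : (0 < #|frame_paths beta m.+2|)%N.
Proof.
rewrite card_frame count_good_bits big_ord_recl /= /good_ups a_gt0 mul1n bin0 mul1n subn0.
by rewrite addn_gt0 bin_gt0 leqnSn.
Qed.

(** A path can visit k only at time k.1 + k.2 - 2 and with k.2 - 1 ups behind it, which is the event
    of [passing_le]. *)
Lemma pass_prob_le k : k \in box m.+2 -> pass_prob m.+2 k <= passing_bound m a (k.1 + k.2 - 2).
Proof.
rewrite mem_box => /andP[k1 k2]; set d := (_ - _)%N.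
have dm : (d <= m + m.+2)%N by rewrite /d; lia.
rewrite /pass_prob ler_pdivrMr ?ltr0n ?card_frame_paths_gt0 // mulrC card_frame.
apply: le_trans (passing_le a_gt0 am k.2.-1 dm).
rewrite ler_nat (card_frame_paths (fun t => k \in t)) //.
rewrite -!size_filter; apply: uniq_leq_size; first by rewrite filter_uniq // bitseqs_uniq.
move=> b; rewrite !mem_filter mem_bitseqs => /andP[/andP[-> /mapP[e]]].
rewrite mem_iota => eb ek /eqP sb; rewrite sb eqxx andbT /=.
have [-> ->] : d = e /\ k.2.-1 = ups (take e b).
  rewrite /d ek /walk_pos /=; have := ups_take_le b e.
  by move: (ups _) => u ue; split; lia.
by rewrite eqxx.
Qed.

(** The left-hand side is the mean number of common sites of two independent paths. One factor is
    bounded by a function of time only; a path visits one site at each time, so summing against the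
    other factor leaves a sum over times. *)
Lemma sum_sqr_pass_prob_le :
  \sum_(k <- box m.+2) pass_prob m.+2 k ^+ 2 <=
  128 * Num.sqrt (m.+4%:R / a%:R) * Num.sqrt m.+3%:R.
Proof.
apply: le_trans (sum_passing_bound_le a_gt0 am).
apply: (@le_trans _ _ (\sum_(k <- box m.+2)
    pass_prob m.+2 k * passing_bound m a (k.1 + k.2 - 2))).
  rewrite big_seq [leRHS]big_seq; apply: ler_sum => k kb.
  by rewrite expr2 ler_wpM2l ?pass_prob_ge0 // pass_prob_le.
rewrite (sum_pass_prob (fun k => passing_bound m a (k.1 + k.2 - 2))); last exact: frame_path_uniq.
rewrite ler_pdivrMr ?ltr0n ?card_frame_paths_gt0 // mulr_natr -sumr_const.
apply: ler_sum => s /frame_path_walk[b -> sb].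
have iE : iota 0 (m + m.+2).+1 = index_iota 0 (m + m.+2).+1 by rewrite /index_iota subn0.
rewrite big_map sb iE big_mkord; apply: ler_sum => d _.
rewrite (_ : (_ - 2)%N = d) //; have := ups_take_le b d.
rewrite /walk_pos /=; move: (ups _) => u ud; lia.
Qed.

End Fixed.

(** 2 <= beta N makes the side B of the hole positive, whence 2 a < N; 8 <= (1 - beta) N lets half
    of (1 - beta) N / 2 pay for the truncation. *)
Lemma frame_width_bounds N : 0 < beta < 1 -> 2 <= beta * N%:R -> 8 <= (1 - beta) * N%:R ->
  [/\ (Num.floor (beta * N%:R))%:~R <= N%:R :> R,
      ((frame_width beta N).*2 < N)%N &
      (1 - beta) / 4 * N%:R <= (frame_width beta N)%:R].
Proof.
move=> /andP[b0 b1] bN cN; have N0 := ler0n R N.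
have B1 := floor_le (beta * N%:R); have B2 := lt_succ_floor (beta * N%:R).
rewrite /frame_width; set B := Num.floor _ in B1 B2 *.
have BN : B%:~R <= N%:R :> R by nra.
have x0 : 0 <= (N%:R - B%:~R) / 2 :> R by rewrite divr_ge0 // subr_ge0.
have /andP[t1 t2] := truncn_itv x0; rewrite intrD1 in B2.
split=> //.
  rewrite -(ltr_nat R) -muln2 natrM; lra.
rewrite -(natr1 (Num.truncn _)) in t2; lra.
Qed.

Lemma collisions : 0 < beta < 1 -> exists C : R, exists N0 : nat, 0 <= C /\
  forall m, (N0 <= m)%N -> (0 < #|frame_paths beta m.+2|)%N /\
   \sum_(k <- box m.+2) pass_prob m.+2 k ^+ 2 <= C * Num.sqrt m.+2%:R.
Proof.
move=> hb; have /andP[b0 b1] := hb; have c0 : 0 < 1 - beta by rewrite subr_gt0.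
pose N0 := maxn (Num.truncn (2 / beta)).+1 (Num.truncn (8 / (1 - beta))).+1.
(* The constants come from m + 4 <= 2 (m + 2), a >= (1 - beta)(m + 2) / 4 and m + 3 <= 2 (m + 2). *)
exists (128 * Num.sqrt (8 / (1 - beta)) * Num.sqrt 2), N0; split.
  by rewrite !mulr_ge0 // sqrtr_ge0.
move=> m; rewrite geq_max => /andP[m1 m2].
have big (x : R) : 0 < x -> forall c : R, 0 <= c -> ((Num.truncn (c / x)).+1 <= m)%N -> c <= x * m.+2%:R.
  move=> x0 c cp h; have /andP[_ t] := truncn_itv (divr_ge0 cp (ltW x0)).
  rewrite [leRHS]mulrC -(ler_pdivrMr _ _ x0); apply: le_trans (ltW t) _; rewrite ler_nat; exact: leq_trans h (leqW (leqnSn m)).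
have [BN am ac] := frame_width_bounds hb (big _ b0 _ (ler0n _ 2) m1) (big _ c0 _ (ler0n _ 8) m2).
have a0 : 0 < (frame_width beta m.+2)%:R :> R.
  by apply: lt_le_trans ac; rewrite mulr_gt0 // divr_gt0.
have a0' : (0 < frame_width beta m.+2)%N by rewrite -(ltr0n R).
split; first exact: card_frame_paths_gt0.
apply: le_trans (sum_sqr_pass_prob_le BN a0' am) _.
rewrite -!mulrA ler_wpM2l // ler_pM ?sqrtr_ge0 //.
  apply: ler_wsqrtr; rewrite ler_pdivrMr //.
  apply: le_trans (ler_wpM2l _ ac); last by rewrite divr_ge0 // ltW.
  have -> : 8 / (1 - beta) * ((1 - beta) / 4 * m.+2%:R) = 2 * m.+2%:R by field; rewrite gt_eqF.
  by rewrite -natrM ler_nat; lia.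
by rewrite -sqrtrM // ler_wsqrtr // -natrM ler_nat; lia.
Qed.

End Collisions.

(** * Expectations over finite products *)

Section FiniteProductExpectation.
Context {R : realType} (K : eqType) (A : finType) (q : K -> A -> R) (v : A -> R).

Definition upd (x : K -> R) (k : K) (c : R) : K -> R := fun l => if l == k then c else x l.

Lemma updC x k l c e : k != l -> upd (upd x k c) l e = upd (upd x l e) k c.
Proof.
move=> kl; apply/funext => j; rewrite /upd; case: (j =P l) => [->|//].
by rewrite eq_sym (negbTE kl).
Qed.

Lemma sum_upd (t : seq K) (P : pred K) x k c : uniq t -> P k ->
  \sum_(l <- t | P l) upd x k c l = \sum_(l <- t | P l && (l != k)) x l + (k \in t)%:R * c.
Proof.
move=> ut Pk; rewrite [LHS](bigID (fun l => l == k)) /= addrC; congr (_ + _).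
  by apply: eq_bigr => l /andP[_ /negbTE lk]; rewrite /upd lk.
case: (boolP (k \in t)) => kt.
  rewrite big_mkcond (bigD1_seq k) //= Pk eqxx /= big1 ?addr0.
    by rewrite /upd eqxx mul1r.
  by move=> l /negbTE ->; rewrite andbF.
by rewrite mul0r big1_seq // => l /andP[/andP[_ /eqP ->]]; rewrite (negbTE kt).
Qed.

Definition avg (k : K) (f : R -> R) : R := \sum_(a : A) q k a * f (v a).

(** The head of s is the outermost average and coordinates outside s are frozen at x, so the inner
    [expect] of a split list is a conditional expectation given the coordinates already revealed. *)
Fixpoint expect (s : seq K) (F : (K -> R) -> R) (x : K -> R) : R :=
  if s is k :: s' then avg k (fun c => expect s' F (upd x k c)) else F x.

Variable D : pred K.
Hypothesis q_ge0 : forall k a, D k -> 0 <= q k a.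
Hypothesis sum_q : forall k, D k -> \sum_(a : A) q k a = 1.

Lemma avg_le k f g : D k -> (forall c, f c <= g c) -> avg k f <= avg k g.
Proof. by move=> Dk fg; apply: ler_sum => a _; rewrite ler_wpM2l ?q_ge0. Qed.

Lemma avgD k f g : avg k (fun c => f c + g c) = avg k f + avg k g.
Proof. by rewrite -big_split; apply: eq_bigr => a _; rewrite mulrDr. Qed.

Lemma avgZ k e f : avg k (fun c => e * f c) = e * avg k f.
Proof. by rewrite mulr_sumr; apply: eq_bigr => a _; rewrite mulrCA. Qed.

Lemma avgB k f g : avg k (fun c => f c - g c) = avg k f - avg k g.
Proof. by rewrite /avg -sumrB; apply: eq_bigr => a _; rewrite mulrBr. Qed.

Lemma avg_cst k e : D k -> avg k (fun _ => e) = e.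
Proof. by move=> Dk; rewrite /avg -mulr_suml sum_q ?mul1r. Qed.

Lemma avg_polynomial k (f : R -> R) (c0 c1 c2 c4 c6 : R) : D k ->
  avg k (fun c => c0 + c1 * f c + (c2 * f c ^+ 2 + c4 * f c ^+ 4 + c6 * f c ^+ 6)) =
  c0 + c1 * avg k f + (c2 * avg k (fun c => f c ^+ 2) + c4 * avg k (fun c => f c ^+ 4) +
    c6 * avg k (fun c => f c ^+ 6)).
Proof. by move=> Dk; rewrite -!avgZ -[X in _ = X + _ + _](avg_cst c0 Dk) -!avgD. Qed.

Lemma norm_avg_le k f : D k -> `|avg k f| <= avg k (fun c => `|f c|).
Proof.
move=> Dk; apply: le_trans (ler_norm_sum _ _ _) _; apply: ler_sum => a _.
by rewrite normrM ger0_norm ?q_ge0.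
Qed.

Lemma eq_avg k f g : f =1 g -> avg k f = avg k g.
Proof. by move=> fg; apply: eq_bigr => a _; rewrite fg. Qed.

Lemma eq_expect s F G x : F =1 G -> expect s F x = expect s G x.
Proof. by move=> FG; elim: s x => [|k s IH] x //=; apply: eq_avg => c. Qed.

Lemma expect_le s F G x : all D s -> (forall z, F z <= G z) -> expect s F x <= expect s G x.
Proof.
move=> + FG; elim: s x => [|k s IH] x //= /andP[Dk Ds].
by apply: avg_le => // c; apply: IH.
Qed.

Lemma expectD s F G x : expect s (fun z => F z + G z) x = expect s F x + expect s G x.
Proof. by elim: s x => [|k s IH] x //=; rewrite -avgD; apply: eq_avg => c. Qed.

Lemma expectZ s e F x : expect s (fun z => e * F z) x = e * expect s F x.
Proof. by elim: s x => [|k s IH] x //=; rewrite -avgZ; apply: eq_avg => c. Qed.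

Lemma expect_cst s e x : all D s -> expect s (fun _ => e) x = e.
Proof.
elim: s x => [|k s IH] x //= /andP[Dk Ds].
by rewrite -[RHS](avg_cst e Dk); apply: eq_avg => c; apply: IH.
Qed.

Lemma expect_sum (I : Type) (r : seq I) (P : pred I) (F : I -> (K -> R) -> R) s x :
  all D s ->
  expect s (fun z => \sum_(i <- r | P i) F i z) x = \sum_(i <- r | P i) expect s (F i) x.
Proof.
move=> Ds; elim: r => [|i r IH].
  by rewrite big_nil -[RHS](expect_cst 0 x Ds); apply: eq_expect => z; rewrite big_nil.
rewrite big_cons; case: ifP => Pi.
  by rewrite -IH -expectD; apply: eq_expect => z; rewrite big_cons Pi.
by rewrite -IH; apply: eq_expect => z; rewrite big_cons Pi.
Qed.

Lemma expect_markov s (F : (K -> R) -> R) (eta c : R) x : all D s -> 0 < eta ->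
  expect s (fun z => (eta <= `|F z - c|)%R%:R) x <= expect s (fun z => (F z - c) ^+ 6) x / eta ^+ 6.
Proof.
move=> Ds e0; rewrite mulrC -expectZ; apply: expect_le => // z.
have z0 : 0 <= (F z - c) ^+ 6 by rewrite (@exprM _ _ 3 2) sqr_ge0.
case: (lerP eta `|F z - c|) => h /=; last by rewrite mulr_ge0 // invr_ge0 exprn_ge0 // ltW.
rewrite mulrC ler_pdivlMr ?exprn_gt0 // mul1r.
have -> : (F z - c) ^+ 6 = `|F z - c| ^+ 6 by rewrite -normrX ger0_norm.
by rewrite lerXn2r // nnegrE // ltW.
Qed.

Section Moments.
Variables (F : (K -> R) -> R) (p : K -> R) (M : R).
Hypothesis p_ge0 : forall k, 0 <= p k.
Hypothesis F_lip : forall k x c e, `|F (upd x k c) - F (upd x k e)| <= p k * `|c - e|.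
Hypothesis M_ge1 : 1 <= M.
Hypothesis moment_le : forall k j, D k -> (j <= 3)%N ->
  avg k (fun c => (`|c| + avg k Num.norm) ^+ j.*2) <= M.

Lemma expect_lip s k x c e : all D s -> k \notin s ->
  `|expect s F (upd x k c) - expect s F (upd x k e)| <= p k * `|c - e|.
Proof.
elim: s x => [|l s IH] x //= /andP[Dl Ds]; rewrite inE negb_or => /andP[kl ks].
rewrite -avgB; apply: le_trans (norm_avg_le _ Dl) _.
rewrite -[leRHS](avg_cst _ Dl); apply: avg_le => // b.
by rewrite ![upd (upd _ k _) l b]updC //; apply: IH.
Qed.

(* The coefficients are what makes the induction of [potential_step] close. *)
Definition potential (y S : R) : R :=
  y ^+ 6 + 25 * M * S * y ^+ 4 + 100 * M ^+ 2 * S ^+ 2 * y ^+ 2 + 34 * M ^+ 3 * S ^+ 3.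

(** One martingale increment is absorbed by raising S to S + P. Completing squares removes the odd
    powers of the increment beyond the first, so only its mean and its even moments matter. *)
Lemma potential_step k (d : R -> R) (y S P : R) : D k -> 0 <= S -> 0 <= P ->
  avg k d = 0 -> (forall j, (j <= 3)%N -> avg k (fun c => d c ^+ j.*2) <= M * P ^+ j) ->
  avg k (fun c => potential (y + d c) S) <= potential y (S + P).
Proof.
move=> Dk S0 P0 d0 dm.
have m1 : avg k (fun c => d c ^+ 2) <= M * P := dm 1%N isT.
have m2 : avg k (fun c => d c ^+ 4) <= M * P ^+ 2 := dm 2%N isT.
have m3 : avg k (fun c => d c ^+ 6) <= M * P ^+ 3 := dm 3%N isT.
set a := 25 * M * S; set b := 100 * M ^+ 2 * S ^+ 2; set g := 34 * M ^+ 3 * S ^+ 3.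
have M1 := M_ge1; have M0 : 0 <= M by lra.
have a0 : 0 <= a by rewrite /a !mulr_ge0.
have b0 : 0 <= b by rewrite /b !mulr_ge0 // exprn_ge0.
apply: (@le_trans _ _ (avg k (fun c =>
   (y ^+ 6 + a * y ^+ 4 + b * y ^+ 2 + g) + (6 * y ^+ 5 + a * 4 * y ^+ 3 + b * 2 * y) * d c
   + ((25 * y ^+ 4 + a * 8 * y ^+ 2 + b) * d c ^+ 2 + (28 * y ^+ 2 + a * 3) * d c ^+ 4
   + 4 * d c ^+ 6)))).
  apply: avg_le => // c; rewrite /potential -/a -/b -/g; set e := d c.
  have h4 : (y + e) ^+ 4 <= y ^+ 4 + 4 * y ^+ 3 * e + 8 * y ^+ 2 * e ^+ 2 + 3 * e ^+ 4.
    have -> : y ^+ 4 + 4 * y ^+ 3 * e + 8 * y ^+ 2 * e ^+ 2 + 3 * e ^+ 4 =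
      (y + e) ^+ 4 + 2 * (e * (y - e)) ^+ 2 by ring.
    by rewrite lerDl mulr_ge0 // sqr_ge0.
  have h6 : (y + e) ^+ 6 <=
     y ^+ 6 + 6 * y ^+ 5 * e + 25 * y ^+ 4 * e ^+ 2 + 28 * y ^+ 2 * e ^+ 4 + 4 * e ^+ 6.
    have -> : y ^+ 6 + 6 * y ^+ 5 * e + 25 * y ^+ 4 * e ^+ 2 + 28 * y ^+ 2 * e ^+ 4 + 4 * e ^+ 6
      = (y + e) ^+ 6 + (10 * (y * e * (y - e)) ^+ 2 + 3 * (e ^+ 2 * (y - e)) ^+ 2) by ring.
    by rewrite lerDl addr_ge0 // mulr_ge0 // sqr_ge0.
  have := ler_wpM2l a0 h4; rewrite -/e; lra.
rewrite avg_polynomial // d0 mulr0 addr0.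
rewrite /potential; move: (avg k (fun c => d c ^+ 2)) (avg k (fun c => d c ^+ 4))
  (avg k (fun c => d c ^+ 6)) m1 m2 m3 => e2 e4 e6 m1 m2 m3.
have y2 : 0 <= y ^+ 2 by rewrite sqr_ge0.
have y4 : 0 <= y ^+ 4 by rewrite (@exprM _ _ 2 2) sqr_ge0.
have n1 := ler_wpM2l (addr_ge0 (addr_ge0 (mulr_ge0 (ler0n R 25) y4) (mulr_ge0 (mulr_ge0 a0 (ler0n R 8)) y2)) b0) m1.
have n2 := ler_wpM2l (addr_ge0 (mulr_ge0 (ler0n R 28) y2) (mulr_ge0 a0 (ler0n R 3))) m2.
have n3 := ler_wpM2l (ler0n R 4) m3.
apply: (@le_trans _ _ (y ^+ 6 + a * y ^+ 4 + b * y ^+ 2 + g +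
   ((25 * y ^+ 4 + a * 8 * y ^+ 2 + b) * (M * P) +
    (28 * y ^+ 2 + a * 3) * (M * P ^+ 2) + 4 * (M * P ^+ 3)))); first by lra.
(* The remaining difference is a polynomial in P, S and y^2 whose coefficients are nonnegative
   because M >= 1. *)
rewrite -subr_ge0 /a /b /g.
rewrite [X in 0 <= X](_ : _ =
  M * (100 * M - 28) * P ^+ 2 * y ^+ 2 + 2 * M ^+ 3 * S ^+ 2 * P +
  M ^+ 2 * (102 * M - 75) * S * P ^+ 2 + M * (34 * M ^+ 2 - 4) * P ^+ 3); last by ring.
have c1 : 0 <= 100 * M - 28 by lra.
have c2 : 0 <= 102 * M - 75 by lra.
have c3 : 0 <= 34 * M ^+ 2 - 4 by have := exprn_ege1 2 M_ge1; lra.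
move: (100 * M - 28) (102 * M - 75) (34 * M ^+ 2 - 4) c1 c2 c3 => c1 c2 c3 h1 h2 h3.
move: (exprn_ge0 2 P0) (exprn_ge0 3 P0) (exprn_ge0 2 S0) (exprn_ge0 2 M0) (exprn_ge0 3 M0).
move: (y ^+ 2) y2 (P ^+ 2) (P ^+ 3) (S ^+ 2) (M ^+ 2) (M ^+ 3).
by move=> *; rewrite !addr_ge0 // !mulr_ge0.
Qed.

(* A conditional sixth-moment bound in which the outermost variable is peeled
   off first; the offset [y] collects the increments already revealed. *)
Lemma moment6_potential s x y : all D s -> uniq s ->
  expect s (fun z => (F z - expect s F x + y) ^+ 6) x <=
  potential y (\sum_(k <- s) p k ^+ 2).
Proof.
elim: s x y => [|k s IH] x y /=.
  move=> _ _; rewrite big_nil /potential subrr add0r.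
  by rewrite !expr0n /= !(mulr0, mul0r, addr0).
move=> /andP[Dk Ds] /andP[ks us]; rewrite big_cons addrC.
set m := fun c => expect s F (upd x k c).
pose d c := m c - avg k m.
apply: (@le_trans _ _ (avg k (fun c => potential (y + d c) (\sum_(k <- s) p k ^+ 2)))).
  apply: avg_le => // c; apply: le_trans (IH (upd x k c) (y + d c) Ds us).
  rewrite le_eqVlt; apply/orP; left; apply/eqP; apply: eq_expect => z.
  by congr (_ ^+ 6); rewrite /d /m; ring.
apply: potential_step => //.
- by apply: sumr_ge0 => i _; rewrite sqr_ge0.
- by rewrite sqr_ge0.
- by rewrite /d avgB avg_cst // subrr.
move=> j j3; apply: (@le_trans _ _ (avg k (fun c => (p k ^+ 2) ^+ j * (`|c| + avg k Num.norm) ^+ j.*2))).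
  apply: avg_le => // c; rewrite -exprM mul2n -exprMn.
  rewrite -mul2n !(exprM _ 2); apply: lerXn2r; rewrite ?nnegrE ?sqr_ge0 //.
  rewrite -ler_sqrt ?sqr_ge0 // !sqrtr_sqr [leRHS]ger0_norm; last first.
    rewrite mulr_ge0 // addr_ge0 // -(avg_cst 0 Dk); exact: avg_le.
  (* The increment is an average of differences against an independent copy e of the variable; the
     Lipschitz bound then gives p k times |c| plus the mean of |e|. *)
  have -> : d c = avg k (fun e => m c - m e).
    by rewrite avgB avg_cst.
  apply: le_trans (norm_avg_le _ Dk) _.
  apply: (@le_trans _ _ (avg k (fun e => p k * (`|c| + `|e|)))).
    apply: avg_le => // e; apply: le_trans (expect_lip _ _ _ Ds ks) _.
    by rewrite ler_wpM2l // ler_normB.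
  by rewrite avgZ avgD avg_cst.
by rewrite avgZ mulrC ler_wpM2r ?exprn_ge0 ?sqr_ge0 // moment_le.
Qed.

Lemma moment6_le s x : all D s -> uniq s ->
  expect s (fun z => (F z - expect s F x) ^+ 6) x <= 34 * M ^+ 3 * (\sum_(k <- s) p k ^+ 2) ^+ 3.
Proof.
move=> Ds us; have := moment6_potential x 0 Ds us.
rewrite /potential !expr0n /= !mulr0 !add0r; apply: le_trans.
rewrite le_eqVlt; apply/orP; left; apply/eqP; apply: eq_expect => z; by rewrite addr0.
Qed.

End Moments.

(** Each averaged variable belonging to t is traded for one step in the index of u, at cost err. The
    recursion exchanges the inner variables first, under the average over the outermost one. *)
Lemma lindeberg_telescope (u : nat -> R -> R) (h err : R) (t : seq K) :
  uniq t ->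
  (forall j k y, D k -> `|avg k (fun c => u j (y + h * c)) - u j.+1 y| <= err) ->
  forall s j x, all D s -> uniq s ->
  `|expect s (fun z => u j (h * \sum_(k <- t) z k)) x -
    u (j + count (mem t) s)%N (h * \sum_(k <- t | k \notin s) x k)| <=
  (count (mem t) s)%:R * err.
Proof.
move=> ut step; elim=> [|k s IH] j x /=.
  move=> _ _; rewrite addn0 mul0r.
  by rewrite [X in _ - X](_ : _ = u j (h * \sum_(k <- t) x k)) ?subrr ?normr0.
move=> /andP[Dk Ds] /andP[ks us].
set n := count (mem t) s.
set S := \sum_(l <- t | l \notin k :: s) x l.
have split_sum c : \sum_(l <- t | l \notin s) upd x k c l = S + (k \in t)%:R * c.
  rewrite sum_upd //; congr (_ + _); apply: eq_bigl => l.
  by rewrite inE negb_or andbC.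
have key : `|avg k (fun c => expect s (fun z => u j (h * \sum_(k <- t) z k)) (upd x k c)) -
     avg k (fun c => u (j + n)%N (h * (S + (k \in t)%:R * c)))| <= n%:R * err.
  rewrite -avgB; apply: le_trans (norm_avg_le _ Dk) _.
  rewrite -[leRHS](avg_cst _ Dk); apply: avg_le => // c; rewrite -split_sum.
  exact: IH.
case: (boolP (k \in t)) key => kt key /=.
  rewrite add1n addnS -natr1 mulrDl mul1r.
  set X := avg k _ in key *; set Y := avg k _ in key.
  have -> : X - u (j + n).+1 (h * S) = (X - Y) + (Y - u (j + n).+1 (h * S)) by ring.
  apply: le_trans (ler_normD _ _) _; apply: lerD => //.
  rewrite /Y (eq_avg k (g := fun c => u (j + n)%N (h * S + h * c))); last first.
    by move=> c; rewrite mul1r mulrDr.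
  exact: step.
rewrite add0n; move: key; rewrite [X in _ - X](_ : _ = u (j + n)%N (h * S)) //.
rewrite -[RHS](avg_cst _ Dk); apply: eq_avg => c; by rewrite mul0r addr0.
Qed.

End FiniteProductExpectation.

(** * Gaussian test functions *)

Lemma mvt_norm_le {R : realType} (f df : R -> R) (B y z : R) :
  (forall x : R, is_derive x 1 f (df x)) ->
  (forall x, Num.min y z <= x <= Num.max y z -> `|df x| <= B) ->
  `|f z - f y| <= B * `|z - y|.
Proof.
move=> fd; wlog yz : y z / y <= z.
  move=> wl; case/orP: (le_total y z) => zy; first exact: wl.
  by move=> bd; rewrite distrC [`|z - y|]distrC; apply: wl => // x; rewrite minC maxC; exact: bd.
rewrite min_l // max_r // => bd.
have cf : {within `[y, z], continuous f}.
  by apply: derivable_within_continuous => x _; by have [] := fd x.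
have [c /[!in_itv]/= cyz ->] := MVT_segment yz (fun x _ => fd x) cf.
by rewrite normrM ler_wpM2r // bd.
Qed.

Lemma between_dist_le {R : realDomainType} (y z x : R) :
  Num.min y z <= x <= Num.max y z -> `|x - y| <= `|z - y|.
Proof.
case: (leP y z) => yz /andP[h1 h2].
  by rewrite !ger0_norm ?subr_ge0 // lerD2r.
by rewrite !ler0_norm ?subr_le0 ?(ltW yz) // lerN2 lerD2r.
Qed.

(** The mean value theorem applied twice, at the price of the factor 1/2. The bound on f2 is asked
    for between y and z only, because [Phi_scale_taylor] has to stay away from scale 0. *)
Lemma taylor2_le {R : realType} (f f1 f2 : R -> R) (C y z : R) :
  (forall x : R, is_derive x 1 f (f1 x)) -> (forall x : R, is_derive x 1 f1 (f2 x)) ->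
  (forall x, Num.min y z <= x <= Num.max y z -> `|f2 x| <= C) ->
  `|f z - f y - f1 y * (z - y)| <= C * `|z - y| ^+ 2.
Proof.
move=> d1 d2 bd.
have g1 (x : R) : is_derive x 1 (fun x => f x - f1 y * x) (f1 x - f1 y).
  by apply: is_derive_eq; rewrite /GRing.scale /=; ring.
have -> : f z - f y - f1 y * (z - y) = (f z - f1 y * z) - (f y - f1 y * y) by ring.
rewrite expr2 mulrA; apply: (mvt_norm_le g1) => x xyz.
have C0 : 0 <= C.
  apply: le_trans (normr_ge0 (f2 y)) _; apply: bd; rewrite ge_min le_max lexx //.
apply: (@le_trans _ _ (C * `|x - y|)); last by rewrite ler_wpM2l // between_dist_le.
apply: (mvt_norm_le d2) => t; case: (leP y z) xyz => yz /andP[h1 h2].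
  rewrite min_l // max_r // => /andP[h3 h4]; apply: bd.
  by rewrite min_l // max_r // h3 (le_trans h4).
rewrite min_r // max_l // => /andP[h3 h4]; apply: bd.
by rewrite min_r ?(ltW yz) // max_l ?(ltW yz) // h4 (le_trans h1).
Qed.

Lemma taylor3_le {R : realType} (f f1 f2 f3 : R -> R) (C y z : R) :
  (forall x : R, is_derive x 1 f (f1 x)) -> (forall x : R, is_derive x 1 f1 (f2 x)) ->
  (forall x : R, is_derive x 1 f2 (f3 x)) -> (forall x, `|f3 x| <= C) ->
  `|f z - f y - f1 y * (z - y) - f2 y * (z - y) ^+ 2 / 2| <= C * `|z - y| ^+ 3.
Proof.
move=> d1 d2 d3 bd.
have g1 (x : R) : is_derive x 1 (fun x => f x - f1 y * (x - y) - f2 y * (x - y) ^+ 2 / 2)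
    (f1 x - f1 y - f2 y * (x - y)).
  by apply: is_derive_eq; rewrite /GRing.scale /=; field.
have -> : f z - f y - f1 y * (z - y) - f2 y * (z - y) ^+ 2 / 2 =
  (f z - f1 y * (z - y) - f2 y * (z - y) ^+ 2 / 2) -
  (f y - f1 y * (y - y) - f2 y * (y - y) ^+ 2 / 2) by field.
rewrite [_ ^+ 3]exprSr [leRHS]mulrA; apply: (mvt_norm_le g1) => x xyz.
have C0 : 0 <= C by apply: le_trans (bd 0).
apply: (le_trans (taylor2_le d2 d3 (fun t _ => bd t))).
rewrite ler_wpM2l // lerXn2r ?nnegrE //; exact: between_dist_le.
Qed.

Section Gaussian.
Context {R : realType}.
Local Notation mu := (@lebesgue_measure R).

Definition gauss (x : R) : R := normal_pdf 0 1 x.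

Definition Phi (x : R) : R := fine (normal_prob 0 1 `]-oo, x] : \bar R).

Lemma gaussE x : gauss x = normal_peak 1 * expR (- x ^+ 2 / 2).
Proof.
by rewrite /gauss normal_pdfE ?oner_neq0 // /normal_fun subr0 expr1n.
Qed.

Lemma PhiE x : (Phi x)%:E = normal_prob 0 1 `]-oo, x].
Proof. by rewrite /Phi fineK // fin_num_measure. Qed.

Lemma Phi_ge0 x : 0 <= Phi x.
Proof. by rewrite -lee_fin PhiE. Qed.

Lemma Phi_le1 x : Phi x <= 1.
Proof. rewrite -lee_fin PhiE; exact: probability_le1. Qed.

(** The identity as a random variable under the normal law: its cumulative distribution function is
    [Phi], which gives the limits at infinity. *)
Let idTR : measurableTypeR R -> R := idfun.

#[local] HB.instance Definition _ :=
  @isMeasurableFun.Build _ _ _ _ idTR (@measurable_id _ _ setT).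

Lemma Phi_cvgy : Phi x @[x --> +oo] --> (1 : R).
Proof. exact: fine_cvg (@cvg_cdfy1 _ _ R (normal_prob 0 1) (idTR : {RV (normal_prob 0 1) >-> R})). Qed.

Lemma Phi_cvgNy : Phi x @[x --> -oo] --> (0 : R).
Proof. exact: fine_cvg (@cvg_cdfNy0 _ _ R (normal_prob 0 1) (idTR : {RV (normal_prob 0 1) >-> R})). Qed.

Lemma is_derive_Phi (x : R) : is_derive x 1 Phi (gauss x).
Proof.
have int : mu.-integrable [set` Interval -oo%O (BRight (x + 1))] (EFin \o gauss).
  apply: (integrableS _ _ (subsetT _)) => //; exact: integrable_normal_pdf.
have xx : x < x + 1 by rewrite ltrDl.
have [] := @continuous_FTC1 R gauss -oo%O x (x + 1) xx int (ltNyr x).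
  by apply: continuous_normal_pdf; rewrite oner_neq0.
move=> d1 d2; apply: DeriveDef; first exact: d1.
by rewrite -derive1E; exact: d2.
Qed.

Lemma is_derive_gauss (x : R) : is_derive x 1 gauss (- (x * gauss x)).
Proof.
have -> : gauss = fun x : R => normal_peak 1 * expR (- x ^+ 2 / 2).
  by apply/funext => t; rewrite gaussE.
by apply: is_derive_eq; rewrite /GRing.scale /=; field.
Qed.

Lemma is_derive_gauss2 (x : R) : is_derive x 1 (fun x : R => - (x * gauss x)) ((x ^+ 2 - 1) * gauss x).
Proof.
have dg := is_derive_gauss x.
by apply: is_derive_eq; rewrite /GRing.scale /=; ring.
Qed.

Lemma gauss_ge0 x : 0 <= gauss x. Proof. exact: normal_pdf_ge0. Qed.

(** The polynomial is 16 (1 + x^2 / 4)^2, and 1 + x^2 / 4 <= exp(x^2 / 4), while the peak of the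
    density is at most 1. The bounds on polynomials times [gauss] below are read off from this
    one. *)
Lemma gauss_decay x : (16 + 8 * x ^+ 2 + x ^+ 4) * gauss x <= 16.
Proof.
rewrite gaussE.
have pk : normal_peak (1 : R) <= 1.
  rewrite /normal_peak invf_le1 ?sqrtr_gt0.
    rewrite -[leLHS]sqrtr1 ler_wsqrtr // expr1n mul1r; have := pi_ge2 R; lra.
  by rewrite expr1n mul1r mulrn_wgt0 // pi_gt0.
set e := expR (x ^+ 2 / 4).
have eE : expR (- x ^+ 2 / 2) = (e * e)^-1.
  by rewrite /e -expRD -expRN; congr expR; field.
have e1 : 1 + x ^+ 2 / 4 <= e by exact: expR_ge1Dx.
have x2 : 0 <= x ^+ 2 by rewrite sqr_ge0.
have e0 : 0 < e by exact: expR_gt0.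
rewrite eE mulrCA; apply: (@le_trans _ _ (1 * ((16 + 8 * x ^+ 2 + x ^+ 4) / (e * e)))).
  rewrite ler_wpM2r // divr_ge0 // ?mulr_ge0 ?(ltW e0) //.
  by rewrite (@exprM _ _ 2 2); have := sqr_ge0 (x ^+ 2); lra.
rewrite mul1r ler_pdivrMr ?mulr_gt0 //.
rewrite (@exprM _ _ 2 2); move: (x ^+ 2) x2 e1 => t t0 e1; nra.
Qed.

End Gaussian.

Section GaussianBounds.
Context {R : realType}.
Implicit Types x y : R.

Let sqr_gauss_ge0 x : 0 <= x ^+ 2 * gauss x.
Proof. by rewrite mulr_ge0 ?sqr_ge0 ?gauss_ge0. Qed.

Let quart_gauss_ge0 x : 0 <= x ^+ 4 * gauss x.
Proof. by rewrite mulr_ge0 ?gauss_ge0 // (@exprM _ _ 2 2) sqr_ge0. Qed.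

Lemma gauss_le1 x : gauss x <= 1.
Proof.
have := gauss_decay x; have := sqr_gauss_ge0 x; have := quart_gauss_ge0 x; lra.
Qed.

Let sqr_gauss_le x : x ^+ 2 * gauss x <= 2.
Proof.
have := gauss_decay x; have := gauss_ge0 x; have := quart_gauss_ge0 x; lra.
Qed.

Lemma norm_mul_gauss_le1 x : `|x * gauss x| <= 1.
Proof.
rewrite normrM (ger0_norm (gauss_ge0 x)).
have g0 := gauss_ge0 x; have d := gauss_decay x; have q := quart_gauss_ge0 x.
have : `|x| <= (1 + x ^+ 2) / 2.
  rewrite -[x ^+ 2]real_normK ?num_real //; have := sqr_ge0 (`|x| - 1); lra.
move=> /(ler_wpM2r g0); lra.
Qed.

Lemma norm_cube_gauss_le x : `|x| ^+ 3 * gauss x <= 9.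
Proof.
have g0 := gauss_ge0 x; have d := gauss_decay x; have q := quart_gauss_ge0 x.
have : `|x| ^+ 3 <= (x ^+ 2 + x ^+ 4) / 2.
  have e2 : x ^+ 2 = `|x| ^+ 2 by rewrite real_normK ?num_real.
  have -> : x ^+ 4 = (x ^+ 2) ^+ 2 by ring.
  by rewrite e2; move: `|x| => t; have := sqr_ge0 (t ^+ 2 - t); lra.
move=> /(ler_wpM2r g0); have := sqr_gauss_le x; have := sqr_gauss_ge0 x; lra.
Qed.

Lemma norm_gauss2_le x : `|(x ^+ 2 - 1) * gauss x| <= 3.
Proof.
have := gauss_ge0 x; have := gauss_le1 x; have := sqr_gauss_le x; have := sqr_gauss_ge0 x.
by rewrite ler_norml mulrBl => *; apply/andP; split; lra.
Qed.

Lemma Phi_lip x y : `|Phi x - Phi y| <= `|x - y|.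
Proof.
rewrite -[leRHS]mul1r; apply: (mvt_norm_le is_derive_Phi) => t _.
by rewrite ger0_norm ?gauss_ge0 // gauss_le1.
Qed.

Lemma is_derive_Phi_scale (z t : R) :
  is_derive t 1 (fun t : R => Phi (z * t)) (z * gauss (z * t)).
Proof.
have d1 : is_derive t 1 (fun t : R => z * t) z.
  by apply: is_derive_eq; rewrite /GRing.scale /=; ring.
have h := is_derive1_comp (is_derive_Phi (z * t)) d1.
by apply: (is_derive_eq h); rewrite mulrC.
Qed.

Lemma is_derive_gauss_scale (z t : R) :
  is_derive t 1 (fun t : R => z * gauss (z * t)) (- (z ^+ 2 * (z * t) * gauss (z * t))).
Proof.
have d1 : is_derive t 1 (fun t : R => z * t) z.
  by apply: is_derive_eq; rewrite /GRing.scale /=; ring.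
have d2 : is_derive t 1 (fun t : R => gauss (z * t)) (- (z * t * gauss (z * t)) * z).
  exact: is_derive1_comp (is_derive_gauss (z * t)) d1.
by apply: is_derive_eq; rewrite /GRing.scale /=; ring.
Qed.

(** In the scale t, the second derivative of Phi (z t) is -(z t)^3 gauss (z t) / t^2, which is
    bounded uniformly in z. *)
Lemma Phi_scale_taylor (z a b : R) : 0 < b <= a ->
  `|Phi (z * b) - Phi (z * a) - z * gauss (z * a) * (b - a)| <= 9 / b ^+ 2 * (a - b) ^+ 2.
Proof.
move=> /andP[b0 ba]; have -> : (a - b) ^+ 2 = `|b - a| ^+ 2.
  by rewrite real_normK ?num_real //; ring.
apply: (taylor2_le (is_derive_Phi_scale z) (is_derive_gauss_scale z)) => t.
rewrite min_r // max_l // => /andP[bt ta].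
have t0 : 0 < t by apply: lt_le_trans bt.
have -> : `|- (z ^+ 2 * (z * t) * gauss (z * t))| = `|z * t| ^+ 3 * gauss (z * t) / t ^+ 2.
  rewrite normrN normrM (ger0_norm (gauss_ge0 _)) normrM normrX.
  rewrite [`|z * t|]normrM (gtr0_norm t0); field; by rewrite gt_eqF.
apply: ler_pM; rewrite ?mulr_ge0 ?exprn_ge0 ?gauss_ge0 ?invr_ge0 ?norm_cube_gauss_le ?exprn_ge0 ?(ltW t0) //.
by rewrite lef_pV2 ?posrE ?exprn_gt0 // lerXn2r // nnegrE ltW.
Qed.

End GaussianBounds.

(* Inverse standard deviations before and after adding one variable: with
   [H = (a h)^2], the hypothesis says [b^-2 = a^-2 + h^2]. *)
Lemma inverse_std_step {R : realType} (a b H : R) :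
  0 < a -> 0 < b -> 0 <= H -> b ^+ 2 * (1 + H) = a ^+ 2 ->
  [/\ b <= a, `|(a - b) / a - H / 2| <= H ^+ 2 / 2 &
      9 / b ^+ 2 * (a - b) ^+ 2 <= 9 / 4 * H ^+ 2 * (1 + H)].
Proof.
move=> a0 b0 H0 E.
have ba : b <= a.
  have : b ^+ 2 <= a ^+ 2 by rewrite -E ler_peMr ?sqr_ge0 //; lra.
  by rewrite ler_sqr // nnegrE ltW.
have ab0 : 0 < a + b by rewrite addr_gt0.
set d := (a - b) / a.
have dE : d * (a * (a + b)) = b ^+ 2 * H.
  transitivity (a ^+ 2 - b ^+ 2); first by rewrite /d; field; rewrite gt_eqF.
  by rewrite -E; ring.
have d0 : 0 <= d by rewrite divr_ge0 ?subr_ge0 // ltW.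
have aab : 0 < a * (a + b) by rewrite mulr_gt0.
have dH : d <= H / 2.
  rewrite -(ler_pM2r aab) dE.
  have : 0 <= H * ((a - b) * (a + 2 * b)) by rewrite !mulr_ge0 ?subr_ge0 // addr_ge0 ?mulr_ge0 ?ltW.
  lra.
split=> //.
  rewrite ler0_norm ?subr_le0 // opprB -(ler_pM2r aab) mulrBl dE.
  have e1 : (a - b) = d * a by rewrite /d mulfVK // gt_eqF.
  have e2 : H / 2 * (a * (a + b)) - b ^+ 2 * H = H / 2 * ((a - b) * (a + 2 * b)) by field.
  rewrite e2 e1.
  have -> : H / 2 * (d * a * (a + 2 * b)) = H * (d * (a * (a + 2 * b))) / 2 by ring.
  have : d * (a * (a + 2 * b)) <= H / 2 * (2 * (a * (a + b))).
    apply: ler_pM => //; first by rewrite mulr_ge0 ?addr_ge0 ?mulr_ge0 ?ltW.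
    have := mulr_ge0 (ltW a0) (ltW a0); lra.
  move=> /(ler_wpM2l H0); lra.
have e1 : (a - b) = d * a by rewrite /d mulfVK // gt_eqF.
rewrite e1 exprMn -E.
have -> : 9 / b ^+ 2 * (d ^+ 2 * (b ^+ 2 * (1 + H))) = 9 * d ^+ 2 * (1 + H).
  by field; rewrite gt_eqF.
apply: ler_wpM2r; first lra.
have : d ^+ 2 <= (H / 2) ^+ 2 by apply: lerXn2r; rewrite ?nnegrE // divr_ge0.
lra.
Qed.

(** The heat equation in discrete form, with a^(-2) as time. With z = c - y, r = a h, w = z a and G
    = gauss w, expanding in the averaged variable gives -w G r^2 / 2 at second order, and expanding
    in the scale gives z G (b - a); they agree up to O(r^4) by [inverse_std_step]. *)
Lemma one_step {R : realType} (K : eqType) (A : finType) (q : K -> A -> R) (v : A -> R)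
    (k : K) (c y h a b m1 m2 m3 : R) :
  (forall e, 0 <= q k e) -> \sum_(e : A) q k e = 1 ->
  0 <= h -> 0 < a -> 0 < b -> b ^+ 2 * (1 + (a * h) ^+ 2) = a ^+ 2 ->
  `|avg q v k id| <= m1 -> `|avg q v k (fun e => e ^+ 2) - 1| <= m2 ->
  avg q v k (fun e => `|e| ^+ 3) <= m3 ->
  `|avg q v k (fun e => Phi ((c - (y + h * e)) * a)) - Phi ((c - y) * b)| <=
  (a * h) * m1 + (a * h) ^+ 2 * m2 + 3 * (a * h) ^+ 3 * m3 + 3 * (a * h) ^+ 4 * (1 + (a * h) ^+ 2).
Proof.
move=> q0 q1 h0 a0 b0 E mm1 mm2 mm3.
set r := a * h; have r0 : 0 <= r by rewrite mulr_ge0 // ltW.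
have [ba i1 i2] := inverse_std_step a0 b0 (sqr_ge0 r) E.
set z := c - y; set w := z * a.
(* Only [q k] is known to be a probability, so the general lemmas are applied with the predicate
   that singles out k. *)
have Dk : pred1 k k by rewrite /= eqxx.
have q0' k' e : pred1 k k' -> 0 <= q k' e by move=> /eqP ->.
have q1' k' : pred1 k k' -> \sum_(e : A) q k' e = 1 by move=> /eqP ->.
set G := gauss w; have G0 : 0 <= G := gauss_ge0 w; have G1 : G <= 1 := gauss_le1 w.
have wG := norm_mul_gauss_le1 w; rewrite -/G in wG.
have tay e : `|Phi ((c - (y + h * e)) * a) - (Phi w - G * r * e - w * G * r ^+ 2 / 2 * e ^+ 2)|
    <= 3 * r ^+ 3 * `|e| ^+ 3.
  have -> : (c - (y + h * e)) * a = w - r * e by rewrite /w /z /r; ring.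
  have := taylor3_le w (w - r * e) is_derive_Phi is_derive_gauss is_derive_gauss2 norm_gauss2_le.
  have -> : w - r * e - w = - (r * e) by ring.
  have -> : 3 * `|- (r * e)| ^+ 3 = 3 * r ^+ 3 * `|e| ^+ 3.
    by rewrite normrN normrM (ger0_norm r0) exprMn mulrA.
  by move=> /(le_trans _); apply; rewrite le_eqVlt; apply/orP; left; apply/eqP; congr `|_|; rewrite -/G; field.
set X := avg q v k _; set m := avg q v k id in mm1; set s := avg q v k _ in mm2.
have tayA : `|X - (Phi w - G * r * m - w * G * r ^+ 2 / 2 * s)| <= 3 * r ^+ 3 * m3.
  have -> : Phi w - G * r * m - w * G * r ^+ 2 / 2 * s =
     avg q v k (fun e => Phi w - G * r * e - w * G * r ^+ 2 / 2 * e ^+ 2).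
    by rewrite !avgB (avg_cst _ q1' _ Dk) !avgZ.
  rewrite /X -avgB; apply: le_trans (norm_avg_le _ q0' _ Dk) _.
  apply: le_trans (avg_le _ q0' Dk tay) _.
  by rewrite avgZ ler_wpM2l // mulr_ge0 // exprn_ge0.
have scale := Phi_scale_taylor z (introT andP (conj b0 ba)).
rewrite -/w -/G in scale.
have last_le : `|z * G * (b - a) + w * G * r ^+ 2 / 2| <= r ^+ 4 / 2.
  have -> : z * G * (b - a) + w * G * r ^+ 2 / 2 = - (w * G) * ((a - b) / a - r ^+ 2 / 2).
    by rewrite /w; field; rewrite gt_eqF.
  rewrite normrM normrN -[leRHS]mul1r (@exprM _ r 2 2); exact: ler_pM.
have -> : X - Phi (z * b) = (X - (Phi w - G * r * m - w * G * r ^+ 2 / 2 * s)) -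
   (Phi (z * b) - Phi w - z * G * (b - a)) - G * r * m - w * G * (r ^+ 2 / 2 * (s - 1))
   - (z * G * (b - a) + w * G * r ^+ 2 / 2) by field.
have n1 : `|G * r * m| <= r * m1.
  rewrite mulrAC normrM mulrC (ger0_norm r0) ler_wpM2l // normrM (ger0_norm G0).
  by rewrite -[leRHS]mul1r ler_pM.
have n2 : `|w * G * (r ^+ 2 / 2 * (s - 1))| <= r ^+ 2 / 2 * m2.
  have r2 : 0 <= r ^+ 2 / 2 by rewrite divr_ge0 ?sqr_ge0.
  rewrite normrM -[leRHS]mul1r ler_pM //.
  by rewrite normrM (ger0_norm r2) ler_wpM2l.
have m20 : 0 <= m2 by apply: le_trans mm2.
have r2m : 0 <= r ^+ 2 * m2 by rewrite mulr_ge0 ?sqr_ge0.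
have r4 : 0 <= r ^+ 4 by rewrite exprn_ge0.
have r6 : 0 <= r ^+ 6 by rewrite exprn_ge0.
rewrite -(@exprM _ r 2 2) /= in i2.
move: tayA scale n1 n2 last_le i2; rewrite !ler_norml.
move=> /andP[t1 t2] /andP[u1 u2] /andP[v1 v2] /andP[w1 w2] /andP[x1 x2] i2.
have e6 : r ^+ 4 * r ^+ 2 = r ^+ 6 by rewrite -exprD.
by apply/andP; split; lra.
Qed.

(** * Averages over frame paths in a fixed environment *)

Section QuenchedMean.
Context {R : realType} (beta : R).

Definition quenched_mean (N : nat) (g : R -> R) (x : nat * nat -> R) : R :=
  (\sum_(s in frame_paths beta N) g ((Num.sqrt (2 * N%:R - 1))^-1 * \sum_(k <- points s) x k)) /
  #|frame_paths beta N|%:R.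

(** A change of the weight at k affects only the paths through k, a proportion [pass_prob] of
    all. *)
Lemma quenched_mean_lip m (g : R -> R) (L : R) : 0 <= L ->
  (forall y z, `|g y - g z| <= L * `|y - z|) ->
  forall k x c e, `|quenched_mean m.+2 g (upd x k c) - quenched_mean m.+2 g (upd x k e)| <=
    L * (Num.sqrt (2 * m.+2%:R - 1))^-1 * pass_prob beta m.+2 k * `|c - e|.
Proof.
move=> L0 gL k x c e; rewrite /quenched_mean; set h := (Num.sqrt _)^-1.
have h0 : 0 <= h by rewrite invr_ge0 sqrtr_ge0.
rewrite -mulrBl normrM [X in _ * X]ger0_norm ?invr_ge0 // /pass_prob.
rewrite [leRHS]mulrAC !mulrA; apply: ler_wpM2r; first by rewrite invr_ge0.
rewrite -sumrB; apply: le_trans (ler_norm_sum _ _ _) _.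
apply: (@le_trans _ _ (\sum_(s in frame_paths beta m.+2) L * h * ((k \in points s)%:R * `|c - e|))).
  apply: ler_sum => s sA; apply: le_trans (gL _ _) _; rewrite -mulrA ler_wpM2l //.
  rewrite -mulrBr normrM (ger0_norm h0) ler_wpM2l //.
  rewrite !sum_upd ?(frame_path_uniq sA) // opprD addrACA subrr add0r -mulrBr normrM.
  by rewrite ger0_norm.
rewrite -mulr_sumr -mulr_suml sum_mem_points.
by rewrite le_eqVlt; apply/orP; left; apply/eqP; ring.
Qed.

Lemma size_frame_path N (s : lattice_seq N) : size (points s) = N.*2.-1.
Proof. by rewrite size_map size_tuple. Qed.

Section Expectation.
Variables (A : finType) (q : nat * nat -> A -> R) (v : A -> R) (m : nat).
Let N := m.+2.
Let n : nat := N.*2.-1.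
Let h : R := (Num.sqrt (2 * N%:R - 1))^-1.
Let D : pred (nat * nat) := fun k => (1 <= k.1)%N && (1 <= k.2)%N.
Hypothesis q_ge0 : forall k a, D k -> 0 <= q k a.
Hypothesis sum_q : forall k, D k -> \sum_(a : A) q k a = 1.

Let D_box : all D (box N).
Proof. by apply/allP => k; rewrite mem_box /D => /andP[/andP[-> _] /andP[-> _]]. Qed.

Let nE : n%:R = 2 * N%:R - 1 :> R.
Proof.
have /(congr1 (fun k => k%:R : R)) : (n + 1 = 2 * N)%N by rewrite /n /N; lia.
by rewrite natrD natrM => <-; ring.
Qed.

Let h_ge0 : 0 <= h. Proof. by rewrite invr_ge0 sqrtr_ge0. Qed.

Let nh2 : n%:R * h ^+ 2 = 1.
Proof.
rewrite /h -nE exprVn sqr_sqrtr ?ler0n // mulfV // pnatr_eq0 /n /N; lia.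
Qed.

(** Every path consists of 2N - 1 distinct sites, so the Lindeberg exchange gives the same limit and
    the same error along each of them, and averaging over paths keeps both. *)
Lemma annealed_mean (c eps m1 m2 m3 : R) : 0 < eps -> (0 < #|frame_paths beta N|)%N ->
  (forall k, D k -> `|avg q v k id| <= m1) ->
  (forall k, D k -> `|avg q v k (fun e => e ^+ 2) - 1| <= m2) ->
  (forall k, D k -> avg q v k (fun e => `|e| ^+ 3) <= m3) ->
  0 <= m1 -> 0 <= m2 -> 0 <= m3 ->
  `|expect q v (box N) (quenched_mean N (fun y => Phi ((c - y) / eps))) (fun=> 0) -
    Phi (c / Num.sqrt (eps ^+ 2 + 1))| <=
  n%:R * (h / eps * m1 + (h / eps) ^+ 2 * m2 + 3 * (h / eps) ^+ 3 * m3 +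
     3 * (h / eps) ^+ 4 * (1 + (h / eps) ^+ 2)).
Proof.
move=> e0 A0 mm1 mm2 mm3 m10 m20 m30; set err := (X in n%:R * X).
(* Inverse standard deviation after j exchanges; since n h^2 = 1 it runs from 1 / eps to 1 /
   sqrt(eps^2 + 1). *)
pose b (j : nat) : R := (Num.sqrt (eps ^+ 2 + j%:R * h ^+ 2))^-1.
have p0 j : 0 < eps ^+ 2 + j%:R * h ^+ 2.
  by rewrite ltr_wpDr ?exprn_gt0 // mulr_ge0 // sqr_ge0.
have b2 j : b j ^+ 2 = (eps ^+ 2 + j%:R * h ^+ 2)^-1.
  by rewrite exprVn sqr_sqrtr // ltW.
have b0 j : 0 < b j by rewrite invr_gt0 sqrtr_gt0.
have b_le j : b j <= eps^-1.
  rewrite lef_pV2 ?posrE ?sqrtr_gt0 // -[leLHS](ger0_norm (ltW e0)) -sqrtr_sqr.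
  by rewrite ler_wsqrtr // lerDl mulr_ge0 // sqr_ge0.
pose u j y := Phi ((c - y) * b j).
have step j k y : D k -> `|avg q v k (fun e => u j (y + h * e)) - u j.+1 y| <= err.
  move=> Dk; have q0 a := q_ge0 a Dk.
  have bj : b j.+1 ^+ 2 * (1 + (b j * h) ^+ 2) = b j ^+ 2.
    rewrite exprMn !b2 -natr1 mulrDl mul1r; have pj := p0 j; have pj1 := p0 j.+1.
    rewrite -natr1 mulrDl mul1r in pj1; field; by rewrite !gt_eqF // addrA.
  apply: le_trans (one_step c y q0 (sum_q Dk) h_ge0 (b0 j) (b0 j.+1) bj (mm1 k Dk) (mm2 k Dk) (mm3 k Dk)) _.
  have r1 : b j * h <= h / eps by rewrite mulrC ler_wpM2l.
  have r0 : 0 <= b j * h by rewrite mulr_ge0 // ltW.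
  have rX i : (b j * h) ^+ i <= (h / eps) ^+ i by rewrite lerXn2r ?nnegrE // (le_trans r0).
  rewrite /err; apply: lerD; [apply: lerD; [apply: lerD|]|].
  - exact: ler_wpM2r.
  - exact: ler_wpM2r m20 _ _ (rX 2%N).
  - by rewrite ler_wpM2r // ler_wpM2l // rX.
  - apply: ler_pM.
    + by rewrite mulr_ge0 // exprn_ge0.
    + by rewrite addr_ge0 // sqr_ge0.
    + by rewrite ler_wpM2l // rX.
    + by rewrite lerD2l rX.
have each s : s \in frame_paths beta N ->
  `|expect q v (box N) (fun z => Phi ((c - h * \sum_(k <- points s) z k) / eps)) (fun=> 0) -
    Phi (c / Num.sqrt (eps ^+ 2 + 1))| <= n%:R * err.
  move=> sA; have us := frame_path_uniq sA.
  have := lindeberg_telescope q_ge0 sum_q us step 0 (fun=> 0) D_box (box_uniq N).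
  have -> : count (mem (points s)) (box N) = n.
    rewrite /n -(size_frame_path s) -size_filter; apply/eqP.
    rewrite -uniq_size_uniq ?filter_uniq ?box_uniq //.
    by move=> k; rewrite mem_filter andb_idr // => /(frame_path_box sA).
  rewrite big1_seq; last by move=> k /andP[/negP kb /(frame_path_box sA)].
  rewrite mulr0 add0n {2}/u subr0 /b nh2.
  rewrite (@eq_expect _ _ _ q v _ _ (fun z => Phi ((c - h * \sum_(k <- points s) z k) / eps))) //.
  by move=> z; rewrite /u /b mul0r addr0 sqrtr_sqr ger0_norm // ltW.
have -> : expect q v (box N) (quenched_mean N (fun y => Phi ((c - y) / eps))) (fun=> 0) =
  (\sum_(s in frame_paths beta N) expect q v (box N)
    (fun z => Phi ((c - h * \sum_(k <- points s) z k) / eps)) (fun=> 0)) / #|frame_paths beta N|%:R.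
  rewrite -(expect_sum v sum_q _ _ _ _ D_box) mulrC -expectZ; apply: eq_expect => z.
  by rewrite /quenched_mean mulrC.
have A0' : 0 < #|frame_paths beta N|%:R :> R by rewrite ltr0n.
set Y := Phi _ in each *.
rewrite (_ : _ / _ - Y = (\sum_(s in frame_paths beta N) (expect q v (box N)
    (fun z => Phi ((c - h * \sum_(k <- points s) z k) / eps)) (fun=> 0) - Y)) / #|frame_paths beta N|%:R).
  rewrite normrM [X in _ * X]ger0_norm ?invr_ge0 // ler_pdivrMr // mulr_natr -sumr_const.
  by apply: le_trans (ler_norm_sum _ _ _) _; apply: ler_sum.
by rewrite sumrB sumr_const -[Y *+ _]mulr_natr [RHS]mulrBl mulfK ?gt_eqF.
Qed.

Lemma quenched_concentration (g : R -> R) (L M eta : R) : 0 <= L -> 1 <= M -> 0 < eta ->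
  (forall y z, `|g y - g z| <= L * `|y - z|) ->
  (forall k j, D k -> (j <= 3)%N ->
     avg q v k (fun c => (`|c| + avg q v k Num.norm) ^+ j.*2) <= M) ->
  expect q v (box N) (fun z => (eta <= `|quenched_mean N g z -
      expect q v (box N) (quenched_mean N g) (fun=> 0)|)%R%:R) (fun=> 0) <=
  34 * M ^+ 3 * ((L * h) ^+ 2 * \sum_(k <- box N) pass_prob beta N k ^+ 2) ^+ 3 / eta ^+ 6.
Proof.
move=> L0 M1 eta0 gL mM.
apply: le_trans (expect_markov v q_ge0 _ _ _ D_box eta0) _.
rewrite ler_pM2r ?invr_gt0 ?exprn_gt0 //.
have p0 k : 0 <= L * h * pass_prob beta N k by rewrite !mulr_ge0 ?pass_prob_ge0.
apply: le_trans (moment6_le q_ge0 sum_q p0 (quenched_mean_lip m L0 gL) M1 mM _ D_box (box_uniq N)) _.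
rewrite mulr_sumr; under eq_bigr => k _ do rewrite exprMn.
exact: lexx.
Qed.

End Expectation.
End QuenchedMean.

(** * Rounded weights *)

Section DiscreteVariable.
Context {R : realType} {d : measure_display} {T : measurableType d} (P : probability T R).
Context {A : finType} (Y : T -> A).
Hypothesis mY : forall a, measurable (Y @^-1` [set a]).

Let term (f : A -> R) (a : A) : T -> \bar R :=
  (fun t => (f a)%:E * (\1_(Y @^-1` [set a]) t)%:E)%E.

Let termE f t : ((f (Y t))%:E = \sum_a term f a t)%E.
Proof.
rewrite (bigD1 (Y t)) //= big1 ?adde0.
  by rewrite /term indicE mem_set // mule1.
by move=> a aY; rewrite /term indicE memNset ?mule0 // => /= e; rewrite e eqxx in aY.
Qed.

Let integrable_term f a : P.-integrable setT (term f a).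
Proof. by apply: integrableZl => //; exact: integrable_indic. Qed.

Lemma integrable_discrete f : P.-integrable setT (EFin \o (f \o Y)).
Proof.
have -> : EFin \o (f \o Y) = (fun t => \sum_(a <- index_enum A) term f a t)%E.
  by apply/funext => t; rewrite /= termE.
exact: integrable_sum.
Qed.

Lemma integral_discrete f :
  (\int[P]_t (f (Y t))%:E = (\sum_a fine (P (Y @^-1` [set a])) * f a)%:E)%E.
Proof.
under eq_integral do rewrite termE.
rewrite integral_sum //; rewrite -sumEFin; apply: eq_bigr => a _.
rewrite /term integralZl //; last exact: integrable_indic.
rewrite integral_indic // setIT EFinM muleC; congr (_ * _)%E.
by rewrite fineK // fin_num_measure.
Qed.

Lemma sum_discrete_prob : \sum_a fine (P (Y @^-1` [set a])) = 1.
Proof.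
have := integral_discrete (cst 1).
have -> : (\int[P]_t (cst 1 (Y t))%:E = 1%:E)%E.
  transitivity (\int[P]_t (cst 1%:E t))%E; first by [].
  by rewrite integral_cst //= (@probability_setT _ _ _ P) mule1.
by move=> [] ->; apply: eq_bigr => a _; rewrite mulr1.
Qed.

(* [g] is the test function before discretisation, [f] after it. *)
Lemma discrete_approx (X : T -> R) (f : A -> R) (g b : R -> R) (e c : R) :
  measurable_fun setT X -> measurable_fun setT g -> measurable_fun setT b ->
  (forall x, 0 <= b x) -> (\int[P]_t (b (X t))%:E <= c%:E)%E ->
  (forall t, `|f (Y t) - g (X t)| <= b (X t)) ->
  (\int[P]_t (g (X t))%:E = e%:E)%E ->
  `|\sum_a fine (P (Y @^-1` [set a])) * f a - e| <= c.
Proof.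
move=> mX mg mb b0 bc fg ge; have if_ := integrable_discrete f.
have mbX : measurable_fun setT (b \o X) by exact: measurableT_comp.
have mgX : measurable_fun setT (g \o X) by exact: measurableT_comp.
have ib : P.-integrable setT (EFin \o (b \o X)).
  apply/integrableP; split; first exact/measurable_EFinP.
  apply: le_lt_trans (ltry c); apply: le_trans bc.
  by under eq_integral => t _ do rewrite /= ger0_norm //.
have ig : P.-integrable setT (EFin \o (g \o X)).
  apply: (le_integrable measurableT (g := (EFin \o ((fun a => `|f a|%R) \o Y)) \+ (EFin \o (b \o X)))%E).
  - exact/measurable_EFinP.
  - move=> t _ /=; rewrite lee_fin [leRHS]ger0_norm ?addr_ge0 //.
    have e1 : g (X t) = f (Y t) - (f (Y t) - g (X t)) by ring.
    have := fg t; have := ler_normB (f (Y t)) (f (Y t) - g (X t)); rewrite -e1 /=; lra.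
  - apply: integrableD => //; exact: integrable_discrete.
rewrite -lee_fin; apply: le_trans bc.
have -> : `|\sum_a fine (P (Y @^-1` [set a])) * f a - e|%:E =
    `|\int[P]_t ((EFin \o (f \o Y)) \- (EFin \o (g \o X))) t|%E.
  rewrite integralB //= ge.
  by have /= -> := integral_discrete f.
apply: le_trans (le_abse_integral _ _ _) _ => //.
  by apply: emeasurable_funB; [have /integrableP[] := if_|have /integrableP[] := ig].
apply: ge0_le_integral => //.
- apply: measurableT_comp => //.
  by apply: emeasurable_funB; [have /integrableP[] := if_|have /integrableP[] := ig].
- exact/measurable_EFinP.
- by move=> t _ /=; rewrite lee_fin.
Qed.

End DiscreteVariable.

(** Brings the powers that occur under the single majorant 1 + |x|^p, which the moment hypothesis
    integrates. *)
Lemma norm_exp_le_powR {R : realType} (x p : R) (j : nat) : 12 < p -> (j <= 12)%N ->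
  `|x| ^+ j <= 1 + `|x| `^ p.
Proof.
move=> p12 j12; case: (lerP `|x| 1) => x1.
  by apply: (@le_trans _ _ 1); [exact: exprn_ile1|rewrite lerDl powR_ge0].
rewrite -powR_mulrn //; apply: ler_wpDl => //; apply: ler_powR; first exact: ltW.
by apply: le_trans (ltW p12); rewrite ler_nat.
Qed.

(** * Rounding to a finite grid *)

Section Grid.
Context {R : realType} (N : nat).
Hypothesis N_gt0 : (0 < N)%N.

(** The indices stand for the multiples of 1 / N in [-N, N]. [minn] clamps from above; [Num.truncn]
    clamps from below, as it sends negative numbers to 0. *)
Definition grid_index (x : R) : 'I_(2 * N * N).+1 :=
  inord (minn (Num.truncn ((x + N%:R) * N%:R)) (2 * N * N)).

Definition grid_val (a : 'I_(2 * N * N).+1) : R := a%:R / N%:R - N%:R.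

Let N0 : 0 < N%:R :> R. Proof. by rewrite ltr0n. Qed.

Lemma measurable_grid_index a : measurable (grid_index @^-1` [set a]).
Proof.
pose f (x : R) : R := (grid_index x)%:R.
have mf : measurable_fun setT f.
  apply: nondecreasing_measurable => // x y xy; rewrite /f ler_nat !inordK ?ltnS ?geq_minr //.
  rewrite leq_min geq_minr andbT; apply: leq_trans (geq_minl _ _) _.
  by apply: le_truncn; rewrite ler_pM2r // lerD2r.
have -> : grid_index @^-1` [set a] = f @^-1` [set (nat_of_ord a)%:R].
  apply/seteqP; split => x /=; first by rewrite /f => ->.
  by rewrite /f => /eqP; rewrite eqr_nat => /eqP /val_inj.
by rewrite -[_ @^-1` _]setTI; apply: mf.
Qed.

Lemma grid_valE x : grid_val (grid_index x) =
  (minn (Num.truncn ((x + N%:R) * N%:R)) (2 * N * N))%:R / N%:R - N%:R.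
Proof. by rewrite /grid_val inordK // ltnS geq_minr. Qed.

Lemma grid_val_near x : `|x| <= N%:R -> `|grid_val (grid_index x) - x| <= N%:R^-1.
Proof.
rewrite grid_valE ler_norml => /andP[x1 x2].
have x0 : 0 <= (x + N%:R) * N%:R by rewrite mulr_ge0 //; lra.
have /andP[t1 t2] := truncn_itv x0.
set t := Num.truncn _ in t1 t2 *.
have -> : minn t (2 * N * N) = t.
  apply/minn_idPl; rewrite -(ler_nat R); apply: le_trans t1 _.
  rewrite !natrM ler_pM2r //; lra.
rewrite -natr1 in t2.
have e1 : (x + N%:R) * N%:R / N%:R = x + N%:R by rewrite mulfK // gt_eqF.
have h1 : t%:R / N%:R <= x + N%:R by rewrite -e1 ler_pM2r ?invr_gt0.
have h2 : x + N%:R <= t%:R / N%:R + N%:R^-1.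
  have -> : t%:R / N%:R + N%:R^-1 = (t%:R + 1) / N%:R :> R by ring.
  by rewrite -e1 ler_pM2r ?invr_gt0 // ltW.
rewrite ler_norml; apply/andP; split; lra.
Qed.

Lemma grid_val_far x : N%:R < `|x| -> `|grid_val (grid_index x)| = N%:R.
Proof.
rewrite grid_valE; case: (lerP 0 x) => x0.
  move=> xN; rewrite (_ : minn _ _ = (2 * N * N)%N).
    rewrite !natrM mulfK ?gt_eqF //.
    by have -> : 2 * N%:R - N%:R = N%:R :> R by [ring]; rewrite ger0_norm.
  apply/minn_idPr; rewrite truncn_ge_nat ?mulr_ge0 ?addr_ge0 //.
  by rewrite !natrM ler_pM2r //; move: xN; rewrite ger0_norm //; lra.
move=> xN; have -> : Num.truncn ((x + N%:R) * N%:R) = 0%N.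
  apply/eqP; rewrite -leqn0 truncn_le_nat; apply: le_lt_trans ltr01.
  by rewrite mulr_le0_ge0 //; move: xN; rewrite ltr0_norm //; lra.
by rewrite min0n mul0r sub0r normrN ger0_norm.
Qed.

Lemma grid_val_le x : `|grid_val (grid_index x)| <= `|x| + 1.
Proof.
case: (lerP `|x| N%:R) => xN; last by rewrite grid_val_far //; lra.
have h := grid_val_near xN; have : N%:R^-1 <= 1 :> R by rewrite invf_le1 // ler1n.
have := ler_normD (grid_val (grid_index x) - x) x; rewrite subrK; lra.
Qed.

(** Outside [-N, N] the error is at most 2 |x| <= 2 x^2 / N, so at the price of a moment clamping
    costs no more than rounding. *)
Lemma grid_val_dist (p x : R) : 12 < p ->
  `|grid_val (grid_index x) - x| <= 5 / N%:R * (1 + `|x| `^ p).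
Proof.
move=> p12; have y0 := powR_ge0 `|x| p; have iN : 0 < N%:R^-1 :> R by rewrite invr_gt0.
case: (lerP `|x| N%:R) => xN.
  by apply: le_trans (grid_val_near xN) _; nra.
apply: (@le_trans _ _ (2 * `|x|)).
  apply: le_trans (ler_normB _ _) _; rewrite grid_val_far //; lra.
have x2 := norm_exp_le_powR x p12 (isT : (2 <= 12)%N).
rewrite mulrAC ler_pdivlMr //; have := normr_ge0 x; rewrite expr2 in x2; nra.
Qed.

(** Inside [-N, N] the difference of squares is factored; outside, it is at most x^2 <= |x|^3 /
    N. *)
Lemma grid_val_sqr_dist (p x : R) : 12 < p ->
  `|grid_val (grid_index x) ^+ 2 - x ^+ 2| <= 5 / N%:R * (1 + `|x| `^ p).
Proof.
move=> p12; have y0 := powR_ge0 `|x| p; have iN : 0 < N%:R^-1 :> R by rewrite invr_gt0.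
have x1 := norm_exp_le_powR x p12 (isT : (1 <= 12)%N).
have x3 := norm_exp_le_powR x p12 (isT : (3 <= 12)%N).
case: (lerP `|x| N%:R) => xN.
  have -> : grid_val (grid_index x) ^+ 2 - x ^+ 2 =
    (grid_val (grid_index x) - x) * (grid_val (grid_index x) + x) by ring.
  rewrite normrM; apply: (@le_trans _ _ (N%:R^-1 * (2 * `|x| + 1))).
    apply: ler_pM => //; first exact: grid_val_near.
    apply: le_trans (ler_normD _ _) _; have := grid_val_le x; lra.
  rewrite mulrAC mulrC ler_pM2r // expr1 in x1 *; lra.
have -> : grid_val (grid_index x) ^+ 2 = N%:R ^+ 2.
  by rewrite -[LHS]real_normK ?num_real // grid_val_far.
have Nx : N%:R ^+ 2 <= `|x| ^+ 2 by rewrite lerXn2r ?nnegrE // ltW.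
rewrite -[x ^+ 2]real_normK ?num_real // [`|_ - _|]ler0_norm ?subr_le0 //.
rewrite mulrAC ler_pdivlMr // opprB.
apply: (@le_trans _ _ (`|x| ^+ 3)); last lra.
apply: (@le_trans _ _ (`|x| ^+ 2 * N%:R)); first by rewrite ler_wpM2r // gerBl sqr_ge0.
by rewrite [leRHS]exprSr ler_wpM2l ?sqr_ge0 // ltW.
Qed.

End Grid.

Section Environment.
Context {R : realType} {d : measure_display} {T : measurableType d} (P : probability T R).
Variables (p M0 : R) (w : nat -> nat -> {RV P >-> R}).
Hypothesis p_gt12 : 12 < p.
Hypothesis M0_gt0 : 0 < M0.
Hypothesis w_mean : forall i j : nat, (1 <= i)%N -> (1 <= j)%N -> ('E_P[w i j] = 0)%E.
Hypothesis w_var : forall i j : nat, (1 <= i)%N -> (1 <= j)%N ->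
  ('E_P[fun omega => (w i j omega ^+ 2)%R] = 1)%E.
Hypothesis w_moment : forall i j : nat, (1 <= i)%N -> (1 <= j)%N ->
  ('E_P[fun omega => (`|w i j omega| `^ p)%R] <= M0%:E)%E.

Let D : pred (nat * nat) := fun k => (1 <= k.1)%N && (1 <= k.2)%N.
Let W (k : nat * nat) : T -> R := w k.1 k.2.

Let mW k : measurable_fun setT (W k).
Proof. exact: measurable_funPT. Qed.

Let measurable_preW k A : measurable A -> measurable (W k @^-1` A).
Proof. by move=> mA; rewrite -[_ @^-1` _]setTI; apply: mW. Qed.

Let measurable_norm_powR (a b : R) : measurable_fun setT (fun x : R => a + b * `|x| `^ p).
Proof.
apply: measurable_funD => //; apply: measurable_funM => //.
apply: (measurableT_comp (measurable_powR p)); exact: normr_measurable.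
Qed.

Lemma integral_bound_le (a b : R) k : D k -> 0 <= a -> 0 <= b ->
  (\int[P]_t (a + b * `|W k t| `^ p)%:E <= (a + b * M0)%:E)%E.
Proof.
move=> /andP[k1 k2] a0 b0.
have mp : measurable_fun setT (fun t => `|W k t| `^ p).
  apply: (measurableT_comp (measurable_powR p)).
  by apply: measurableT_comp; first exact: normr_measurable.
under eq_integral => t _ do rewrite EFinD EFinM.
have mp' : measurable_fun setT (fun t => (`|W k t| `^ p)%:E) by exact/measurable_EFinP.
have h1 t : setT t -> (0 <= b%:E * (`|W k t| `^ p)%:E)%E.
  by move=> _; rewrite lee_fin mulr_ge0 ?powR_ge0.
have h2 : measurable_fun setT (fun t => b%:E * (`|W k t| `^ p)%:E)%E by exact: measurable_funeM.
have h3 t : setT t -> (0 <= (`|W k t| `^ p)%:E)%E by move=> _; rewrite lee_fin powR_ge0.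
rewrite ge0_integralD // ge0_integralZl_EFin //.
have -> : (\int[P]_t (a%:E) = a%:E)%E.
  transitivity (\int[P]_t (cst a%:E t))%E; first by [].
  by rewrite integral_cst //= (@probability_setT _ _ _ P) mule1.
rewrite EFinD leeD2lE // EFinM; apply: lee_wpmul2l; first by rewrite lee_fin.
by have := w_moment k1 k2; rewrite unlock.
Qed.

Section FixedSize.
Variable (N : nat).
Hypothesis N_gt0 : (0 < N)%N.

Definition cell (k : nat * nat) : T -> 'I_(2 * N * N).+1 := @grid_index R N \o W k.

Definition cell_prob (k : nat * nat) (a : 'I_(2 * N * N).+1) : R :=
  fine (P (cell k @^-1` [set a])).

Lemma measurable_cell k a : measurable (cell k @^-1` [set a]).
Proof. exact: measurable_preW (measurable_grid_index N_gt0 a). Qed.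

Lemma cell_prob_ge0 k a : 0 <= cell_prob k a.
Proof. exact: fine_ge0. Qed.

Lemma sum_cell_prob k : \sum_a cell_prob k a = 1.
Proof. exact: sum_discrete_prob (measurable_cell k). Qed.

Lemma avg_cell_approx k (f g : R -> R) (a b e : R) : D k -> 0 <= a -> 0 <= b ->
  measurable_fun setT g ->
  (forall x, `|f (grid_val (grid_index N x)) - g x| <= a + b * `|x| `^ p) ->
  (\int[P]_t (g (W k t))%:E = e%:E)%E ->
  `|avg cell_prob (@grid_val R N) k f - e| <= a + b * M0.
Proof.
move=> Dk a0 b0 mg fg ge.
apply: (discrete_approx (measurable_cell k) (f := f \o @grid_val R N)
  (b := fun x => a + b * `|x| `^ p) (mW k) mg (measurable_norm_powR a b)) ge => //.
- by move=> x; rewrite addr_ge0 // mulr_ge0 // powR_ge0.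
- exact: integral_bound_le.
- by move=> t; apply: fg.
Qed.

Lemma avg_cell_le k (f : R -> R) (a b : R) : D k -> 0 <= a -> 0 <= b ->
  (forall x, 0 <= f x) ->
  (forall x, f (grid_val (grid_index N x)) <= a + b * `|x| `^ p) ->
  avg cell_prob (@grid_val R N) k f <= a + b * M0.
Proof.
move=> Dk a0 b0 f0 fle; have := @avg_cell_approx k f (cst 0) a b 0 Dk a0 b0.
rewrite subr0 => h; apply: le_trans (ler_norm _) _; apply: h => //.
- by move=> x; rewrite subr0 ger0_norm.
- by rewrite integral0.
Qed.

Lemma avg_cell_mean k : D k ->
  `|avg cell_prob (@grid_val R N) k id| <= 5 / N%:R * (1 + M0).
Proof.
move=> Dk; have Dk' := Dk; have /andP[k1 k2] := Dk'.
have c0 : 0 <= 5 / N%:R :> R by rewrite divr_ge0.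
rewrite -[X in `|X|]subr0 mulrDr mulr1; apply: (@avg_cell_approx _ _ id) => //.
- move=> x; have := grid_val_dist N_gt0 x p_gt12; by rewrite mulrDr mulr1.
- by have := w_mean k1 k2; rewrite unlock.
Qed.

Lemma avg_cell_sqr k : D k ->
  `|avg cell_prob (@grid_val R N) k (fun e => e ^+ 2) - 1| <= 5 / N%:R * (1 + M0).
Proof.
move=> Dk; have /andP[k1 k2] := Dk.
have c0 : 0 <= 5 / N%:R :> R by rewrite divr_ge0.
rewrite mulrDr mulr1; apply: (@avg_cell_approx _ _ (fun x => x ^+ 2)) => //.
- move=> x; have := grid_val_sqr_dist N_gt0 x p_gt12; by rewrite mulrDr mulr1.
- by have := w_var k1 k2; rewrite unlock.
Qed.

(** Obtained from (u + v)^6 <= 64 (u^6 + v^6) with u = |x| and v = 3 + M0: a rounded value is at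
    most |x| + 1 in size, and its mean size at most 2 + M0. The leading 1 covers the lower
    powers. *)
Definition cell_moment : R := 1 + 64 * ((3 + M0) ^+ 6 + 1 + M0).

Lemma cell_moment_ge1 : 1 <= cell_moment.
Proof.
have m0 := ltW M0_gt0; have h3 : 0 <= 3 + M0 by lra.
by have := exprn_ge0 6 h3; rewrite /cell_moment; lra.
Qed.

Let avg_norm_bounds k : D k -> 0 <= avg cell_prob (@grid_val R N) k Num.norm <= 2 + M0.
Proof.
move=> Dk; apply/andP; split.
  by apply: sumr_ge0 => a _; rewrite mulr_ge0 // cell_prob_ge0.
rewrite -[M0]mul1r; apply: avg_cell_le => // x.
apply: le_trans (grid_val_le N_gt0 x) _.
by have := norm_exp_le_powR x p_gt12 (isT : (1 <= 12)%N); rewrite expr1 mul1r; lra.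
Qed.

Lemma avg_cell_moment k j : D k -> (j <= 3)%N ->
  avg cell_prob (@grid_val R N) k (fun c =>
    (`|c| + avg cell_prob (@grid_val R N) k Num.norm) ^+ j.*2) <= cell_moment.
Proof.
move=> Dk j3; have /andP[] := avg_norm_bounds Dk; set mu := avg _ _ _ _ => mu0 mu2.
have m0 := ltW M0_gt0.
have -> : cell_moment = (1 + 64 * ((3 + M0) ^+ 6 + 1)) + 64 * M0 by rewrite /cell_moment; ring.
have c0 : 0 <= 1 + 64 * ((3 + M0) ^+ 6 + 1).
  by rewrite addr_ge0 // mulr_ge0 // addr_ge0 // exprn_ge0 // addr_ge0.
apply: avg_cell_le => //.
  by move=> x; rewrite exprn_ge0 // addr_ge0.
move=> x; set y := `|_| + mu.
have y0 : 0 <= y by rewrite addr_ge0.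
have yx : y <= `|x| + (3 + M0) by have := grid_val_le N_gt0 x; rewrite /y; lra.
apply: (@le_trans _ _ (1 + y ^+ 6)).
  case: (lerP y 1) => y1.
    by apply: le_trans (exprn_ile1 _ y0 y1) _; rewrite lerDl exprn_ge0.
  apply: ler_wpDl => //; apply: ler_weXn2l; rewrite ?ltW //; lia.
have x6 := norm_exp_le_powR x p_gt12 (isT : (6 <= 12)%N).
have s0 : 0 <= 3 + M0 by lra.
have : y ^+ 6 <= 64 * ((3 + M0) ^+ 6 + `|x| ^+ 6); last lra.
case: (lerP `|x| (3 + M0)) => xs.
  apply: (@le_trans _ _ ((2 * (3 + M0)) ^+ 6)).
    by apply: lerXn2r; rewrite ?nnegrE ?mulr_ge0 //; lra.
  have -> : (2 * (3 + M0)) ^+ 6 = 64 * (3 + M0) ^+ 6 by ring.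
  by rewrite ler_pM2l // lerDl exprn_ge0.
apply: (@le_trans _ _ ((2 * `|x|) ^+ 6)).
  by apply: lerXn2r; rewrite ?nnegrE ?mulr_ge0 //; lra.
have -> : (2 * `|x|) ^+ 6 = 64 * `|x| ^+ 6 by ring.
by rewrite ler_pM2l // lerDr exprn_ge0.
Qed.

Lemma avg_cell_cube k : D k ->
  avg cell_prob (@grid_val R N) k (fun e => `|e| ^+ 3) <= 1 + cell_moment.
Proof.
move=> Dk; have /andP[] := avg_norm_bounds Dk; set mu := avg _ _ _ _ => mu0 _.
pose q0 k' a (_ : D k') := cell_prob_ge0 k' a.
pose q1 k' (_ : D k') := sum_cell_prob k'.
apply: (@le_trans _ _ (avg cell_prob (@grid_val R N) k (fun c => 1 + (`|c| + mu) ^+ 6))).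
  apply: (avg_le _ q0) => // c.
  apply: (@le_trans _ _ (1 + `|c| ^+ 6)).
    have := sqr_ge0 (`|c| ^+ 3 - 1); rewrite sqrrB1 -exprM => h.
    have : 0 <= `|c| ^+ 3 by rewrite exprn_ge0.
    move: h; rewrite /=; lra.
  by rewrite lerD2l lerXn2r ?nnegrE ?addr_ge0 // lerDl.
rewrite avgD (avg_cst _ q1) // lerD2l; exact: (@avg_cell_moment k 3).
Qed.

End FixedSize.
End Environment.

(** * Joint law of the rounded weights *)

Section ProductLaw.
Context {R : realType} {d : measure_display} {T : measurableType d} (P : probability T R).
Variables (w : nat -> nat -> {RV P >-> R}).
Hypothesis w_indep : mutually_independent
  [set k : nat * nat | (1 <= k.1)%N /\ (1 <= k.2)%N] (fun k => w k.1 k.2).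
Variable (N : nat).
Hypothesis N_gt0 : (0 < N)%N.

Let D : pred (nat * nat) := fun k => (1 <= k.1)%N && (1 <= k.2)%N.
Let W (k : nat * nat) : T -> R := w k.1 k.2.

Definition splice (x : nat * nat -> R) (s : seq (nat * nat)) (y : nat * nat -> R) : nat * nat -> R :=
  fun l => if l \in s then y l else x l.

Definition cell_env (t : T) : nat * nat -> R := fun k => grid_val (cell w N k t).

Let cylinder (s : seq (nat * nat)) (A : nat * nat -> set R) : set T :=
  \bigcap_(k in [set` s]) (W k @^-1` A k).

Let measurable_cylinder s A : (forall k, measurable (A k)) -> measurable (cylinder s A).
Proof.
move=> mA; rewrite /cylinder bigcap_seq; apply: bigsetI_measurable => k _.
by rewrite -[_ @^-1` _]setTI; apply: measurable_funPT => //.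
Qed.

Let prob_cylinder s A : uniq s -> all D s -> (forall k, measurable (A k)) ->
  P (cylinder s A) = (\prod_(k <- s) P (W k @^-1` A k))%E.
Proof.
move=> us Ds mA; apply: w_indep => // k /= ks.
by have /andP[] := allP Ds k ks.
Qed.

Lemma splice_cons x k s y : k \notin s -> splice x (k :: s) y = splice (upd x k (y k)) s y.
Proof.
move=> ks; apply/funext => l; rewrite /splice inE /upd.
by case: (l =P k) => [->|]; [rewrite (negbTE ks)|].
Qed.

(** Induction on the coordinates still to be revealed, the cylinder recording those already fixed:
    the event is split over the finitely many cells of k, and k joins the cylinder. Independence
    enters through the product formula for cylinders; measurability for an arbitrary Q comes from
    the finite union. *)
Let prob_splice_cylinder s : forall s0 A x (Q : (nat * nat -> R) -> bool),
  uniq (s0 ++ s) -> all D (s0 ++ s) -> (forall k, measurable (A k)) ->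
  measurable (cylinder s0 A `&` [set t | Q (splice x s (cell_env t))]) /\
  (P (cylinder s0 A `&` [set t | Q (splice x s (cell_env t))]) =
   P (cylinder s0 A) *
     (expect (cell_prob w (N := N)) (@grid_val R N) s (fun z => (Q z)%:R) x)%:E)%E.
Proof.
elim: s => [|k s IH] s0 A x Q us Ds mA.
  have -> : cylinder s0 A `&` [set t | Q (splice x [::] (cell_env t))] =
      if Q x then cylinder s0 A else set0.
    by case: ifP => Qx; apply/seteqP; split=> t /=; rewrite ?Qx //= => -[].
  rewrite /=; case: ifP => Qx; split; rewrite ?mule1 ?mule0 //.
  exact: measurable_cylinder.
have us' : uniq ((k :: s0) ++ s).
  by rewrite -(perm_uniq (permEl (perm_catCA s0 [:: k] s))).
have Ds' : all D ((k :: s0) ++ s).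
  by rewrite -(perm_all _ (permEl (perm_catCA s0 [:: k] s))).
have /andP[ks0 us0] : uniq (k :: s0) by move: us'; rewrite cat_uniq => /andP[].
have /andP[Dk Ds0] : all D (k :: s0) by move: Ds'; rewrite all_cat => /andP[].
have ks : k \notin s by move: us'; rewrite /= mem_cat negb_or => /andP[/andP[]].
pose A' a l := if l == k then @grid_index R N @^-1` [set a] else A l.
have mA' a l : measurable (A' a l).
  by rewrite /A'; case: ifP => // _; exact: measurable_grid_index.
have cylE a : cylinder (k :: s0) (A' a) = cylinder s0 A `&` (cell w N k @^-1` [set a]).
  apply/seteqP; split=> t.
    move=> ct; split=> [l /= ls|].
      have := ct l; rewrite /= inE ls orbT => /(_ isT); rewrite /A'.
      by case: eqP ls => [->|//]; rewrite (negbTE ks0).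
    by have := ct k; rewrite /= inE eqxx => /(_ isT); rewrite /A' eqxx.
  move=> [c0 ck] l /=; rewrite inE /A' => /orP[/eqP ->|ls]; first by rewrite eqxx.
  by case: eqP => [->|_]; [|exact: c0].
have cylP a : P (cylinder (k :: s0) (A' a)) = (P (cylinder s0 A) * (cell_prob w k a)%:E)%E.
  rewrite !prob_cylinder //; last by rewrite /= Dk.
    rewrite big_cons muleC {2}/A' eqxx /cell_prob fineK ?fin_num_measure //; last first.
      exact: measurable_cell.
    congr (_ * _)%E; apply: eq_big_seq => l ls; rewrite /A'.
    by case: eqP ls => [->|//]; rewrite (negbTE ks0).
  by rewrite /= ks0.
pose E a := cylinder (k :: s0) (A' a) `&` [set t | Q (splice (upd x k (grid_val a)) s (cell_env t))].
have EE : cylinder s0 A `&` [set t | Q (splice x (k :: s) (cell_env t))] =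
    \big[setU/set0]_(a < (2 * N * N).+1) E a.
  rewrite -bigcup_seq; apply/seteqP; split=> t.
    move=> [ct /= Qt]; exists (cell w N k t); first by rewrite /= mem_index_enum.
    by split; [rewrite cylE|rewrite /= -splice_cons].
  move=> [a _ []]; rewrite cylE => -[ct /= <-] Qt; split=> //=.
  by rewrite splice_cons.
have mE a : measurable (E a) by have [] := IH (k :: s0) (A' a) (upd x k (grid_val a)) Q us' Ds' (mA' a).
rewrite EE; split; first exact: bigsetU_measurable.
rewrite measure_bigsetU_ord //; last first.
  apply/trivIsetP => a b _ _ ab; rewrite -subset0 => t [[+ _] [+ _]].
  by rewrite !cylE => -[_ /= e1] [_ /= e2]; rewrite -e1 -e2 eqxx in ab.
have cE : P (cylinder s0 A) = (fine (P (cylinder s0 A)))%:E.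
  by rewrite fineK // fin_num_measure //; exact: measurable_cylinder.
rewrite cE -EFinM mulr_sumr -sumEFin; apply: eq_bigr => a _.
have [_ EP] := IH (k :: s0) (A' a) (upd x k (grid_val a)) Q us' Ds' (mA' a).
by apply: etrans EP _; rewrite cylP cE -!EFinM mulrA.
Qed.

Lemma expect_prob s (Q : (nat * nat -> R) -> bool) x : uniq s -> all D s ->
  measurable [set t | Q (splice x s (cell_env t))] /\
  P [set t | Q (splice x s (cell_env t))] =
   (expect (cell_prob w (N := N)) (@grid_val R N) s (fun z => (Q z)%:R) x)%:E.
Proof.
move=> us Ds; have := @prob_splice_cylinder s [::] (fun=> setT) x Q us Ds (fun=> measurableT).
have -> : cylinder [::] (fun=> setT) = setT by apply/seteqP; split => // t _ l.
by rewrite setTI probability_setT mul1e.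
Qed.

End ProductLaw.

(** * Concentration and the quenched limit *)

(** Telescoping of (k + 1)^(-3/2) <= 2 (1 / sqrt k - 1 / sqrt(k + 1)). *)
Lemma sum_inv_pow32_le {R : realType} (n : nat) :
  \sum_(i < n) (i.+2%:R * Num.sqrt i.+2%:R)^-1 <= 2 * (1 - (Num.sqrt n.+1%:R)^-1) :> R.
Proof.
elim: n => [|n IH]; first by rewrite big_ord0 sqrtr1 invr1 subrr mulr0.
rewrite big_ord_recr /=; apply: le_trans (lerD IH (lexx _)) _.
set a := Num.sqrt n.+1%:R; set b := Num.sqrt n.+2%:R.
have a0 : 0 < a by rewrite sqrtr_gt0.
have b0 : 0 < b by rewrite sqrtr_gt0.
have aE : a ^+ 2 = n.+1%:R by rewrite sqr_sqrtr.
have bE : b ^+ 2 = n.+1%:R + 1 by rewrite sqr_sqrtr // natr1.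
have ab : a <= b by rewrite ler_wsqrtr // ler_nat.
have -> : n.+2%:R = b ^+ 2 by rewrite sqr_sqrtr.
rewrite -subr_ge0.
have -> : 2 * (1 - b^-1) - (2 * (1 - a^-1) + (b ^+ 2 * b)^-1) =
    (2 * b ^+ 2 * (b - a) - a) / (a * b ^+ 3) by field; rewrite !gt_eqF.
apply: divr_ge0; last by rewrite mulr_ge0 ?exprn_ge0 // ltW.
have e1 : (b - a) * (b + a) = 1 by rewrite -subr_sqr bE aE; ring.
have s0 : 0 < b + a by rewrite addr_gt0.
rewrite -(pmulr_lge0 _ s0) mulrBl.
have -> : 2 * b ^+ 2 * (b - a) * (b + a) = 2 * b ^+ 2 by rewrite -mulrA e1 mulr1.
have := mulr_ge0 (ltW b0) (ltW a0); nra.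
Qed.

Lemma borel_cantelli_ae {R : realType} {d : measure_display} {T : measurableType d}
    (P : probability T R) (F : nat -> set T) (C : R) (n0 : nat) : 0 <= C ->
  (forall n, measurable (F n)) ->
  (forall n, (n0 <= n)%N -> (P (F n) <= (C / (n.+2%:R * Num.sqrt n.+2%:R))%:E)%E) ->
  {ae P, forall t, exists m, forall n, (m <= n)%N -> ~ F n t}.
Proof.
(* The bound holds from n0 on, so the earlier events are emptied; this does not affect the
   limsup. *)
move=> C0 mF PF; pose G n := if (n0 <= n)%N then F n else set0.
have mG n : measurable (G n) by rewrite /G; case: ifP.
have PG n : (P (G n) <= (C / (n.+2%:R * Num.sqrt n.+2%:R))%:E)%E.
  rewrite /G; case: ifP => [|_]; first exact: PF.
  by rewrite measure0 lee_fin divr_ge0 // mulr_ge0 // sqrtr_ge0.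
have sumG : (\sum_(n <oo) P (G n) < +oo)%E.
  apply: (@le_lt_trans _ _ ((2 * C)%:E)); last exact: ltry.
  apply: lime_le; first by apply: is_cvg_nneseries.
  apply: nearW => n; rewrite big_mkord.
  apply: (@le_trans _ _ (\sum_(i < n) (C / (i.+2%:R * Num.sqrt i.+2%:R))%:E)%E).
    by apply: lee_sum => i _.
  rewrite sumEFin lee_fin -mulr_sumr mulrC ler_wpM2r //.
  apply: le_trans (sum_inv_pow32_le _) _.
  have : 0 <= (Num.sqrt n.+1%:R)^-1 :> R by rewrite invr_ge0 sqrtr_ge0.
  lra.
exists (lim_sup_set G); split.
- by apply: bigcap_measurable => // k _; apply: bigcup_measurable.
- exact: lim_sup_set_cvg0.
- move=> t /= nt k _; apply: contrapT => nk; apply: nt; exists (maxn k n0) => n.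
  rewrite geq_max => /andP[kn nn0] Fn; apply: nk; exists n => //.
  by rewrite /G nn0.
Qed.

Section Concentration.
Context {R : realType} {d : measure_display} {T : measurableType d} (P : probability T R).
Variables (beta p M0 : R) (w : nat -> nat -> {RV P >-> R}).
Hypothesis beta01 : 0 < beta < 1.
Hypothesis p_gt12 : 12 < p.
Hypothesis M0_gt0 : 0 < M0.
Hypothesis w_indep : mutually_independent
  [set k : nat * nat | (1 <= k.1)%N /\ (1 <= k.2)%N] (fun k => w k.1 k.2).
Hypothesis w_moment : forall i j : nat, (1 <= i)%N -> (1 <= j)%N ->
  ('E_P[fun omega => (`|w i j omega| `^ p)%R] <= M0%:E)%E.

Let D : pred (nat * nat) := fun k => (1 <= k.1)%N && (1 <= k.2)%N.
Let W (k : nat * nat) : T -> R := w k.1 k.2.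

Let D_box N : all D (box N).
Proof. by apply/allP => k; rewrite mem_box /D => /andP[/andP[-> _] /andP[-> _]]. Qed.

Definition rounded_env (N : nat) (t : T) : nat * nat -> R :=
  splice (fun=> 0) (box N) (cell_env w N t).

(** Outside this event each rounded weight of the box is within 1 / N of the true one. *)
Definition large_weight (N : nat) : set T :=
  [set t | has (fun k => N%:R < `|w k.1 k.2 t|) (box N)].

Let measurable_large k (r : R) : measurable [set t | r < `|W k t|].
Proof.
have mn : measurable_fun setT (fun t => `|W k t|).
  apply: measurableT_comp; first exact: normr_measurable.
  exact: measurable_funPT.
have -> : [set t | r < `|W k t|] = (fun t => `|W k t|) @^-1` `]r, +oo[%classic.
  by apply/seteqP; split=> t /=; rewrite in_itv /= andbT.
by rewrite -[_ @^-1` _]setTI; apply: mn.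
Qed.

Let large_weightE N : large_weight N =
  \bigcup_(k in [set` box N]) [set t | N%:R < `|W k t|].
Proof.
apply/seteqP; split=> t /=; first by move=> /hasP[k kb h]; exists k.
by move=> [k /= kb h]; apply/hasP; exists k.
Qed.

Lemma measurable_large_weight N : measurable (large_weight N).
Proof.
by rewrite large_weightE bigcup_seq; apply: bigsetU_measurable => k _; exact: measurable_large.
Qed.

Let prob_large k (N : nat) : D k -> (0 < N)%N ->
  (P [set t | (N%:R < `|W k t|)%R] <= ((1 + M0) / N%:R ^+ 6)%:E)%E.
Proof.
move=> Dk N0; have n0 : 0 < N%:R ^+ 6 :> R by rewrite exprn_gt0 // ltr0n.
have c0 : 0 <= (N%:R ^+ 6)^-1 :> R by rewrite invr_ge0 ltW.
have := integral_bound_le w_moment Dk c0 c0.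
have -> : (N%:R ^+ 6)^-1 + (N%:R ^+ 6)^-1 * M0 = (1 + M0) / N%:R ^+ 6 by ring.
apply: le_trans.
have mS := measurable_large k N%:R.
have -> : (P [set t | (N%:R < `|W k t|)%R] =
    \int[P]_t (\1_[set t | (N%:R < `|W k t|)%R] t)%:E)%E by rewrite integral_indic // setIT.
apply: ge0_le_integral => //.
- by apply/measurable_EFinP; apply: measurable_indic; exact: measurable_large.
- apply/measurable_EFinP; apply: measurable_funD => //; apply: measurable_funM => //.
  apply: (measurableT_comp (measurable_powR p)).
  apply: measurableT_comp; first exact: normr_measurable.
  exact: measurable_funPT.
- move=> t _; rewrite lee_fin indicE; case: (boolP (_ \in _)) => [|_]; last first.
    by rewrite addr_ge0 // mulr_ge0 // powR_ge0.
  rewrite inE /= => h.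
  have -> : (N%:R ^+ 6)^-1 + (N%:R ^+ 6)^-1 * `|W k t| `^ p = (1 + `|W k t| `^ p) / N%:R ^+ 6 by ring.
  rewrite ler_pdivlMr // mul1r.
  apply: le_trans (norm_exp_le_powR _ p_gt12 (isT : (6 <= 12)%N)).
  by rewrite lerXn2r ?nnegrE // ltW.
Qed.

(** A union bound over N^2 sites against N^(-6) gives N^(-4), weakened to N^(-3/2) so that one
    Borel-Cantelli series also covers [deviation]. *)
Lemma prob_large_weight (N : nat) : (0 < N)%N ->
  (P (large_weight N) <= ((1 + M0) / (N%:R * Num.sqrt N%:R))%:E)%E.
Proof.
move=> N0; have n0 : 1 <= N%:R :> R by rewrite ler1n.
apply: (@le_trans _ _ (\sum_(k <- box N) ((1 + M0) / N%:R ^+ 6)%:E)%E).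
  have : forall s, all D s ->
    (P (\bigcup_(k in [set` s]) [set t | (N%:R < `|W k t|)%R]) <=
     \sum_(k <- s) ((1 + M0) / N%:R ^+ 6)%:E)%E.
    elim=> [|k s IH] /=.
      by move=> _; rewrite big_nil bigcup_seq big_nil measure0.
    move=> /andP[Dk Ds]; rewrite bigcup_seq !big_cons -bigcup_seq.
    apply: le_trans (leeD (prob_large Dk N0) (IH Ds)).
    apply: measureU2; first exact: measurable_large.
    by rewrite bigcup_seq; apply: bigsetU_measurable => l _; exact: measurable_large.
  by rewrite large_weightE; apply.
rewrite sumEFin lee_fin big_const_seq count_predT size_allpairs size_iota iter_addr_0.
rewrite -[_ *+ (_ * _)]mulr_natr natrM.
have n1 : 0 < N%:R :> R by lra.
have -> : (1 + M0) / N%:R ^+ 6 * (N%:R * N%:R) = (1 + M0) / N%:R ^+ 4.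
  by field; rewrite gt_eqF.
have m1 : 0 <= 1 + M0 by have := M0_gt0; lra.
rewrite ler_wpM2l // lef_pV2 ?posrE ?mulr_gt0 ?sqrtr_gt0 ?exprn_gt0 //.
have s1 : 1 <= Num.sqrt N%:R :> R by rewrite -[leLHS]sqrtr1 ler_wsqrtr.
have sN : Num.sqrt N%:R <= N%:R :> R.
  by rewrite -[leRHS](@sqr_sqrtr _ N%:R) // expr2 ler_peMl // ltW // sqrtr_gt0.
apply: (@le_trans _ _ (N%:R ^+ 2)); first by rewrite expr2 ler_wpM2l // ltW.
by apply: ler_weXn2l.
Qed.

Definition test_fun (c eps y : R) : R := Phi ((c - y) / eps).

Lemma test_fun_lip c eps : 0 < eps -> forall y z,
  `|test_fun c eps y - test_fun c eps z| <= eps^-1 * `|y - z|.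
Proof.
move=> e0 y z; apply: le_trans (Phi_lip _ _) _.
have -> : (c - y) / eps - (c - z) / eps = - (y - z) * eps^-1 by ring.
by rewrite normrM normrN mulrC [X in X * _]gtr0_norm ?invr_gt0.
Qed.

Definition annealed (c eps : R) (N : nat) : R :=
  expect (cell_prob w (N := N)) (@grid_val R N) (box N) (quenched_mean beta N (test_fun c eps)) (fun=> 0).

Definition deviation (c eps eta : R) (N : nat) : set T :=
  [set t | eta <= `|quenched_mean beta N (test_fun c eps) (rounded_env N t) - annealed c eps N|].

Lemma prob_deviation (c eps eta : R) : 0 < eps -> 0 < eta ->
  exists C : R, exists n0 : nat, 0 <= C /\ forall m, (n0 <= m)%N ->
   (P (deviation c eps eta m.+2) <= (C / (m.+2%:R * Num.sqrt m.+2%:R))%:E)%E.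
Proof.
move=> e0 eta0; have [C [n0 [C0 hC]]] := collisions beta01.
have M1 := cell_moment_ge1 M0_gt0; set M := cell_moment M0 in M1.
exists (34 * M ^+ 3 * (C / eps ^+ 2) ^+ 3 / eta ^+ 6), n0; split.
  have k0 : 0 <= (C / eps ^+ 2) ^+ 3 by rewrite exprn_ge0 // divr_ge0 // exprn_ge0 // ltW.
  have k1 : 0 <= M ^+ 3 by rewrite exprn_ge0; lra.
  have k2 : 0 <= eta ^+ 6 by rewrite exprn_ge0 // ltW.
  by rewrite divr_ge0 // mulr_ge0 // mulr_ge0.
move=> m mn0; have [_ col] := hC m mn0.
have N0 : (0 < m.+2)%N by [].
pose Q (z : nat * nat -> R) := eta <= `|quenched_mean beta m.+2 (test_fun c eps) z - annealed c eps m.+2|.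
have [_ ->] := @expect_prob _ _ _ P w w_indep m.+2 N0 (box m.+2) Q (fun=> 0) (box_uniq _) (D_box _).
rewrite lee_fin.
have q0 k a (_ : D k) := cell_prob_ge0 w k (N := m.+2) a.
have q1 k (_ : D k) := sum_cell_prob w N0 k.
have ie0 : 0 <= eps^-1 by rewrite invr_ge0 ltW.
have conc := quenched_concentration beta m q0 q1 ie0 M1 eta0 (test_fun_lip c e0)
   (fun k j => @avg_cell_moment _ _ _ _ _ _ _ p_gt12 M0_gt0 w_moment m.+2 N0 k j).
apply: le_trans conc _.
set n := m.+2%:R in col *.
have n1 : 1 <= n :> R by rewrite ler1n.
have s0 : 0 < Num.sqrt n by rewrite sqrtr_gt0; lra.
have nE : n = Num.sqrt n ^+ 2 by rewrite sqr_sqrtr; lra.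
move: (Num.sqrt n) s0 nE col => r s0 nE col.
set h := (Num.sqrt _)^-1.
have h2 : h ^+ 2 <= n^-1.
  rewrite exprVn sqr_sqrtr; last lra.
  by rewrite lef_pV2 ?posrE; lra.
have -> : 34 * M ^+ 3 * (C / eps ^+ 2) ^+ 3 / eta ^+ 6 / (n * r) =
   34 * M ^+ 3 * (C / eps ^+ 2 / r) ^+ 3 / eta ^+ 6.
  by rewrite nE; field; rewrite !gt_eqF.
have M3 : 0 <= M ^+ 3 by rewrite exprn_ge0; lra.
apply: ler_wpM2r; first by rewrite invr_ge0 exprn_ge0 // ltW.
apply: ler_wpM2l; first by rewrite mulr_ge0.
have S0 : 0 <= \sum_(k <- box m.+2) pass_prob beta m.+2 k ^+ 2.
  by apply: sumr_ge0 => k _; rewrite sqr_ge0.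
have e2 : 0 <= (eps ^+ 2)^-1 by rewrite invr_ge0 exprn_ge0 // ltW.
apply: lerXn2r; rewrite ?nnegrE.
- by rewrite mulr_ge0 // sqr_ge0.
- by rewrite mulr_ge0 ?invr_ge0 ?(ltW s0) // mulr_ge0.
apply: (@le_trans _ _ ((eps ^+ 2)^-1 * n^-1 * (C * r))).
  rewrite exprMn exprVn; apply: ler_pM => //.
    by rewrite mulr_ge0 // sqr_ge0.
  by rewrite ler_wpM2l.
rewrite le_eqVlt; apply/orP; left; apply/eqP.
by rewrite nE; field; rewrite !gt_eqF.
Qed.

Lemma measurable_deviation (c eps eta : R) m : measurable (deviation c eps eta m.+2).
Proof.
pose Q (z : nat * nat -> R) := eta <= `|quenched_mean beta m.+2 (test_fun c eps) z - annealed c eps m.+2|.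
by have [] := @expect_prob _ _ _ P w w_indep m.+2 isT (box m.+2) Q (fun=> 0) (box_uniq _) (D_box _).
Qed.

Lemma eventually_good (c eps eta : R) : 0 < eps -> 0 < eta ->
  {ae P, forall t, exists m, forall n, (m <= n)%N ->
     ~ (large_weight n.+2 `|` deviation c eps eta n.+2) t}.
Proof.
move=> e0 eta0; have [C [n0 [C0 hC]]] := prob_deviation c e0 eta0.
apply: (@borel_cantelli_ae _ _ _ _ _ (1 + M0 + C) n0).
- by have := M0_gt0; lra.
- by move=> n; apply: measurableU; [exact: measurable_large_weight|exact: measurable_deviation].
- move=> n nn0; apply: le_trans (measureU2 _ (measurable_large_weight _) (measurable_deviation _ _ _ _)) _.
  rewrite mulrDl EFinD; apply: leeD; last exact: hC.
  exact: prob_large_weight.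
Qed.

End Concentration.

(** * From smooth test functions to distribution functions *)

Lemma inv_sqrt_eventually_le {R : realType} (C delta : R) : 0 <= C -> 0 < delta ->
  exists n0, forall m, (n0 <= m)%N -> C / Num.sqrt m.+2%:R <= delta.
Proof.
move=> C0 d0; exists (Num.truncn ((C / delta) ^+ 2)) => m mn.
have s0 : 0 < Num.sqrt m.+2%:R :> R by rewrite sqrtr_gt0.
rewrite ler_pdivrMr // mulrC -ler_pdivrMr //.
have c0 : 0 <= C / delta by rewrite divr_ge0 // ltW.
rewrite -[leLHS](ger0_norm c0) -sqrtr_sqr ler_wsqrtr //.
apply: le_trans (ltW (truncnS_gt _)) _; rewrite ler_nat; exact: leqW.
Qed.

Lemma inv_succ_le {R : realType} (r : R) : 0 < r -> exists j : nat, j.+1%:R^-1 <= r.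
Proof.
move=> r0; exists (Num.truncn r^-1); rewrite -[leRHS]invrK lef_pV2 ?posrE ?invr_gt0 //.
exact: ltW (truncnS_gt _).
Qed.

Lemma natr_double_pred {R : realType} m : ((m.+2).*2.-1)%:R = 2 * m.+2%:R - 1 :> R.
Proof.
have /(congr1 (fun k => k%:R : R)) : ((m.+2).*2.-1 + 1 = 2 * m.+2)%N by lia.
by rewrite natrD natrM => <-; ring.
Qed.

Lemma normalizer_bounds {R : realType} m (s := (Num.sqrt m.+2%:R)^-1 : R)
    (h := (Num.sqrt (2 * m.+2%:R - 1))^-1 : R) (n := ((m.+2).*2.-1)%:R : R) :
  [/\ n * h ^+ 2 = 1, 0 <= h, h <= s, n * h <= 2 / s & s ^+ 2 = m.+2%:R^-1].
Proof.
have nE : n = 2 * m.+2%:R - 1 := natr_double_pred m.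
have N1 : 1 <= m.+2%:R :> R by rewrite ler1n.
have n0 : 0 < n by rewrite nE; lra.
have h0 : 0 < h by rewrite invr_gt0 sqrtr_gt0 -nE.
have s0 : 0 < s by rewrite invr_gt0 sqrtr_gt0; lra.
have hn : n * h ^+ 2 = 1 by rewrite /h -nE exprVn sqr_sqrtr ?ltW // mulfV // gt_eqF.
have sE : s ^+ 2 = m.+2%:R^-1 by rewrite exprVn sqr_sqrtr.
split=> //; first exact: ltW.
  by rewrite lef_pV2 ?posrE ?sqrtr_gt0 -?nE // ler_wsqrtr // nE; lra.
have -> : n * h = h^-1.
  by apply: (mulIf (lt0r_neq0 h0)); rewrite mulVf ?gt_eqF // -mulrA -expr2 hn.
have r4 : 2 = Num.sqrt 4 :> R.
  by rewrite (_ : 4 = 2 ^+ 2) ?sqrtr_sqr ?ger0_norm //; ring.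
rewrite /h /s !invrK [X in _ <= X * _]r4 -sqrtrM //.
by rewrite ler_wsqrtr //; lra.
Qed.

Section Convergence.
Context {R : realType}.
Variables (beta : R).

(** Moving each of the 2N - 1 weights of a path by r moves the normalised sum by at most 2 sqrt N r,
    so a rounding error r = 1 / N disappears in the limit. *)
Lemma quenched_mean_close m (g : R -> R) (L r : R) (x y : nat * nat -> R) :
  0 <= L -> 0 <= r -> (0 < #|frame_paths beta m.+2|)%N ->
  (forall a b, `|g a - g b| <= L * `|a - b|) ->
  (forall k, k \in box m.+2 -> `|x k - y k| <= r) ->
  `|quenched_mean beta m.+2 g x - quenched_mean beta m.+2 g y| <=
    L * (2 * Num.sqrt m.+2%:R * r).
Proof.
move=> L0 r0 A0 gL xy; rewrite /quenched_mean; set h := (Num.sqrt _)^-1.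
have A0' : 0 < #|frame_paths beta m.+2|%:R :> R by rewrite ltr0n.
have [_ h0 _ nh _] := @normalizer_bounds R m; rewrite invrK -/h in nh h0.
rewrite -mulrBl normrM [X in _ * X]ger0_norm ?invr_ge0 // ler_pdivrMr // mulr_natr -sumr_const -sumrB.
apply: le_trans (ler_norm_sum _ _ _) _; apply: ler_sum => s sA.
apply: le_trans (gL _ _) _; rewrite ler_wpM2l // -mulrBr normrM (ger0_norm h0) -sumrB.
apply: (@le_trans _ _ (h * \sum_(k <- points s) r)).
  rewrite ler_wpM2l //; apply: le_trans (ler_norm_sum _ _ _) _.
  rewrite big_seq [leRHS]big_seq; apply: ler_sum => k ks; apply: xy.
  exact: frame_path_box sA _ ks.
rewrite big_const_seq count_predT size_frame_path iter_addr_0 -[r *+ _]mulr_natr.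
by rewrite mulrCA mulrC [h * _]mulrC ler_wpM2r.
Qed.

Lemma quenched_lawE (w : nat -> nat -> R) N (z : R) :
  quenched_law beta w N `]-oo, z] =
  (quenched_mean beta N (fun y => (y <= z)%R%:R) (fun k => w k.1 k.2))%:E.
Proof.
rewrite /quenched_law /uniform_law /quenched_mean; congr (_ / _)%:E.
rewrite -natr_sum -sum1_card; congr _%:R; rewrite big_mkcond /= [RHS]big_mkcond /=.
apply: eq_bigr => s _; rewrite [s \in _]finset.in_set.
case: (s \in frame_paths beta N) => //=.
have -> : (s \in normalized_energy w (N := N) @^-1` `]-oo, z]) = (normalized_energy w s <= z).
  by apply/idP/idP; rewrite inE /= in_itv.
by rewrite /normalized_energy; case: (_ <= z).
Qed.

Lemma quenched_mean_le N (f g : R -> R) (delta : R) (x : nat * nat -> R) :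
  (0 < #|frame_paths beta N|)%N -> (forall y, f y <= g y + delta) ->
  quenched_mean beta N f x <= quenched_mean beta N g x + delta.
Proof.
move=> A0 fg; have A0' : 0 < #|frame_paths beta N|%:R :> R by rewrite ltr0n.
rewrite /quenched_mean ler_pdivrMr // [leRHS]mulrDl divfK ?gt_eqF //.
rewrite [delta * _]mulr_natr -sumr_const -big_split /=; apply: ler_sum => s _; exact: fg.
Qed.

(** Undoes the smoothing: 1 / sqrt(1 + eps^2) lies between 1 - eps and 1, and [Phi] is
    1-Lipschitz. *)
Lemma Phi_std_near (c z eps delta : R) : `|c - z| <= delta -> 0 < eps <= 1 -> `|c| * eps <= delta ->
  `|Phi (c / Num.sqrt (eps ^+ 2 + 1)) - Phi z| <= 2 * delta.
Proof.
move=> cz /andP[e0 e1] ce; apply: le_trans (Phi_lip _ _) _.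
set q := (Num.sqrt _)^-1.
have q1 : q <= 1.
  rewrite invf_le1 ?sqrtr_gt0 ?ltr_wpDl ?sqr_ge0 //.
  by rewrite -[leLHS]sqrtr1 ler_wsqrtr // lerDr sqr_ge0.
have q2 : 1 - eps <= q.
  have s0 : 0 < Num.sqrt (eps ^+ 2 + 1) by rewrite sqrtr_gt0 ltr_wpDl ?sqr_ge0.
  rewrite -[leRHS]mul1r ler_pdivlMr //.
  have s1 : Num.sqrt (eps ^+ 2 + 1) <= 1 + eps.
    have p0 : 0 <= 1 + eps by lra.
    rewrite -[leRHS](ger0_norm p0) -sqrtr_sqr ler_wsqrtr //.
    have := ltW e0; nra.
  have := ler_wpM2l (_ : 0 <= 1 - eps) s1; rewrite subr_ge0 => /(_ e1); nra.
have -> : c * q - z = (c - z) - c * (1 - q) by ring.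
apply: le_trans (ler_normB _ _) _; rewrite normrM [`|1 - q|]ger0_norm ?subr_ge0 //.
have : `|c| * (1 - q) <= `|c| * eps by rewrite ler_wpM2l //; lra.
lra.
Qed.

(** Up to delta, the indicator of y <= z lies between test functions centred at rationals c2 < z <
    c1, both within delta of z and so narrow that at y = z they are already delta-close to their
    limits 0 and 1. *)
Lemma quenched_mean_sandwich (x : nat * nat -> R) (z : R) :
  (exists n0, forall m, (n0 <= m)%N -> (0 < #|frame_paths beta m.+2|)%N) ->
  (forall (c : rat) (j : nat) (delta : R), 0 < delta -> exists n0, forall m, (n0 <= m)%N ->
    `|quenched_mean beta m.+2 (test_fun (ratr c) j.+1%:R^-1) x -
      Phi (ratr c / Num.sqrt (j.+1%:R^-1 ^+ 2 + 1))| <= delta) ->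
  forall e, 0 < e -> exists n0, forall m, (n0 <= m)%N ->
   `|Phi z - quenched_mean beta m.+2 (fun y => (y <= z)%R%:R) x| <= e.
Proof.
move=> [n1 A0] cvgx e e0; pose delta := e / 4; have d0 : 0 < delta by rewrite divr_gt0.
have [a1 ha1] : exists a : R, forall y, a <= y -> 1 - delta <= Phi y.
  have /cvgrPdist_le/(_ _ d0) [a [_ ha]] := @Phi_cvgy R.
  exists (a + 1) => y ay; have ya1 : a < y by lra.
  have := ha y ya1.
  by rewrite ler_norml => /andP[]; lra.
have [a2 ha2] : exists a : R, forall y, y <= a -> Phi y <= delta.
  have /cvgrPdist_le/(_ _ d0) [a [_ ha]] := @Phi_cvgNy R.
  exists (a - 1) => y ya.
  have ya1 : y < a by lra.
  have := ha y ya1.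
  by rewrite ler_norml => /andP[]; lra.
(* The width has to be small against |c - z|, for the comparison with the indicator, and against
   delta / |c|, for [Phi_std_near]. *)
have choose_eps (r c : R) : 0 < r -> exists j : nat, j.+1%:R^-1 <= r /\ `|c| * j.+1%:R^-1 <= delta.
  move=> r0; have [j hj] : exists j : nat, j.+1%:R^-1 <= Num.min r (delta / (`|c| + 1)).
    by apply: inv_succ_le; rewrite lt_min r0 divr_gt0 // ltr_wpDl.
  exists j; move: hj; rewrite le_min => /andP[-> h2]; split=> //.
  have c1 : 0 < `|c| + 1 by rewrite ltr_wpDl.
  rewrite ler_pdivlMr // in h2; have : 0 <= j.+1%:R^-1 :> R by rewrite invr_ge0.
  by move: (j.+1%:R^-1) h2 => u; rewrite mulrDr mulr1 [u * _]mulrC; lra.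
have eps01 j : 0 < (j.+1%:R^-1 : R) <= 1.
  by rewrite invr_gt0 ltr0Sn /= invf_le1 // ler1n.
have [c1 /[!in_itv]/= /andP[c1z c1d]] : exists c : rat, ratr c \in `]z, (z + delta)[.
  have zd : z < z + delta by rewrite ltrDl.
  by have [c hc] := rat_in_itvoo zd; exists c.
have [c2 /[!in_itv]/= /andP[c2d c2z]] : exists c : rat, ratr c \in `](z - delta), z[.
  have zd : z - delta < z by rewrite gtrBl.
  by have [c hc] := rat_in_itvoo zd; exists c.
have [j1 [r1 s1]] := choose_eps ((ratr c1 - z) / (`|a1| + 1)) (ratr c1) ltac:(
  by rewrite divr_gt0 ?subr_gt0 // ltr_wpDl).
have [j2 [r2 s2]] := choose_eps ((z - ratr c2) / (`|a2| + 1)) (ratr c2) ltac:(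
  by rewrite divr_gt0 ?subr_gt0 // ltr_wpDl).
have [m1 h1] := cvgx c1 j1 _ d0; have [m2 h2] := cvgx c2 j2 _ d0.
exists (maxn n1 (maxn m1 m2)) => m; rewrite !geq_max => /and3P[mn1 /h1 {}h1 /h2 {}h2].
have Ap := A0 m mn1.
have p1 : `|ratr c1 - z| <= delta by rewrite ger0_norm ?subr_ge0 ?lerBlDl ltW.
have p2 : `|ratr c2 - z| <= delta by rewrite distrC ger0_norm ?subr_ge0 ?lerBlDl -?lerBlDr ltW.
have near1 := Phi_std_near p1 (eps01 j1) s1.
have near2 := Phi_std_near p2 (eps01 j2) s2.
have up : quenched_mean beta m.+2 (fun y => (y <= z)%R%:R) x <=
    quenched_mean beta m.+2 (test_fun (ratr c1) j1.+1%:R^-1) x + delta.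
  apply: quenched_mean_le => // y; case: (lerP y z) => yz /=; last first.
    by rewrite addr_ge0 ?Phi_ge0 ?ltW.
  rewrite -lerBlDr; apply: ha1; rewrite invrK.
  apply: (@le_trans _ _ ((ratr c1 - z) * j1.+1%:R)); last by rewrite ler_wpM2r // lerD2l lerN2.
  have g0 : 0 < j1.+1%:R :> R by [].
  rewrite ler_pdivlMr ?ltr_wpDl // in r1.
  move: r1; rewrite mulrC ler_pdivrMr // => r1; apply: le_trans r1.
  by apply: le_trans (ler_norm _) _; rewrite lerDl.
have low : quenched_mean beta m.+2 (test_fun (ratr c2) j2.+1%:R^-1) x <=
    quenched_mean beta m.+2 (fun y => (y <= z)%R%:R) x + delta.
  apply: quenched_mean_le => // y; case: (lerP y z) => yz /=.
    by apply: le_trans (Phi_le1 _) _; rewrite lerDl ltW.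
  rewrite add0r; apply: ha2; rewrite invrK.
  apply: (@le_trans _ _ ((ratr c2 - z) * j2.+1%:R)).
    by rewrite ler_wpM2r // lerD2l lerN2 ltW.
  rewrite ler_pdivlMr ?ltr_wpDl // in r2.
  move: r2; rewrite mulrC ler_pdivrMr // => r2.
  rewrite -opprB mulNr lerNl; apply: le_trans r2.
  by apply: le_trans (ler_norm _) _; rewrite normrN lerDl.
(* One delta for the comparison with the indicator, one for the convergence of the test function,
   two for [Phi_std_near]. *)
have eE : e = 4 * delta by rewrite /delta; field.
move: up low h1 h2 near1 near2; rewrite eE.
move: (quenched_mean beta m.+2 (test_fun (ratr c1) j1.+1%:R^-1) x)
  (quenched_mean beta m.+2 (test_fun (ratr c2) j2.+1%:R^-1) x)
  (quenched_mean beta m.+2 (fun y => (y <= z)%R%:R) x)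
  (Phi (ratr c1 / Num.sqrt (j1.+1%:R^-1 ^+ 2 + 1)))
  (Phi (ratr c2 / Num.sqrt (j2.+1%:R^-1 ^+ 2 + 1))) (Phi z) => q1 q2 q f1 f2 f.
move: (delta) d0 => u; clear=> u0 up low; rewrite !ler_norml.
by move=> /andP[b1 b2] /andP[b3 b4] /andP[b5 b6] /andP[b7 b8]; apply/andP; split; lra.
Qed.

End Convergence.

Section QuenchedLimit.
Context {R : realType} {d : measure_display} {T : measurableType d} (P : probability T R).
Variables (beta p M0 : R) (w : nat -> nat -> {RV P >-> R}).
Hypothesis beta01 : 0 < beta < 1.
Hypothesis p_gt12 : 12 < p.
Hypothesis M0_gt0 : 0 < M0.
Hypothesis w_indep : mutually_independent
  [set k : nat * nat | (1 <= k.1)%N /\ (1 <= k.2)%N] (fun k => w k.1 k.2).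
Hypothesis w_mean : forall i j : nat, (1 <= i)%N -> (1 <= j)%N -> ('E_P[w i j] = 0)%E.
Hypothesis w_var : forall i j : nat, (1 <= i)%N -> (1 <= j)%N ->
  ('E_P[fun omega => (w i j omega ^+ 2)%R] = 1)%E.
Hypothesis w_moment : forall i j : nat, (1 <= i)%N -> (1 <= j)%N ->
  ('E_P[fun omega => (`|w i j omega| `^ p)%R] <= M0%:E)%E.

Lemma annealed_cvg (c eps delta : R) : 0 < eps -> 0 < delta ->
  exists n0, forall m, (n0 <= m)%N ->
    `|annealed beta w c eps m.+2 - Phi (c / Num.sqrt (eps ^+ 2 + 1))| <= delta.
Proof.
move=> e0 d0; have [C1 [n1 [_ col]]] := collisions beta01.
pose E := eps^-1; have E0 : 0 <= E by rewrite invr_ge0 ltW.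
pose B := 5 * (1 + M0); pose m3 := 1 + cell_moment M0.
have B0 : 0 <= B by rewrite /B; have := M0_gt0; lra.
have m30 : 0 <= m3 by rewrite /m3; have := cell_moment_ge1 M0_gt0; lra.
pose C := 2 * E * B + E ^+ 2 * B + 3 * E ^+ 3 * m3 + 3 * E ^+ 4 * (1 + E ^+ 2).
have E2 : 0 <= E ^+ 2 by rewrite exprn_ge0.
have E3 : 0 <= E ^+ 3 by rewrite exprn_ge0.
have E4 : 0 <= E ^+ 4 by rewrite exprn_ge0.
have t1 : 0 <= E * B by rewrite mulr_ge0.
have t2 : 0 <= E ^+ 2 * B by rewrite mulr_ge0.
have t3 : 0 <= E ^+ 3 * m3 by rewrite mulr_ge0.
have t4 : 0 <= E ^+ 4 * (1 + E ^+ 2) by rewrite mulr_ge0 // addr_ge0.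
have C0 : 0 <= C by rewrite /C; lra.
have [n2 small] := inv_sqrt_eventually_le C0 d0.
exists (maxn n1 n2) => m; rewrite geq_max => /andP[mn1 mn2].
have [A0 _] := col m mn1; apply: le_trans (small m mn2).
have N0 : (0 < m.+2)%N by [].
have [nh2 h0 hs nh s2] := @normalizer_bounds R m.
have N1 : 1 <= m.+2%:R :> R by rewrite ler1n.
have b0 : 0 <= 5 / m.+2%:R * (1 + M0) :> R.
  by rewrite mulrAC divr_ge0.
have q0 k a (_ : (1 <= k.1)%N && (1 <= k.2)%N) := cell_prob_ge0 w k (N := m.+2) a.
have q1 k (_ : (1 <= k.1)%N && (1 <= k.2)%N) := sum_cell_prob w N0 k.
apply: le_trans (annealed_mean q0 q1 c e0 A0
  (avg_cell_mean p_gt12 w_mean w_moment N0) (avg_cell_sqr p_gt12 w_var w_moment N0)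
  (avg_cell_cube p_gt12 M0_gt0 w_moment N0) b0 b0 m30) _.
have -> : 5 / m.+2%:R * (1 + M0) = B * (Num.sqrt m.+2%:R)^-1 ^+ 2 by rewrite s2 /B; ring.
have s0 : 0 < (Num.sqrt m.+2%:R)^-1 :> R by rewrite invr_gt0 sqrtr_gt0; lra.
have s1 : (Num.sqrt m.+2%:R)^-1 <= 1 :> R.
  by rewrite invf_le1 ?sqrtr_gt0 -?[leLHS]sqrtr1 ?ler_wsqrtr //; lra.
rewrite -/E -/m3.
move: (Num.sqrt m.+2%:R)^-1 (Num.sqrt (2 * m.+2%:R - 1))^-1 (m.+2.*2.-1)%:R
  s0 s1 hs h0 nh nh2 => s h n s0 s1 hs h0 nh nh2.
(* The factor n is compensated by h^2, except in the term of the mean, which has a single h: there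
   the rounding bias O(s^2) supplies one s for n h s <= 2 and leaves another. *)
have -> : n * (h * E * (B * s ^+ 2) + (h * E) ^+ 2 * (B * s ^+ 2) + 3 * (h * E) ^+ 3 * m3 +
     3 * (h * E) ^+ 4 * (1 + (h * E) ^+ 2)) =
  n * h * s * (E * B * s) + n * h ^+ 2 * (E ^+ 2 * B * s ^+ 2 + 3 * (E ^+ 3 * m3) * h +
    3 * E ^+ 4 * (h ^+ 2 * (1 + h ^+ 2 * E ^+ 2))) by ring.
rewrite nh2 mul1r.
have k1 : n * h * s * (E * B * s) <= 2 * (E * B * s).
  apply: ler_wpM2r; first by rewrite mulr_ge0 // ltW.
  by rewrite -ler_pdivlMr.
have hs2 : h ^+ 2 <= s.
  by rewrite expr2; apply: le_trans (ler_pM h0 h0 hs (le_trans hs s1)) _; rewrite mulr1.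
have ss : s ^+ 2 <= s by rewrite expr2 ler_piMr // ltW.
have k2 : E ^+ 2 * B * s ^+ 2 <= E ^+ 2 * B * s by rewrite ler_wpM2l.
have k3 : 3 * (E ^+ 3 * m3) * h <= 3 * (E ^+ 3 * m3) * s by rewrite ler_wpM2l // mulr_ge0.
have k4 : 3 * E ^+ 4 * (h ^+ 2 * (1 + h ^+ 2 * E ^+ 2)) <= 3 * E ^+ 4 * (s * (1 + E ^+ 2)).
  rewrite ler_wpM2l ?mulr_ge0 // ler_pM ?sqr_ge0 ?addr_ge0 ?mulr_ge0 ?sqr_ge0 // lerD2l ler_piMl //.
  exact: le_trans hs2 s1.
rewrite /C; lra.
Qed.

(** One null set has to serve all test functions and all accuracies: c is rational, the width and
    the accuracy are of the form 1 / (i + 1), and the triples are enumerated by [pickle]. *)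
Lemma quenched_mean_cvg :
  {ae P, forall t (c : rat) (j : nat) (delta : R), 0 < delta ->
    exists n0, forall m, (n0 <= m)%N ->
    `|quenched_mean beta m.+2 (test_fun (ratr c) j.+1%:R^-1) (fun k => w k.1 k.2 t) -
      Phi (ratr c / Num.sqrt (j.+1%:R^-1 ^+ 2 + 1))| <= delta}.
Proof.
have e0 j : 0 < (j.+1%:R^-1 : R) by rewrite invr_gt0.
pose good (n : nat) (t : T) := if unpickle n is Some (c, j, i) then
   exists m, forall n, (m <= n)%N ->
     ~ (large_weight w n.+2 `|` deviation beta w (ratr c) (j.+1%:R^-1) (i.+1%:R^-1) n.+2) t
  else True.
have : \forall t \ae P, forall n, good n t.
  apply: ae_foralln => n; rewrite /good.
  case: (unpickle n : option (rat * nat * nat)) => [[[c j] i]|]; last exact: aeW.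
  exact (eventually_good beta01 p_gt12 M0_gt0 w_indep w_moment _ (e0 j) (e0 i)).
apply: filterS => t gt c j delta d0.
have d3 : 0 < delta / 3 by rewrite divr_gt0.
have [i hi] := inv_succ_le d3.
have := gt (pickle (c, j, i)); rewrite /good pickleK => -[m1 h1].
have [m2 h2] := annealed_cvg (ratr c) (e0 j) d3.
have C0 : 0 <= j.+1%:R * 2 :> R by rewrite mulr_ge0.
have [m3 h3] := inv_sqrt_eventually_le C0 d3.
have [C1 [m4 [_ h4]]] := collisions beta01.
exists (maxn (maxn m1 m2) (maxn m3 m4)) => m; rewrite !geq_max.
move=> /andP[/andP[/h1 {}h1 /h2 {}h2] /andP[/h3 {}h3 mn4]].
have [A0 _] := h4 m mn4.
set F := quenched_mean _ _ _; set x := fun k : nat * nat => w k.1 k.2 t.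
have N0 : (0 < m.+2)%N by [].
have near_x k : k \in box m.+2 -> `|x k - rounded_env w m.+2 t k| <= m.+2%:R^-1.
  move=> kb; rewrite /rounded_env /splice kb /cell_env distrC; apply: grid_val_near => //.
  rewrite leNgt; apply/negP => large; apply: h1; left.
  by apply/hasP; exists k.
have Fx : `|F x - F (rounded_env w m.+2 t)| <= delta / 3.
  have iN0 : 0 <= m.+2%:R^-1 :> R by rewrite invr_ge0.
  have J0 : 0 <= (j.+1%:R^-1)^-1 :> R by rewrite invrK.
  apply: le_trans (quenched_mean_close J0 iN0 A0 (test_fun_lip (ratr c) (e0 j)) near_x) _.
  apply: le_trans h3; rewrite invrK mulrA mulrA -mulrA ler_wpM2l //.
  have s0 : Num.sqrt m.+2%:R != 0 :> R by rewrite gt_eqF // sqrtr_gt0.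
  rewrite -{2}[m.+2%:R](@sqr_sqrtr R) // le_eqVlt; apply/orP; left; apply/eqP.
  by field.
have dev : `|F (rounded_env w m.+2 t) - annealed beta w (ratr c) j.+1%:R^-1 m.+2| <= delta / 3.
  apply: le_trans hi; rewrite leNgt; apply/negP => dv; apply: h1; right.
  exact: ltW.
move: (F x) (F (rounded_env w m.+2 t)) (annealed _ _ _ _ _) (Phi _) h2 Fx dev => a1 a2 a3 a4 h2 Fx dev.
(* Rounding error, fluctuation around the annealed mean, and annealed error take delta / 3 each. *)
have -> : a1 - a4 = (a1 - a2) + (a2 - a3) + (a3 - a4) by ring.
apply: le_trans (ler_normD _ _) _; apply: le_trans (lerD (ler_normD _ _) h2) _.
apply: le_trans (lerD (lerD Fx dev) (lexx _)) _.
by rewrite le_eqVlt; apply/orP; left; apply/eqP; field.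
Qed.

End QuenchedLimit.

Theorem theorem1p3 (R : realType) (d : measure_display) (T : measurableType d)
    (P : probability T R) (beta p K : R)
    (w : nat -> nat -> {RV P >-> R})
    (hbeta : 0 < beta < 1) (hp : 12 < p) (hK : 0 < K)
    (hindep : mutually_independent
       [set k : nat * nat | (1 <= k.1)%N /\ (1 <= k.2)%N]
       (fun k : nat * nat => w k.1 k.2))
    (hmean : forall i j : nat, (1 <= i)%N -> (1 <= j)%N ->
       ('E_P[w i j] = 0)%E)
    (hvar : forall i j : nat, (1 <= i)%N -> (1 <= j)%N ->
       ('E_P[fun omega => (w i j omega ^+ 2)%R] = 1)%E)
    (hmoment : forall i j : nat, (1 <= i)%N -> (1 <= j)%N ->
       ('E_P[fun omega => (`|w i j omega| `^ p)%R] <= K%:E)%E) :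
  {ae P, forall omega : T,
    cvg_in_distribution
      (quenched_law beta (fun i j => w i j omega))
      (normal_prob 0 1)}.
Proof.
have := quenched_mean_cvg hbeta hp hK hindep hmean hvar hmoment.
apply: filterS => t cvgt z _; rewrite -PhiE.
under eq_fun => N do rewrite quenched_lawE.
apply: cvg_EFin; first by apply: nearW.
apply/cvgrPdist_le => e e0 /=.
have [C1 [n0 [_ col]]] := collisions hbeta.
have A0 : exists n0, forall m, (n0 <= m)%N -> (0 < #|frame_paths beta m.+2|)%N.
  by exists n0 => m /col [].
have [n1 h1] := quenched_mean_sandwich z A0 cvgt e0.
(* The estimates are stated for N = m + 2, so the sizes 0 and 1 are skipped. *)
exists n1.+2 => // -[|[|m]] //=; rewrite !ltnS; exact: h1.
Qed.
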